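(* Let $W\in C^1(\mathbb{R})$ satisfy $W(-1)=W(1)=0$ and $W(s)>0$ for $s\neq\pm1$. Let $a:\mathbb{R}\to\mathbb{R}$ be measurable and such that there exist $a_1,a_2\in\mathbb{R}$ with $0<a_1\le a(t)\le a_2$ for all $t\in\mathbb{R}$. Suppose also that $a$ is $T$-periodic for some $T>0$. Then $\mathcal{L}_a$ attains its infimum over $\mathcal{X}_1$ at some $u_a\in\mathcal{X}_1$. Moreover, $u_a$ is a heteroclinic $C^1\cap W^{2,2}_{\mathrm{loc}}$ solution of $$\left(\frac{u'}{\sqrt{1-|u'|^2}}\right)'=a(t)W'(u)\quad\text{in }\mathbb{R},\qquad \lim_{t\to\pm\infty}\big(u(t),u'(t)\big)=(\pm1,0),$$ and $\|u_a'\|_{L^\infty}<1$.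
   Context: The space is $$\mathcal{X}_1=\Big\{u\in W^{1,\infty}(\mathbb{R})\ :\ \|u'\|_{L^\infty}\le1\ \text{ and }\ \lim_{t\to\pm\infty}u(t)=\pm1\Big\},$$ and $$\mathcal{L}_a(u)=\int_{-\infty}^{+\infty}\Big(1-\sqrt{1-|u'|^2}+a(t)W(u)\Big)\,\mathrm{d}t .$$ *)

(* Defs.v *)
From HB Require Import structures.
From mathcomp Require Import all_boot all_order all_algebra.
From mathcomp Require Import all_classical all_reals all_analysis.
Set Implicit Arguments.
Unset Strict Implicit.
Unset Printing Implicit Defensive.
Import Order.TTheory GRing.Theory Num.Theory.
Import numFieldNormedType.Exports.

Local Open Scope classical_set_scope.
Local Open Scope ring_scope.

(* [lebesgue_measure] lives on the Borel sigma-algebra.  This is harmless for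
   functions taken up to a.e. equality (weak derivatives, L^2_loc, L^oo): every
   Lebesgue measurable class has a Borel representative.  The coefficient [a]
   of the problem is instead a pointwise given, merely Lebesgue measurable
   function, so its measurability and the action integral are taken with
   respect to [completed_lebesgue_measure]. *)
Definition lebesgue_measurable_type (R : realType) :=
  caratheodory_type ((wlength (@idfun R))^*)%mu.

Definition lebesgue_measurable_fun (R : realType) (f : R -> R) :=
  measurable_fun [set: lebesgue_measurable_type R] f.

Section sobolev.
Context {R : realType}.
Implicit Types u v f : R -> R.
Local Notation mu := (@lebesgue_measure R).

Definition C1 f := (forall x, derivable f x 1) /\ continuous (derive1 f).

Definition test_function f :=
  (forall n x, derivable (derive1n n f) x 1) /\ compact (closure [set x | f x != 0]).

Definition is_weak_derivative u v :=
  [/\ locally_integrable [set: R] u, locally_integrable [set: R] v &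
      forall phi, test_function phi ->
        \int[mu]_x (u x * derive1 phi x) = - \int[mu]_x (v x * phi x)].

(* A choice of representative of the weak derivative, which is unique up to
   a.e. equality when it exists; junk value otherwise. *)
Definition weak_derivative u : R -> R :=
  xget (cst 0) [set v | is_weak_derivative u v].

Definition W1oo u :=
  u \in Lfun mu +oo%E /\
  exists v, is_weak_derivative u v /\ v \in Lfun mu +oo%E.

Definition L2loc f :=
  measurable_fun [set: R] f /\ locally_integrable [set: R] (fun x => f x ^+ 2).

Definition W22loc u :=
  exists v w, [/\ is_weak_derivative u v, is_weak_derivative v w,
                  L2loc u, L2loc v & L2loc w].

(* An element of W^{1,oo}(R) is represented by its continuous representative;
   without it the limits at infinity would not make sense pointwise. *)
Definition X1 : set (R -> R) :=
  [set u | [/\ W1oo u, continuous u,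
               ('N[mu]_+oo[EFin \o weak_derivative u] <= 1)%E,
               u t @[t --> +oo] --> (1 : R) &
               u t @[t --> -oo] --> (-1 : R)]].

Definition action (a W : R -> R) u : \bar R :=
  (\int[@completed_lebesgue_measure R]_t
     (1 - Num.sqrt (1 - `|weak_derivative u t| ^+ 2) + a t * W (u t))%:E)%E.

(* The equation (u' / sqrt (1 - |u'|^2))' = a(t) W'(u), for u of class C^1:
   the flux is weakly differentiable and the equation holds a.e. *)
Definition solves_equation (a W : R -> R) u :=
  exists g, is_weak_derivative
      (fun t => derive1 u t / Num.sqrt (1 - `|derive1 u t| ^+ 2)) g /\
    {ae mu, forall t, g t = a t * derive1 W (u t)}.

End sobolev.

(* Main.v *)
Require Import Defs.
From HB Require Import structures.
From mathcomp Require Import all_boot all_order all_algebra.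
From mathcomp Require Import all_classical all_reals all_analysis.
From mathcomp Require Import measurable_realfun ess_sup_inf.
From mathcomp Require Import lra ring.
Import Order.TTheory GRing.Theory Num.Theory.
Import numFieldNormedType.Exports.
Local Open Scope classical_set_scope.
Local Open Scope ring_scope.

(** Write [born p = 1 - sqrt (1 - p^2)].  The function spaces disappear first:
    an element of [X1] is exactly a 1-Lipschitz function with limits -1 and 1
    ([X1P]), its weak derivative is its almost everywhere derivative
    ([ae_weak_derivativeE]), and the action is the Borel integral [energy] of
    [born u' + b W u] for a Borel function [b] equal to [a] almost everywhere
    ([borel_representative], [actionE]).

    Existence is the direct method.  Truncating to [[-1, 1]] does not increase
    the energy and translating by a multiple of the period does not change it, so
    there is a minimizing sequence of functions with values in [[-1, 1]] whose last
    zero lies in [[0, T]].  The slope constraint makes it equi-Lipschitz, hence a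
    subsequence converges locally uniformly to some [u].  The energy is lower
    semicontinuous ([energy_lsc]): the difference quotients of the sequence
    converge pointwise, Fatou's lemma applies to them, and by Jensen's inequality
    they have no more energy than the derivative.  Finite energy forces [W u] to 0 at
    infinity, and [u >= 0] to the right of [T], so [u] tends to 1 at +oo.  What could
    be lost is the limit -1 at -oo: [u] might stay close to 1.  But a function
    close to 1 long before its last zero wastes a fixed amount of energy, since it
    could have climbed to 1 at once ([early_climb]); hence [u <= 1 - e] to the left
    of 0, and [u] tends to -1 there.

    Regularity has to face that [born] is not differentiable where [|u'| = 1], a
    set not known to be null in advance.  It is obtained from convexity instead
    of from the Euler-Lagrange equation.  Let [G] be a primitive of the force
    [b W'(u)] and [velocity q = q / sqrt (1 + q^2)] the inverse of the flux.  On a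
    window [[-r, r]] choose [c] so that [velocity (G + c)] has the same integral as
    [u'], and let [v] be the competitor with this slope in the window and equal to
    [u] outside.  Moving from [u] towards [v], minimality and the convexity of
    [born] give ([first_variation])
      0 <= int born v' - born u' + b W'(u) (v - u).
    Integrating by parts the last term, this says that the integral of
    [born p - (G + c) p] is at most as large for [p = u'] as for [p = v'].  By
    Young's inequality ([born_young]) the latter minimizes the integrand at every
    point, and uniquely so, whence [u' = velocity (G + c)] almost everywhere in the
    window ([euler_window]).  The constant is the same for all windows, so
    [u' = velocity (G + c)] everywhere ([minimizer_is_derive]).  All remaining claims
    are read off from this formula: [u'] is Lipschitz, the flux of [u'] is [G + c],
    [|u'| < 1] pointwise, and [u'] vanishes at infinity because [u] converges and
    [u'] is Lipschitz; so [|u'|] is bounded away from 1. *)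

Set Implicit Arguments.
Unset Strict Implicit.
Unset Printing Implicit Defensive.

(** * Lipschitz functions as integrals of their derivatives *)

Section LipschitzDensity.
Context {R : realType}.
Notation mu := (@lebesgue_measure R).
Implicit Types (f g w : R -> R) (K L : R).

Definition lip K f := forall x y, `|f x - f y| <= K * `|x - y|.

Lemma lip_continuous K f : lip K f -> continuous f.
Proof.
move=> fK x; apply/cvgrPdist_le => e e0; near=> y.
have K1 : 0 < `|K| + 1 by rewrite ltr_wpDl.
apply: (le_trans (fK x y)); apply: (@le_trans _ _ ((`|K| + 1) * `|x - y|)).
  by apply: ler_wpM2r => //; rewrite (le_trans (ler_norm _))// lerDl.
rewrite -ler_pdivlMl// mulrC; near: y.
by apply: (@cvgr_dist_le _ _ _ _ _ id x) => //; rewrite divr_gt0.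
Unshelve. all: by end_near. Qed.

Lemma ae_imp (P Q : R -> Prop) : (forall x, P x -> Q x) ->
  {ae mu, forall x, P x} -> {ae mu, forall x, Q x}.
Proof. by move=> PQ; apply: filterS; first exact: (ae_filter_ringOfSetsType mu). Qed.

Lemma ae_imp2 (P Q S : R -> Prop) : (forall x, P x -> Q x -> S x) ->
  {ae mu, forall x, P x} -> {ae mu, forall x, Q x} -> {ae mu, forall x, S x}.
Proof. by move=> PQ; apply: filterS2; first exact: (ae_filter_ringOfSetsType mu). Qed.

(** Both measures are infima over the same countable covers, so domination on
    half-open intervals passes to every set. *)
Lemma stieltjes_le_lebesgue (f : cumulative R R) L (A : set R) : 0 < L ->
  (forall x y, x <= y -> f y - f x <= L * (y - x)) ->
  (lebesgue_stieltjes_measure f A <= L%:E * mu A)%E.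
Proof.
move=> L0 fL; rewrite -lee_pdivrMl//.
apply: le_ereal_inf_tmp => _ [B [mB AB] <-].
rewrite lee_pdivrMl//.
apply: (@le_trans _ _ (\sum_(0 <= k <oo) wlength f (B k))%E).
  by apply: ereal_inf_lbound; exists B.
rewrite -nneseriesZl//.
apply: lee_nneseries; [by move=> i _ _; exact: wlength_ge0|move=> i _].
have [[a b] _ /= <-] := mB i.
have [ab|ba] := leP a b; last first.
  by rewrite set_itv_ge ?wlength0 ?mule0// bnd_simp -leNgt ltW.
by rewrite !wlength_itv_bnd// -EFinM lee_fin fL.
Qed.

(** A nondecreasing Lipschitz [f] defines a Stieltjes measure dominated by a
    multiple of the Lebesgue measure; [h] is its Radon-Nikodym density. *)
Lemma nondecreasing_lip_density L f (a b : R) : a < b -> 0 < L ->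
  nondecreasing f -> (forall x y, x <= y -> f y - f x <= L * (y - x)) ->
  exists2 h : R -> R, mu.-integrable setT (EFin \o h) &
  forall x, a <= x <= b -> \int[mu]_(t in `]a, x]) h t = f x - f a.
Proof.
move=> ab L0 f_nd fL.
have f_cts : right_continuous f.
  move=> x; apply: cvg_at_right_filter; apply: (@lip_continuous L) => {}x y.
  have [xy|/ltW yx] := leP x y.
    by rewrite distrC ger0_norm ?subr_ge0 ?f_nd// (distrC x) ger0_norm ?subr_ge0 ?fL.
  by rewrite !ger0_norm ?subr_ge0 ?f_nd// fL.
pose mixin := isCumulative.Build R _ R f f_nd f_cts.
pose fc : cumulative R R := HB.pack f mixin.
pose nu := lebesgue_stieltjes_measure fc.
have nu_mu A : (nu A <= L%:E * mu A)%E by exact: stieltjes_le_lebesgue.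
have mab : measurable (`]a, b] : set (measurableTypeR R)) by exact: measurable_itv.
have nufin : (nu `]a, b]%classic < +oo)%E.
  apply: (le_lt_trans (nu_mu _)); rewrite lebesgue_measure_itv/= lte_fin ab.
  by rewrite -EFinB -EFinM ltry.
pose nuab : {finite_measure set (measurableTypeR R) -> \bar R} := mfrestr mab nufin.
have nuabmu : nuab `<< mu.
  apply/null_content_dominatesP => A mA A0.
  apply/eqP; rewrite eq_le measure_ge0 andbT.
  apply: (@le_trans _ _ (nu A)).
    by apply: le_measure; rewrite ?inE//; exact: measurableI.
  by apply: (le_trans (nu_mu _)); rewrite A0 mule0.
have [h [h0 hfin hint nuE]] := radon_nikodym_sigma_finite nuabmu.
have hfine : EFin \o (fine \o h) = h by apply/funext => x /=; rewrite fineK.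
exists (fine \o h); first by rewrite hfine.
move=> x /andP[ax xb].
rewrite /Rintegral (_ : (fun t => _) = h)//.
rewrite -nuE; last exact: measurable_itv.
rewrite /nuab /= /mfrestr /mrestr setIidl; last first.
  by move=> t /=; rewrite !in_itv/= => /andP[->]/= /le_trans ->.
rewrite /nu /lebesgue_stieltjes_measure /measure_extension measurable_mu_extE/=.
  by rewrite wlength_itv_bnd.
exact: is_ocitv.
Qed.

Lemma bounded_integrable_itv f K (a b : R) (x y : bool) :
  measurable_fun setT f -> (forall t, `|f t| <= K) ->
  mu.-integrable [set` Interval (BSide x a) (BSide y b)] (EFin \o f).
Proof.
move=> mf fK; apply: measurable_bounded_integrable.
- exact: measurable_itv.
- apply: (@le_lt_trans _ _ (mu [set` Interval (BSide x a) (BSide y b)])) => //.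
  by rewrite lebesgue_measure_itv/=; case: ifP => _; rewrite -?EFinB ltry.
- exact: measurable_funS mf.
- exists K; split; first exact: num_real.
  by move=> M KM t _ /=; apply: (le_trans (fK t)); exact: ltW.
Qed.

(** Adding a linear function of large slope makes [f] nondecreasing, so it is
    the integral of a density, to which Lebesgue's differentiation theorem
    applies. *)
Lemma lip_ae_derivable_itv K f (a b : R) : a < b -> lip K f ->
  exists2 g : R -> R, mu.-integrable `]a, b] (EFin \o g) &
  \int[mu]_(t in `]a, b]) g t = f b - f a /\
  {ae mu, forall x, a < x < b -> derivable f x 1 /\ derive1 f x = g x}.
Proof.
move=> ab fK.
pose L := `|K| + 1; pose F x := f x + L * x.
have L0 : 0 < L by rewrite /L ltr_wpDl.
have fL x y : x <= y -> `|f y - f x| <= L * (y - x).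
  move=> xy; apply: (le_trans (fK _ _)); rewrite (@ger0_norm _ (y - x)) ?subr_ge0//.
  by apply: ler_wpM2r; rewrite ?subr_ge0// /L (le_trans (ler_norm _))// lerDl.
have F_nd : nondecreasing F.
  move=> x y xy; rewrite /F.
  have := fL _ _ xy; rewrite ler_norml => /andP[+ _].
  by rewrite mulrBr; lra.
have F_lip x y : x <= y -> F y - F x <= (2 * L) * (y - x).
  move=> xy; rewrite /F.
  have := fL _ _ xy; rewrite ler_norml => /andP[_].
  by rewrite !mulrBr; lra.
have L20 : 0 < 2 * L by rewrite mulr_gt0.
have [h hint hF] := nondecreasing_lip_density ab L20 F_nd F_lip.
have hab : mu.-integrable `]a, b] (EFin \o h).
  by apply: integrableS hint => //; exact: measurable_itv.
have iL : mu.-integrable `]a, b] (EFin \o (fun=> L)).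
  by apply: (@bounded_integrable_itv _ `|L|).
exists (fun x => h x - L).
  rewrite (_ : _ \o _ = (EFin \o h) \- (EFin \o (fun=> L)))%E; last first.
    by apply/funext => x /=; rewrite EFinB.
  by apply: integrableB.
split.
  rewrite RintegralB//= hF ?lexx ?ltW// Rintegral_cst//= lebesgue_measure_itv/=.
  by rewrite lte_fin ab -EFinB /= /F mulrBr; lra.
have loch : locally_integrable setT h by exact: open_integrable_locally openT hint.
have := @FTC1 _ h (BRight a) _ loch.
have ih y : mu.-integrable `]a, y] (EFin \o h) by exact: integrableS hint.
move=> /(_ ih) /=; apply: ae_imp => x /[swap] /andP[ax xb] /(_ _)[].
  by rewrite lte_fin.
move=> dx dE.
pose G := (fun x => \int[mu]_(t in `]a, x]) h t) : R -> R.
have fE : \near x, G x + (F a - L * x) = f x.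
  near=> y; rewrite /G hF.
    by rewrite /F; lra.
  by apply/andP; split; apply: ltW; near: y; [exact: lt_nbhsr|exact: lt_nbhsl].
have dlin : is_derive x (1 : R) (fun y => F a - L * y) (- L).
  have -> : - L = 0 - L *: 1 by rewrite sub0r /GRing.scale/= mulr1.
  by apply: is_deriveB.
have dG : is_derive x (1:R) G (h x) by rewrite -dE derive1E; exact: derivableP.
have dsum : is_derive x (1 : R) (fun y => G y + (F a - L * y)) (h x - L).
  exact: is_deriveD.
have df : is_derive x (1:R) f (h x - L).
  by apply: (near_eq_is_derive _ dsum).
split; first exact: ex_derive.
by rewrite derive1E; exact: derive_val.
Unshelve. all: by end_near. Qed.

Lemma lip_ae_derivable K f : lip K f -> {ae mu, forall x, derivable f x 1}.
Proof.
move=> fK.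
have : {ae mu, forall x, forall n : nat, - n.+1%:R < x < n.+1%:R -> derivable f x 1}.
  apply: ae_foralln => n.
  have nn : - n.+1%:R < n.+1%:R :> R by rewrite gtrN.
  have [g _ [_]] := lip_ae_derivable_itv nn fK.
  by apply: ae_imp => x h /h[].
apply: ae_imp => x /(_ (Num.bound `|x|)); apply; rewrite -ltr_norml.
by rewrite (lt_trans (archi_boundP _))// ltr_nat.
Qed.

(** The upper limit of difference quotients is a Borel function defined at every
    point, and equals the derivative wherever the latter exists. *)
Definition lip_derive f t : R :=
  limn_sup (fun n => n.+1%:R * (f (t + n.+1%:R^-1) - f t)).

Lemma cvg_diff_quotient f t : derivable f t 1 ->
  n.+1%:R * (f (t + n.+1%:R^-1) - f t) @[n --> \oo] --> derive1 f t.
Proof.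
move=> ft.
have /cvg_ex[l] := ft.
rewrite derive1E /derive => fl; rewrite (cvg_lim _ fl)//.
have inv0 : (forall n, n.+1%:R^-1 != 0 :> R) /\ n.+1%:R^-1 @[n --> \oo] --> (0 : R).
  by split; [move=> n; rewrite invr_eq0 pnatr_eq0|exact: cvg_harmonic].
have := (cvgr_dnbhsP _ _ _).1 fl _ inv0.
apply: cvg_trans; apply: near_eq_cvg; near=> n => /=.
by rewrite invrK [X in f (X + _)]mulr1 (addrC _ t).
Unshelve. all: by end_near. Qed.

Lemma lip_derive_derivable f t : derivable f t 1 -> lip_derive f t = derive1 f t.
Proof. by move=> /cvg_diff_quotient cf; exact: (cvg_limn_inf_sup cf).2. Qed.

(** Stated without dividing by [z], which may be 0. *)
Lemma cvg_scaled_increment (f : R -> R) (x z : R) : derivable f x 1 ->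
  n.+1%:R * (f (x + n.+1%:R^-1 * z) - f x) @[n --> \oo] --> derive1 f x * z.
Proof.
move=> dfx.
pose phi (h : R) := f (x + h * z).
have dh : is_derive (0 : R) (1 : R) (fun h : R => x + h * z) z.
  have := @is_deriveD _ _ _ (cst x) (fun h : R => h * z) 0 1 0 z.
  rewrite add0r; apply.
  have := @is_deriveM _ _ (@id R) (cst z) 0 1 1 0 _ _.
  move=> /(_ (is_derive_id _ _) (is_derive_cst _ _ _)).
  by rewrite /GRing.scale/= mulr0 add0r mulr1.
have df : is_derive (x + 0 * z) (1 : R) f (derive1 f x).
  by rewrite mul0r addr0 derive1E; exact: derivableP.
have dphi : is_derive (0 : R) (1 : R) phi (derive1 f x * z).
  exact: (@is_derive1_comp R f (fun h : R => x + h * z)).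
have := cvg_diff_quotient (f := phi) (@ex_derive _ _ _ _ _ _ _ dphi).
have -> : derive1 phi 0 = derive1 f x * z by rewrite [LHS]derive1E derive_val.
apply: cvg_trans; apply: near_eq_cvg; apply: nearW => n.
by rewrite /phi mul0r addr0 add0r.
Qed.

Lemma lip_derive_val f t (d : R) : is_derive t (1 : R) f d -> lip_derive f t = d.
Proof.
move=> df; rewrite lip_derive_derivable; last exact: ex_derive.
by rewrite derive1E derive_val.
Qed.

Lemma lip_quotient K f t (n : nat) : lip K f ->
  `|n.+1%:R * (f (t + n.+1%:R^-1) - f t)| <= K.
Proof.
move=> fK; rewrite normrM gtr0_norm// -ler_pdivlMl// mulrC.
by apply: (le_trans (fK _ _)); rewrite addrAC subrr add0r gtr0_norm.
Qed.

Lemma lip_derive_bound K f t : lip K f -> `|lip_derive f t| <= K.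
Proof.
move=> fK; rewrite /lip_derive; set u := (X in limn_sup X).
have uK n : `|u n| <= K by exact: lip_quotient.
have ub n : has_ubound (sdrop u n).
  by exists K => _ [m _ <-]; exact: le_trans (ler_norm _) (uK m).
have lb n : has_lbound (sdrop u n).
  by exists (- K) => _ [m _ <-]; have := uK m; rewrite ler_norml => /andP[].
have supsK n : - K <= sups u n <= K.
  apply/andP; split.
    apply: (@le_trans _ _ (u n)).
      by have := uK n; rewrite ler_norml => /andP[].
    by apply: ub_le_sup => //; exists n => /=.
  apply: ge_sup; first by exists (u n), n => /=.
  by move=> _ [m _ <-]; exact: le_trans (ler_norm _) (uK m).
have cu : cvgn (sups u).
  apply: cvgP (cvg_sups_inf _ _).
    by exists K => _ [m _ <-]; exact: le_trans (ler_norm _) (uK m).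
  by exists (- K) => _ [m _ <-]; have := uK m; rewrite ler_norml => /andP[].
rewrite ler_norml; apply/andP; split.
  by apply: limr_ge => //; near=> n; have /andP[] := supsK n.
by apply: limr_le => //; near=> n; have /andP[] := supsK n.
Unshelve. all: by end_near. Qed.

Lemma measurable_lip K f : lip K f -> measurable_fun setT f.
Proof. by move=> fK; apply: continuous_measurable_fun; exact: lip_continuous fK. Qed.

Lemma measurable_lip_derive K f : lip K f -> measurable_fun setT (lip_derive f).
Proof.
move=> fK; apply: measurable_fun_limn_sup.
- move=> t _; exists K => _ [n _ <-].
  by apply: (le_trans (ler_norm _)); exact: lip_quotient.
- move=> t _; exists (- K) => _ [n _ <-].
  by have := lip_quotient t n fK; rewrite ler_norml => /andP[].
- move=> n; apply: measurable_funM => //; apply: measurable_funB.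
    apply: measurableT_comp; first exact: measurable_lip fK.
    exact: measurable_funD.
  exact: measurable_lip fK.
Qed.

Lemma integrable_lip_derive K f (a b : R) (x y : bool) : lip K f ->
  mu.-integrable [set` Interval (BSide x a) (BSide y b)] (EFin \o lip_derive f).
Proof.
move=> fK; apply: (@bounded_integrable_itv _ K).
  exact: measurable_lip_derive fK.
by move=> t; exact: lip_derive_bound.
Qed.

Lemma ae_is_derive_lip K f : lip K f ->
  {ae mu, forall x, is_derive x (1 : R) f (lip_derive f x)}.
Proof.
move=> fK; apply: ae_imp (lip_ae_derivable fK) => x fx.
by rewrite lip_derive_derivable// derive1E; exact: derivableP.
Qed.

Lemma ae_neq (a : R) : {ae mu, forall x, x != a}.
Proof.
exists [set a]; split; [exact: measurable_set1|exact: lebesgue_measure_set1|].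
by move=> x /= /negP; rewrite negbK => /eqP.
Qed.

Lemma ae_witness (P : R -> Prop) (x y : R) : x < y -> {ae mu, forall t, P t} ->
  exists2 t, x <= t <= y & P t.
Proof.
move=> xy [N [mN N0 PN]]; apply: contrapT => nP.
have : (mu `[x, y]%classic <= mu N)%E.
  apply: le_measure; rewrite ?inE//.
  move=> t; rewrite /= in_itv/= => txy; apply: PN => Pt; apply: nP; by exists t.
have -> : mu `[x, y]%classic = (y - x)%:E.
  by rewrite lebesgue_measure_itv/= lte_fin xy -EFinB.
by move: xy; rewrite [mu N]N0 lee_fin subr_le0 ltNge => /negbTE ->.
Qed.

Lemma Rintegral_ae_eq (A : set R) f g : measurable A ->
  measurable_fun A f -> measurable_fun A g ->
  {ae mu, forall x, A x -> f x = g x} ->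
  \int[mu]_(x in A) f x = \int[mu]_(x in A) g x.
Proof.
move=> mA mf mg fg; rewrite /Rintegral; congr fine; apply: ae_eq_integral => //.
- exact/measurable_EFinP.
- exact/measurable_EFinP.
- by apply: ae_imp fg => x h /h ->.
Qed.

Lemma lip_FTC K f (a b : R) : a <= b -> lip K f ->
  \int[mu]_(x in `[a, b]) lip_derive f x = f b - f a.
Proof.
rewrite le_eqVlt => /predU1P[<- _|ab fK].
  by rewrite set_itv1 Rintegral_set1 subrr.
have [g ig [<- dg]] := lip_ae_derivable_itv ab fK.
rewrite -Rintegral_itv_obnd_cbnd; last exact: integrable_lip_derive fK.
apply: Rintegral_ae_eq.
- exact: measurable_itv.
- by apply: measurable_funTS; exact: measurable_lip_derive fK.
- by case/integrableP : ig => /measurable_EFinP.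
- apply: ae_imp2 dg (ae_neq b) => x h xb; rewrite /= in_itv/= => /andP[ax xb'].
  by have [|dx <-] := h _; [rewrite ax lt_neqAle xb|exact: lip_derive_derivable].
Qed.

Definition clamp (a b x : R) : R := Num.max a (Num.min b x).

Lemma clamp_itv a b x : a <= b -> a <= clamp a b x <= b.
Proof. by move=> ab; rewrite /clamp le_max lexx ge_max ab ge_min lexx. Qed.

Lemma clamp_id a b x : a <= x <= b -> clamp a b x = x.
Proof. by move=> /andP[ax xb]; rewrite /clamp (min_idPr xb) (max_idPr ax). Qed.

Lemma clamp_contraction a b x y : `|clamp a b x - clamp a b y| <= `|x - y|.
Proof.
have h1 := ler_norm (x - y); have h2 := ler_norm (y - x); rewrite distrC in h2.
have h3 := normr_ge0 (x - y).
rewrite ler_norml /clamp /Num.max /Num.min.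
case: (ltP b x) => ?; case: (ltP b y) => ?; case: ltP => ?; case: ltP => ?;
  apply/andP; split; lra.
Qed.

(** Extending by constants reduces the local statement to the global one. *)
Lemma lip_on_FTC K f w (a b : R) : a <= b -> 0 <= K ->
  (forall x y, a <= x <= b -> a <= y <= b -> `|f x - f y| <= K * `|x - y|) ->
  measurable_fun setT w ->
  {ae mu, forall x, a < x < b -> is_derive x (1 : R) f (w x)} ->
  \int[mu]_(x in `[a, b]) w x = f b - f a.
Proof.
move=> ab K0 fK mw fw.
pose c := clamp a b.
have cab x : a <= c x <= b by exact: clamp_itv.
have cid_ x : a <= x <= b -> c x = x by exact: clamp_id.
have hK : lip K (f \o c).
  move=> x y /=; apply: (le_trans (fK _ _ (cab x) (cab y))); rewrite ler_wpM2l//.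
  exact: clamp_contraction.
have -> : f b - f a = (f \o c) b - (f \o c) a.
  by rewrite /= !cid_ ?lexx ?ab.
rewrite -(lip_FTC ab hK); apply: Rintegral_ae_eq.
- exact: measurable_itv.
- exact: measurable_funTS.
- by apply: measurable_funTS; exact: measurable_lip_derive hK.
have ab_neq := ae_imp2 (fun x => @conj _ _) (ae_neq a) (ae_neq b).
apply: ae_imp2 ab_neq fw => x [xa xb] fx; rewrite /= in_itv/= => /andP[ax xb'].
have axb : a < x < b by rewrite !lt_neqAle eq_sym xa ax xb xb'.
have /andP[? ?] := axb.
have dx : is_derive x (1 : R) (f \o c) (w x).
  apply: near_eq_is_derive (fx axb).
  near=> y; rewrite /= cid_//.
  by apply/andP; split; apply: ltW; near: y; [exact: lt_nbhsr|exact: lt_nbhsl].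
by rewrite (lip_derive_val dx).
Unshelve. all: by end_near. Qed.

Lemma lip_ge0 K f : lip K f -> 0 <= K.
Proof.
move=> /(_ 1 0); rewrite subr0 normr1 mulr1; exact: le_trans.
Qed.

Lemma lip_bound_itv K f (a b x : R) : lip K f -> a <= x <= b ->
  `|f x| <= `|f a| + K * (b - a).
Proof.
move=> fK /andP[ax xb]; rewrite -(subrK (f a) (f x)) addrC.
apply: (le_trans (ler_normD _ _)); rewrite lerD2l (le_trans (fK _ _))//.
by rewrite ler_wpM2l ?(lip_ge0 fK)// ger0_norm ?subr_ge0// lerD2r.
Qed.

(** The product of two Lipschitz functions is Lipschitz on the segment, so its
    derivative integrates to its increment. *)
Lemma lip_parts K L f g (a b : R) : a <= b -> lip K f -> lip L g ->
  \int[mu]_(x in `[a, b]) (lip_derive f x * g x + f x * lip_derive g x) =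
  f b * g b - f a * g a.
Proof.
move=> ab fK gL.
have K0 := lip_ge0 fK; have L0 := lip_ge0 gL.
pose M := `|f a| + K * (b - a); pose N := `|g a| + L * (b - a).
have N0 : 0 <= N by rewrite addr_ge0// mulr_ge0// subr_ge0.
have M0 : 0 <= M by rewrite addr_ge0// mulr_ge0// subr_ge0.
apply: (@lip_on_FTC (K * N + M * L) (fun x => f x * g x)) => //.
- by rewrite addr_ge0// mulr_ge0.
- move=> x y abx aby.
  have -> : f x * g x - f y * g y = (f x - f y) * g x + f y * (g x - g y) by ring.
  apply: (le_trans (ler_normD _ _)); rewrite !normrM mulrDl; apply: lerD.
    rewrite mulrAC; apply: ler_pM => //; exact: lip_bound_itv.
  by rewrite -mulrA; apply: ler_pM => //; exact: lip_bound_itv.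
- apply: measurable_funD; apply: measurable_funM.
  + exact: measurable_lip_derive fK.
  + exact: measurable_lip gL.
  + exact: measurable_lip fK.
  + exact: measurable_lip_derive gL.
apply: ae_imp2 (ae_is_derive_lip fK) (ae_is_derive_lip gL) => x fx gx _.
rewrite addrC mulrC [X in _ + X]mulrC.
have := @is_deriveM _ _ f g x 1 _ _ fx gx.
rewrite /GRing.scale/= [X in X + _]mulrC [X in _ + X]mulrC addrC.
by congr is_derive; rewrite mulrC [X in _ + X]mulrC.
Qed.
End LipschitzDensity.

(** * A smooth step function *)

Section SmoothStep.
Context {R : realType}.
Implicit Types (f g : R -> R) (p q : {poly R}).

Definition flat_exp p (x : R) := if 0 < x then p.[x^-1] * expR (- x^-1) else 0.

(** After [y = 1/x] this is the domination of [p.[y]] by [expR y]. *)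
Lemma flat_exp_small p : exists2 C, 0 <= C &
  forall x, `|x| <= 1 -> `|flat_exp p x| <= C * `|x|.
Proof.
pose n := size p; pose S := \sum_(i < n) `|p`_i|.
have S0 : 0 <= S by apply: sumr_ge0.
exists (S * n.+1`!%:R); first by rewrite mulr_ge0.
move=> x x1; rewrite /flat_exp; case: ifPn => [x0|_]; last first.
  by rewrite normr0 !mulr_ge0.
have y1 : 1 <= x^-1 by rewrite -invr1 lef_pV2 ?posrE// -(gtr0_norm x0).
set y := x^-1 in y1 *.
have y0 : 0 < y by rewrite (lt_le_trans _ y1).
have pS : `|p.[y]| <= S * y ^+ n.
  rewrite horner_coef (le_trans (ler_norm_sum _ _ _))// mulr_suml ler_sum// => i _.
  rewrite normrM ler_wpM2l// (ger0_norm (exprn_ge0 _ (ltW y0))).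
  exact: (ler_weXn2l y1 (ltnW (ltn_ord i))).
have ey : y ^+ n.+1 / n.+1`!%:R <= expR y.
  by apply: le_trans (expR_ge1Dxn n (ltW y0)); rewrite lerDr.
rewrite normrM expRN (gtr0_norm (_ : 0 < (expR y)^-1)) ?invr_gt0 ?expR_gt0//.
rewrite ler_pdivrMr ?expR_gt0//; apply: (le_trans pS).
have {1}-> : y ^+ n = y ^+ n.+1 / n.+1`!%:R * (n.+1`!%:R * `|x|).
  rewrite (gtr0_norm x0) mulrA divfK ?pnatr_eq0 -?lt0n ?fact_gt0//.
  by rewrite exprSr -mulrA /y mulVf ?mulr1 ?gt_eqF.
rewrite mulrCA [leLHS]mulrC ![in leLHS]mulrA -[leLHS]mulrA.
by apply: ler_wpM2l ey; rewrite !mulr_ge0.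
Qed.

(** The derivative is a function of the same family, with [p] replaced by
    [X^2 (p - p')]; at 0 both sides are flat. *)
Lemma is_derive_flat_exp p x :
  is_derive x (1 : R) (flat_exp p) (flat_exp ('X^2 * (p - p^`())) x).
Proof.
have [x0|x0|->] := ltgtP x 0.
- rewrite {2}/flat_exp ltNge (ltW x0)/=.
  apply: (near_eq_is_derive _ (is_derive_cst (0 : R) x 1)).
  near=> y; rewrite /flat_exp ltNge ltW//; near: y; exact: lt_nbhsl.
- rewrite {2}/flat_exp x0.
  pose h (y : R) := p.[y^-1] * expR (- y^-1).
  have dinv : is_derive x (1 : R) (fun y : R => y^-1) (- x ^- 2).
    have := @is_deriveV _ (@id R) x 1 1 (lt0r_neq0 x0) _.
    rewrite /GRing.scale/= mulr1. apply.
  have dh : is_derive x (1 : R) h (('X^2 * (p - p^`())).[x^-1] * expR (- x^-1)).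
    have d1 := is_derive1_comp (is_derive_poly p x^-1) dinv.
    have d2 := @is_derive1_comp _ expR (fun y => - y^-1) x _ _
      (is_derive_expR (- x^-1)) (is_deriveN dinv).
    have := is_deriveM d1 d2.
    rewrite /GRing.scale/= -exprVn => d.
    apply: is_derive_eq d _; rewrite hornerM hornerXn hornerD hornerN.
    by ring.
  apply: (near_eq_is_derive _ dh).
  near=> y; rewrite /flat_exp ifT//; near: y; exact: lt_nbhsr.
- rewrite {2}/flat_exp ltxx.
  have [C C0 hC] := flat_exp_small ('X * p).
  have C1 : 0 < C + 1 by rewrite ltr_wpDl.
  have d0 : h^-1 *: ((flat_exp p \o shift 0) h%:A - flat_exp p 0) @[h --> 0^'] --> (0 : R).
    apply/cvgrPdist_le => e e0; near=> h.
    have h1 : `|h| <= 1.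
      near: h; apply: dnbhs0_le; exact: ltr01.
    have hn0 : h != 0 by near: h; exact: nbhs_dnbhs_neq.
    rewrite sub0r normrN /= addr0 [h%:A]mulr1 {2}/flat_exp ltxx subr0.
    have -> : h^-1 *: flat_exp p h = flat_exp ('X * p) h.
      rewrite /flat_exp; case: ifP => _; last by rewrite scaler0.
      by rewrite hornerM hornerX /GRing.scale/= mulrA.
    apply: (le_trans (hC _ h1)); apply: (@le_trans _ _ ((C + 1) * `|h|)).
      by rewrite ler_wpM2r// lerDl.
    rewrite -ler_pdivlMl// mulrC; near: h; apply: dnbhs0_le.
    by rewrite divr_gt0.
  split; first by apply/cvg_ex; exists 0.
  exact: cvg_lim d0.
Unshelve. all: by end_near. Qed.

(** Closed under derivation by construction, which is what makes its members
    infinitely differentiable without computing any higher derivative. *)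
Inductive flat_smooth : (R -> R) -> Prop :=
| flat_smooth_exp p a b : flat_smooth (fun x => flat_exp p (a * x + b))
| flat_smooth_cst c : flat_smooth (fun=> c)
| flat_smoothD f g : flat_smooth f -> flat_smooth g -> flat_smooth (fun x => f x + g x)
| flat_smoothM f g : flat_smooth f -> flat_smooth g -> flat_smooth (fun x => f x * g x)
| flat_smoothV f : (forall x, f x != 0) -> flat_smooth f -> flat_smooth (fun x => (f x)^-1).

Lemma flat_smooth_derive f : flat_smooth f ->
  exists2 g, flat_smooth g & forall x, is_derive x (1 : R) f (g x).
Proof.
elim => {f} [p a b|c|f g _ [f' sf' df] _ [g' sg' dg]|f g sf [f' sf' df] sg [g' sg' dg]
  |f f0 sf [f' sf' df]].
- exists (fun x => flat_exp ('X^2 * (p - p^`())) (a * x + b) * a).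
    by apply: flat_smoothM; [exact: flat_smooth_exp|exact: flat_smooth_cst].
  move=> x; apply: (@is_derive1_comp _ (flat_exp p) (fun x => a * x + b)).
    exact: is_derive_flat_exp.
  have := is_deriveD (is_deriveZ a (is_derive_id x (1:R))) (is_derive_cst b x (1:R)).
  by rewrite addr0 [a *: 1]mulr1.
- by exists (fun=> 0); [exact: flat_smooth_cst|move=> x; exact: is_derive_cst].
- exists (fun x => f' x + g' x); first exact: flat_smoothD.
  by move=> x; exact: is_deriveD.
- exists (fun x => f x * g' x + g x * f' x).
    by apply: flat_smoothD; exact: flat_smoothM.
  move=> x; exact: is_deriveM.
- exists (fun x => -1 * ((f x)^-1 * (f x)^-1) * f' x).
    apply: flat_smoothM => //; apply: flat_smoothM; first exact: flat_smooth_cst.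
    by apply: flat_smoothM; exact: flat_smoothV.
  move=> x; have := @is_deriveV _ f x (f' x) 1 (f0 x) (df x).
  by rewrite mulN1r -invfM -expr2.
Qed.

Lemma flat_smooth_derive1n f n : flat_smooth f -> flat_smooth (derive1n n f).
Proof.
elim: n f => // n ih f sf; rewrite /derive1n iterSr; apply: ih.
have [g sg dg] := flat_smooth_derive sf.
rewrite (_ : derive1 f = g)//; apply/funext => x.
by rewrite derive1E; exact: derive_val.
Qed.

Lemma flat_smooth_derivable f n x : flat_smooth f -> derivable (derive1n n f) x 1.
Proof.
by move=> /(flat_smooth_derive1n n) /flat_smooth_derive[g _ dg]; exact: ex_derive.
Qed.

Lemma flat_smooth_affine f a b : flat_smooth f -> flat_smooth (fun x => f (a * x + b)).
Proof.
elim => {f} [p c d|c|f g _ sf _ sg|f g _ sf _ sg|f f0 _ sf].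
- rewrite (_ : (fun x => _) = fun x => flat_exp p ((c * a) * x + (c * b + d))).
    exact: flat_smooth_exp.
  by apply/funext => x; congr flat_exp; ring.
- exact: flat_smooth_cst.
- exact: flat_smoothD.
- exact: flat_smoothM.
- exact: flat_smoothV.
Qed.

Lemma flat_exp1_gt0 x : 0 < x -> 0 < flat_exp 1 x.
Proof. by move=> x0; rewrite /flat_exp x0 hornerC mul1r expR_gt0. Qed.

Lemma flat_exp_le0 p x : x <= 0 -> flat_exp p x = 0.
Proof. by move=> x0; rewrite /flat_exp ltNge x0. Qed.

Lemma flat_exp1_ge0 x : 0 <= flat_exp 1 x.
Proof. by have [/flat_exp_le0->|/flat_exp1_gt0/ltW] := leP x 0. Qed.

(** The quotient [A / (A + B)], with [A] flat at 0 and [B] flat at 1. *)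
Lemma smooth_step : exists H : R -> R, [/\ flat_smooth H,
  forall x, x <= 0 -> H x = 0, forall x, 1 <= x -> H x = 1 & forall x, 0 <= H x <= 1].
Proof.
pose A x := flat_exp 1 (1 * x + 0); pose B x := flat_exp 1 (-1 * x + 1).
have A0 x : 0 <= A x by exact: flat_exp1_ge0.
have B0 x : 0 <= B x by exact: flat_exp1_ge0.
have AB0 x : 0 < A x + B x.
  have [x0|x0] := ltP 0 x.
    by rewrite ltr_pwDl// flat_exp1_gt0// mul1r addr0.
  by rewrite ltr_wpDl// flat_exp1_gt0//; lra.
exists (fun x => A x * (A x + B x)^-1); split.
- apply: flat_smoothM; first exact: flat_smooth_exp.
  apply: flat_smoothV; first by move=> x; rewrite gt_eqF.
  by apply: flat_smoothD; exact: flat_smooth_exp.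
- by move=> x x0; rewrite {1}/A flat_exp_le0 ?mul0r// mul1r addr0.
- move=> x x1; have -> : B x = 0 by rewrite /B flat_exp_le0//; lra.
  by rewrite addr0 divff// gt_eqF// flat_exp1_gt0//; lra.
- move=> x; rewrite divr_ge0 ?(ltW (AB0 _))//=.
  by rewrite ler_pdivrMr// mul1r lerDl.
Qed.

End SmoothStep.

(** * Weak derivatives of Lipschitz functions *)

Section WeakDerivatives.
Context {R : realType}.
Notation mu := (@lebesgue_measure R).
Implicit Types (f g v w : R -> R) (K C : R).

Lemma lip_of_derive1 C f : (forall x, derivable f x 1) ->
  (forall x, `|derive1 f x| <= C) -> lip C f.
Proof.
move=> df fC x y; wlog xy : x y / x <= y.
  move=> h; have [/h//|/ltW/h] := leP x y.
  by rewrite distrC (distrC x).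
have [||c _ E] := @MVT_segment _ f (derive1 f) x y xy.
- by move=> z _; rewrite derive1E; exact: derivableP.
- by apply: derivable_within_continuous => z _; exact: df.
by rewrite distrC E normrM (distrC x) ler_wpM2r.
Qed.

Lemma integrable_EFinB (A : set R) f g : measurable A ->
  mu.-integrable A (EFin \o f) -> mu.-integrable A (EFin \o g) ->
  mu.-integrable A (EFin \o (fun x => f x - g x)).
Proof.
move=> mA fi gi.
rewrite (_ : _ \o _ = (EFin \o f) \- (EFin \o g))%E; first exact: integrableB.
by apply/funext => x /=; rewrite EFinB.
Qed.

Lemma integrable_EFinD (A : set R) f g : measurable A ->
  mu.-integrable A (EFin \o f) -> mu.-integrable A (EFin \o g) ->
  mu.-integrable A (EFin \o (fun x => f x + g x)).
Proof.
move=> mA fi gi.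
rewrite (_ : _ \o _ = (EFin \o f) \+ (EFin \o g))%E; first exact: integrableD.
by apply/funext => x /=; rewrite EFinD.
Qed.

Lemma Rintegral_supp f (a b : R) : (forall x, ~ (a <= x <= b) -> f x = 0) ->
  \int[mu]_x f x = \int[mu]_(x in `[a, b]) f x.
Proof.
move=> f0; rewrite [RHS]Rintegral_mkcond; apply: eq_Rintegral => x _.
rewrite patchE; case: ifPn => //; rewrite notin_setE /= in_itv/= => /f0.
by [].
Qed.

Lemma integrable_supp f (a b : R) : (forall x, ~ (a <= x <= b) -> f x = 0) ->
  mu.-integrable `[a, b] (EFin \o f) -> mu.-integrable setT (EFin \o f).
Proof.
move=> f0 fi; have -> : EFin \o f = (EFin \o f) \_ `[a, b].
  apply/funext => x; rewrite patchE; case: ifPn => //.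
  by rewrite notin_setE /= in_itv/= => /f0 ->.
by rewrite -integrable_mkcond//; exact: measurable_itv.
Qed.

Lemma dominated_Rintegral (A : set R) (f_ : nat -> R -> R) f g :
  measurable A -> (forall n, measurable_fun A (f_ n)) -> measurable_fun A f ->
  {ae mu, forall x, A x -> f_ n x @[n --> \oo] --> f x} ->
  mu.-integrable A (EFin \o g) ->
  {ae mu, forall x n, A x -> `|f_ n x| <= g x} ->
  \int[mu]_(x in A) f_ n x @[n --> \oo] --> \int[mu]_(x in A) f x.
Proof.
move=> mA mf_ mf ff ig fg.
have [||||intf _ h] := @dominated_convergence _ _ R mu A mA
    (fun n => EFin \o f_ n) (EFin \o f) (EFin \o g) _ _ _ ig.
- by move=> n; apply/measurable_EFinP; exact: mf_.
- exact/measurable_EFinP.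
- by apply: ae_imp ff => x h /h ?; apply: cvg_EFin => //; exact: nearW.
- by apply: ae_imp fg => x h n /(h n); rewrite /= lee_fin.
apply: fine_cvg; rewrite /Rintegral fineK//.
by apply: integrable_fin_num.
Qed.

Lemma continuous_locally_integrable f : continuous f -> locally_integrable setT f.
Proof.
move=> cf; split; [exact: continuous_measurable_fun|exact: openT|].
move=> A _ cA.
have /integrableP[_] := @continuous_compact_integrable _ f A cA (continuous_subspaceT cf).
by [].
Qed.

Lemma bounded_locally_integrable f K : measurable_fun setT f ->
  (forall x, `|f x| <= K) -> locally_integrable setT f.
Proof.
move=> mf fK; split => //; first exact: openT.
move=> A _ cA.
have /integrableP[_] // : mu.-integrable A (EFin \o f).
apply: measurable_bounded_integrable.
- exact: compact_measurable.
- exact: compact_finite_measure.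
- exact: measurable_funS mf.
- exists K; split; first exact: num_real.
  by move=> M KM t _ /=; apply: (le_trans (fK t)); exact: ltW.
Qed.

Lemma integrable_itv f K (a b : R) : measurable_fun setT f ->
  (forall t, a <= t <= b -> `|f t| <= K) -> mu.-integrable `[a, b] (EFin \o f).
Proof.
move=> mf fK; apply: measurable_bounded_integrable.
- exact: measurable_itv.
- exact/compact_finite_measure/segment_compact.
- exact: measurable_funS mf.
- exists K; split; first exact: num_real.
  move=> M KM t; rewrite /= in_itv/= => /fK h /=; apply: (le_trans h); exact: ltW.
Qed.

Lemma continuous_bounded_itv f (a b : R) : continuous f ->
  exists2 K, 0 <= K & forall t, a <= t <= b -> `|f t| <= K.
Proof.
move=> cf; have [ab|ba] := leP a b; last first.
  by exists 0 => // t /andP[a_t t_b]; move: ba; rewrite ltNge (le_trans a_t t_b).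
have [|c _ hc] := @EVT_max _ (fun x => `|f x|) a b ab.
  by apply: continuous_subspaceT => x; apply: cvg_norm; exact: cf.
exists `|f c| => // t tab; exact: hc.
Qed.

Lemma integrableM_itv f g (a b : R) : measurable_fun setT f -> continuous g ->
  (exists K, forall t, a <= t <= b -> `|f t| <= K) ->
  mu.-integrable `[a, b] (EFin \o (fun x => f x * g x)).
Proof.
move=> mf cg [K fK]; have [L L0 gL] := continuous_bounded_itv a b cg.
apply: (@integrable_itv _ (K * L)).
  by apply: measurable_funM => //; exact: continuous_measurable_fun.
by move=> t tab; rewrite normrM ler_pM// ?fK ?gL.
Qed.

Lemma test_function_support phi : test_function phi ->
  exists2 N : R, 0 < N & forall x, N <= `|x| -> phi x = 0.
Proof.
move=> [_ /compact_bounded[M [_ hM]]]; exists (`|M| + 1); first by rewrite ltr_wpDl.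
move=> x xM; apply/eqP; apply: contraT => phix.
have Mlt : M < `|M| + 1/2.
  by rewrite (le_lt_trans (ler_norm _))// ltrDl divr_gt0.
have xcl : closure [set x | phi x != 0] x by exact: subset_closure.
have := hM _ Mlt x xcl; rewrite /= => xM2.
have := le_trans xM xM2; rewrite lerD2l => h.
by exfalso; lra.
Qed.

Lemma derive1_near_cst (c : R) f x : (\near x, f x = c) -> derive1 f x = 0.
Proof. by move=> fc; rewrite derive1E (near_eq_derive _ fc) derive_cst. Qed.

Lemma test_function_lip phi : test_function phi -> exists C, lip C phi.
Proof.
move=> tphi; have [N N0 phi0] := test_function_support tphi.
have [dphi _] := tphi.
have d'phi : continuous (derive1 phi).
  by move=> x; apply: differentiable_continuous; apply/derivable1_diffP; exact: (dphi 1%N).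
have NN : - N <= N by rewrite ge0_cp// ltW.
have [|c _ hc] := @EVT_max _ (fun x => `|derive1 phi x|) (- N) N NN.
  by apply: continuous_subspaceT => x; apply: cvg_norm; exact: d'phi.
exists `|derive1 phi c|; apply: lip_of_derive1; first exact: (dphi 0%N).
move=> x; have [xN|xN] := leP `|x| N.
  by apply: hc; rewrite in_itv/= -ler_norml.
rewrite (@derive1_near_cst 0) ?normr0//; near=> y; apply: phi0; near: y.
have : `|y| @[y --> x] --> `|x| by apply: cvg_norm; exact: cvg_id.
by move/cvgr_ge; apply.
Unshelve. all: by end_near. Qed.

(** Integration by parts of Lipschitz functions against a compactly supported
    one: the boundary terms vanish. *)
Lemma lip_is_weak_derivative K M f w : lip K f -> measurable_fun setT w ->
  (forall x, `|w x| <= M) -> {ae mu, forall x, is_derive x (1 : R) f (w x)} ->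
  is_weak_derivative f w.
Proof.
move=> fK mw wM dw; split.
- exact: continuous_locally_integrable (lip_continuous fK).
- exact: bounded_locally_integrable wM.
move=> phi tphi.
have [N N0 phi0] := test_function_support tphi.
have [C phiC] := test_function_lip tphi.
have [dphi _] := tphi.
have phiN x : ~ (- N <= x <= N) -> phi x = 0.
  by move=> /negP; rewrite -ler_norml -ltNge => /ltW/phi0.
have d'phiN x : ~ (- N <= x <= N) -> derive1 phi x = 0.
  move=> /negP; rewrite -ler_norml -ltNge => xN.
  apply: (@derive1_near_cst 0); near=> y; apply: phi0; near: y.
  have : `|y| @[y --> x] --> `|x| by apply: cvg_norm; exact: cvg_id.
  by move/cvgr_ge; apply.
have NN : - N <= N by rewrite ge0_cp// ltW.
rewrite (@Rintegral_supp _ (- N) N); last by move=> x /d'phiN ->; rewrite mulr0.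
rewrite (@Rintegral_supp _ (- N) N); last by move=> x /phiN ->; rewrite mulr0.
have := lip_parts NN fK phiC.
rewrite (phi0 N) ?(phi0 (- N)) ?normrN ?gtr0_norm// !mulr0 subr0.
have dE x : lip_derive phi x = derive1 phi x.
  by apply: lip_derive_derivable; exact: (dphi 0%N).
have iw : mu.-integrable `[(- N), N] (EFin \o (fun x => w x * phi x)).
  apply: integrableM_itv => //; first exact: lip_continuous phiC.
  by exists M.
have iphi : mu.-integrable `[(- N), N] (EFin \o (fun x => f x * derive1 phi x)).
  apply: integrableM_itv => //; first exact: measurable_lip fK.
    by move=> x; apply: differentiable_continuous; apply/derivable1_diffP; exact: (dphi 1%N).
  by exists (`|f (- N)| + K * (N - (- N))) => t; exact: lip_bound_itv.
have mphi := measurable_lip phiC.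
have mf := measurable_lip fK.
have md'phi : measurable_fun setT (derive1 phi).
  rewrite (_ : derive1 phi = lip_derive phi); last by apply/funext => x; rewrite dE.
  exact: measurable_lip_derive phiC.
rewrite (@Rintegral_ae_eq _ _ _ (fun x => w x * phi x + f x * derive1 phi x)).
- rewrite RintegralD//.
  by move=> /eqP; rewrite addrC addr_eq0 => /eqP.
- exact: measurable_itv.
- apply: measurable_funTS; apply: measurable_funD; apply: measurable_funM => //.
    exact: measurable_lip_derive fK.
  exact: measurable_lip_derive phiC.
- by apply: measurable_funTS; apply: measurable_funD; apply: measurable_funM.
- apply: ae_imp dw => x dx _; rewrite dE.
  by rewrite (lip_derive_val dx).
Unshelve. all: by end_near. Qed.

Lemma flat_smooth_derivable0 f x : flat_smooth f -> derivable f x 1.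
Proof. by move=> sf; exact: (@flat_smooth_derivable _ f 0%N x sf). Qed.

Lemma flat_smooth_continuous f : flat_smooth f -> continuous f.
Proof.
move=> sf x; apply: differentiable_continuous; apply/derivable1_diffP.
exact: flat_smooth_derivable0.
Qed.

Lemma flat_smooth_derive1 f : flat_smooth f -> flat_smooth (derive1 f).
Proof. by move=> sf; exact: (flat_smooth_derive1n 1%N sf). Qed.

Lemma lip_smooth_step : exists C, exists H : R -> R, [/\ flat_smooth H, lip C H,
  forall x, x <= 0 -> H x = 0, forall x, 1 <= x -> H x = 1 & forall x, 0 <= H x <= 1].
Proof.
have [H [sH H0 H1 H01]] := @smooth_step R.
have [C C0 hC] := continuous_bounded_itv 0 1 (flat_smooth_continuous (flat_smooth_derive1 sH)).
exists C, H; split => //; apply: lip_of_derive1; first by move=> x; exact: flat_smooth_derivable0.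
move=> x; have [x0|x0] := ltP x 0.
  rewrite (@derive1_near_cst 0) ?normr0//; near=> y; apply: H0; apply: ltW; near: y.
  exact: lt_nbhsl.
have [x1|x1] := leP x 1; first by apply: hC; rewrite x0.
rewrite (@derive1_near_cst 1) ?normr0//.
near=> y; apply: H1; apply: ltW; near: y; exact: lt_nbhsr.
Unshelve. all: by end_near. Qed.

(** The fundamental lemma of the calculus of variations, tested with smooth
    approximations of the indicator of [s, t]: their derivatives concentrate
    at s and t, where continuity of v gives the limit. *)
Section FundamentalLemma.
Variables (C : R) (H : R -> R).
Hypotheses (sH : flat_smooth H) (HC : lip C H).
Hypotheses (H0 : forall x, x <= 0 -> H x = 0) (H1 : forall x, 1 <= x -> H x = 1).
Hypothesis H01 : forall x, 0 <= H x <= 1.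

Let S (r : R) (n : nat) (x : R) := H (n.+1%:R * x + - (n.+1%:R * r)).

Let S_smooth r n : flat_smooth (S r n). Proof. exact: flat_smooth_affine. Qed.

Let S_lip r n : lip (C * n.+1%:R) (S r n).
Proof.
move=> x y; rewrite /S; apply: (le_trans (HC _ _)).
rewrite opprD addrACA subrr addr0 -mulrBr normrM mulrA.
by rewrite ger0_norm.
Qed.

Let S_left r n x : x <= r -> S r n x = 0.
Proof. by move=> xr; apply: H0; rewrite -mulrBr mulr_ge0_le0// subr_le0. Qed.

Let S_right r n x : r + n.+1%:R^-1 <= x -> S r n x = 1.
Proof.
move=> xr; apply: H1; rewrite -mulrBr -ler_pdivrMl// mulr1.
by rewrite lerBrDl.
Qed.

Let S_derive_out r n x : ~ (r <= x <= r + n.+1%:R^-1) -> derive1 (S r n) x = 0.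
Proof.
move=> /negP; rewrite negb_and -!ltNge => /orP[xr|xr].
  rewrite (@derive1_near_cst 0)//; near=> y; apply: S_left; apply: ltW; near: y.
  exact: lt_nbhsl.
rewrite (@derive1_near_cst 1)//.
near=> y; apply: S_right; apply: ltW; near: y; exact: lt_nbhsr.
Unshelve. all: by end_near. Qed.

Let S_derive r n x : lip_derive (S r n) x = derive1 (S r n) x.
Proof. by apply: lip_derive_derivable; exact: flat_smooth_derivable0. Qed.

Let S_average v r : continuous v ->
  \int[mu]_x (v x * derive1 (S r n) x) @[n --> \oo] --> v r.
Proof.
move=> cv; have C0 := lip_ge0 HC.
apply/cvgrPdist_le => e e0.
have C1 : 0 < C + 1 by rewrite ltr_wpDl.
have d0 : 0 < e / (C + 1) by rewrite divr_gt0.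
have /cvgrPdist_le/(_ _ d0)[d /= dpos hd] := cv r.
near=> n.
pose h := n.+1%:R^-1 : R; have hpos : 0 < h by rewrite invr_gt0.
have hd' : h < d.
  rewrite /h; near: n; exact: near_infty_natSinv_lt (PosNum dpos).
have rh : r <= r + h by rewrite lerDl ltW.
have mS' : measurable_fun setT (derive1 (S r n)).
  apply: continuous_measurable_fun; apply: flat_smooth_continuous.
  exact: flat_smooth_derive1.
have cS' : continuous (derive1 (S r n)).
  by apply: flat_smooth_continuous; exact: flat_smooth_derive1.
have ivS : mu.-integrable `[r, r + h] (EFin \o (fun x => v x * derive1 (S r n) x)).
  apply: integrableM_itv => //; first exact: continuous_measurable_fun.
  by have [K _ hK] := continuous_bounded_itv r (r + h) cv; exists K.
have iS : mu.-integrable `[r, r + h] (EFin \o (fun x => v r * derive1 (S r n) x)).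
  by apply: integrableM_itv => //; exists `|v r|.
rewrite (@Rintegral_supp _ r (r + h)); last first.
  by move=> x /S_derive_out ->; rewrite mulr0.
have int1 : \int[mu]_(x in `[r, r + h]) derive1 (S r n) x = 1.
  by rewrite -(funext (@S_derive r n)) (lip_FTC rh (@S_lip r n)) S_right// S_left// subr0.
have -> : v r = \int[mu]_(x in `[r, r + h]) (v r * derive1 (S r n) x).
  rewrite RintegralZl ?int1 ?mulr1//.
  have := @integrableM_itv (cst 1) (derive1 (S r n)) r (r + h).
  under [X in _ -> _ -> _ -> mu.-integrable _ X]eq_fun do rewrite /= mul1r.
  by apply => //; exists 1 => t _; rewrite normr1.
rewrite -RintegralB//.
apply: (le_trans (le_normr_Rintegral _ _)) => //.
  exact: integrable_EFinB.
have hint : mu.-integrable `[r, r + h] (EFin \o (fun=> e / (C + 1) * (C * n.+1%:R))).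
  by apply: (@bounded_integrable_itv _ _ `|e / (C + 1) * (C * n.+1%:R)|).
apply: (@le_trans _ _ (\int[mu]_(x in `[r, r + h]) (e / (C + 1) * (C * n.+1%:R)))).
  apply: le_Rintegral => //.
    by apply: integrable_norm; exact: integrable_EFinB.
  move=> x; rewrite /= in_itv/= => /andP[rx xrh].
  rewrite -mulrBl normrM ler_pM//.
    apply: hd; rewrite /= distrC ger0_norm ?subr_ge0//.
    by rewrite (le_lt_trans _ hd')// lerBlDl.
  by rewrite -S_derive lip_derive_bound.
rewrite Rintegral_cst//= lebesgue_measure_itv/= lte_fin ltrDl hpos -EFinB/=.
rewrite [X in _ * X](_ : _ = h); last by rewrite addrAC subrr add0r.
have nh : n.+1%:R * h = 1 by rewrite /h mulfV// pnatr_eq0.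
rewrite -!mulrA nh mulr1 -[leRHS]mulr1 ler_wpM2l ?(ltW e0)//.
by rewrite mulrC ler_pdivrMr// mul1r lerDl.
Unshelve. all: by end_near. Qed.

Lemma weak_derivative_FTC_aux v w s t : continuous v -> is_weak_derivative v w ->
  s < t -> \int[mu]_(x in `[s, t]) w x = v t - v s.
Proof.
move=> cv [_ [mw _ lw] vw] st.
pose phi n x := S s n x + (-1) * S t n x.
have phi_smooth n : flat_smooth (phi n).
  by apply: flat_smoothD => //; apply: flat_smoothM => //; exact: flat_smooth_cst.
have phi_out n x : ~ (s <= x <= t + 1) -> phi n x = 0.
  move=> /negP; rewrite negb_and -!ltNge => /orP[xr|xr].
    by rewrite /phi !S_left ?mulr0 ?addr0 ?ltW// (lt_trans xr).
  have n1 : n.+1%:R^-1 <= 1 :> R by rewrite invf_le1// ler1n.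
  have sx : s + n.+1%:R^-1 <= x.
    by apply: le_trans (ltW xr); rewrite lerD// ltW.
  have tx : t + n.+1%:R^-1 <= x by apply: le_trans (ltW xr); rewrite lerD.
  by rewrite /phi (S_right sx) (S_right tx) mulr1 subrr.
have phi_test n : test_function (phi n).
  split; first by move=> k x; exact: flat_smooth_derivable.
  apply: (@subclosed_compact _ _ `[s, t + 1]); [exact: closed_closure|exact: segment_compact|].
  rewrite [X in _ `<=` X](closure_id _).1; last exact: itv_closed.
  apply: closure_subset => x /= phix; rewrite in_itv/=; apply: contrapT => /phi_out p0.
  by move: phix; rewrite p0 eqxx.
have phi_derive n x : derive1 (phi n) x = derive1 (S s n) x - derive1 (S t n) x.
  have d1 r : is_derive x (1 : R) (S r n) (derive1 (S r n) x).
    by rewrite derive1E; apply: derivableP; exact: flat_smooth_derivable0.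
  have [_ <-] := is_deriveB (d1 s) (d1 t).
  by rewrite derive1E; congr ('D_1 _ x); apply/funext => y; rewrite /phi mulN1r.
have n1 n : n.+1%:R^-1 <= 1 :> R by rewrite invf_le1// ler1n.
have iv r n : mu.-integrable `[r, r + 1] (EFin \o (fun x => v x * derive1 (S r n) x)).
  apply: integrableM_itv.
  - exact: continuous_measurable_fun.
  - by apply: flat_smooth_continuous; exact: flat_smooth_derive1.
  - by have [K _ hK] := continuous_bounded_itv r (r + 1) cv; exists K.
have ivT r n : mu.-integrable setT (EFin \o (fun x => v x * derive1 (S r n) x)).
  apply: integrable_supp (iv r n) => x hx; rewrite S_derive_out ?mulr0//.
  by move=> /andP[rx xr]; apply: hx; rewrite rx (le_trans xr)// lerD2l.
have cvgL : \int[mu]_x (v x * derive1 (phi n) x) @[n --> \oo] --> v s - v t.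
  rewrite (_ : (fun n => _) = fun n => \int[mu]_x (v x * derive1 (S s n) x) -
      \int[mu]_x (v x * derive1 (S t n) x)); last first.
    apply/funext => n; rewrite -RintegralB//; apply: eq_Rintegral => x _.
    by rewrite phi_derive mulrBr.
  by apply: cvgB; exact: S_average.
have cvgR : \int[mu]_x (w x * phi n x) @[n --> \oo] --> \int[mu]_(x in `[s, t]) w x.
  rewrite (_ : (fun n => _) = fun n => \int[mu]_(x in `[s, t + 1]) (w x * phi n x)); last first.
    apply/funext => n; apply: Rintegral_supp => x /phi_out ->; by rewrite mulr0.
  rewrite Rintegral_mkcond (_ : \int[mu]_x _ =
      \int[mu]_(x in `[s, t + 1]) (w \_ `[s, t]) x); last first.
    apply: Rintegral_supp => x hx; rewrite patchE memNset//= in_itv/= => /andP[sx xt].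
    by apply: hx; rewrite sx (le_trans xt)// lerDl.
  apply: (@dominated_Rintegral _ _ _ (fun x => `|w x|)).
  - exact: measurable_itv.
  - move=> n; apply: measurable_funTS; apply: measurable_funM => //.
    by apply: continuous_measurable_fun; exact: flat_smooth_continuous.
  - apply: measurable_funTS; apply/(measurable_restrictT _ _).1 => //.
    exact: measurable_funS mw.
  - apply: ae_imp (ae_neq s) => x xs; rewrite /= in_itv/= => /andP[sx xt1].
    have {sx xs} sx : s < x by rewrite lt_neqAle eq_sym xs sx.
    have S1 r : r < x -> \forall n \near \oo, S r n x = 1.
      move=> rx; have xr0 : 0 < x - r by rewrite subr_gt0.
      near=> n; apply: S_right; rewrite -lerBrDl ltW//.
      near: n; exact: near_infty_natSinv_lt (PosNum xr0).
    rewrite patchE; apply: cvg_near_cst; have [xt|tx] := leP x t.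
      have := S1 _ sx; apply: filterS => n Sn; rewrite /phi Sn (@S_left t)// mulr0 addr0 mulr1.
      by rewrite mem_set//= in_itv/= (ltW sx).
    have := S1 _ tx; have := S1 _ sx; apply: filterS2 => n Sn Tn.
    rewrite /phi Sn Tn mulr1 subrr mulr0 memNset//= in_itv/= => /andP[_].
    by rewrite leNgt tx.
  - have h : mu.-integrable `[s, t + 1] (EFin \o w).
      apply/integrableP; split; first by apply/measurable_EFinP; exact: measurable_funS mw.
      by apply: lw => //; exact: segment_compact.
    exact: integrable_norm.
  - apply: aeW => x n _; rewrite normrM ler_piMr// /phi.
    have /andP[? ?] := H01 (n.+1%:R * x + - (n.+1%:R * s)).
    have /andP[? ?] := H01 (n.+1%:R * x + - (n.+1%:R * t)).
    by rewrite mulN1r ler_norml /S; apply/andP; split; lra.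
have : \int[mu]_x (v x * derive1 (phi n) x) @[n --> \oo] --> - \int[mu]_(x in `[s, t]) w x.
  under eq_fun do rewrite vw//.
  exact: cvgN.
move=> /(cvg_unique _ cvgL) h.
by rewrite -[LHS]opprK -h// opprB.
Unshelve. all: by end_near. Qed.

End FundamentalLemma.

Lemma weak_derivative_FTC v w s t : continuous v -> is_weak_derivative v w ->
  s <= t -> \int[mu]_(x in `[s, t]) w x = v t - v s.
Proof.
move=> cv vw; rewrite le_eqVlt => /predU1P[<-|st].
  by rewrite set_itv1 Rintegral_set1 subrr.
have [C [H [sH HC H0 H1 H01]]] := lip_smooth_step.
exact: (weak_derivative_FTC_aux sH HC H0 H1 H01 cv vw st).
Qed.

Lemma locally_integrable_itv w (a b : R) (x y : bool) : locally_integrable setT w ->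
  mu.-integrable [set` Interval (BSide x a) (BSide y b)] (EFin \o w).
Proof.
move=> [mw _ lw].
have wab : mu.-integrable `[a, b] (EFin \o w).
  apply/integrableP; split; first by apply/measurable_EFinP; exact: measurable_funS mw.
  by apply: lw => //; exact: segment_compact.
apply: integrableS wab => //.
by apply: subset_itv; rewrite bnd_simp//; case: x; case: y.
Qed.

Lemma FTC_ae_derive v w : locally_integrable setT w ->
  (forall s t, s <= t -> \int[mu]_(x in `[s, t]) w x = v t - v s) ->
  {ae mu, forall x, is_derive x (1 : R) v (w x)}.
Proof.
move=> lw vw.
have : {ae mu, forall x : R, forall n : nat, - n.+1%:R < x -> is_derive x (1 : R) v (w x)}.
  apply: ae_foralln => n.
  have iw y : mu.-integrable `](- n.+1%:R), y] (EFin \o w).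
    exact: locally_integrable_itv.
  have := FTC1 iw lw; apply: ae_imp => x /= h nx.
  have [|dx dE] := h; first by rewrite lte_fin.
  have d : is_derive x (1 : R) (fun y => \int[mu]_(t in `](- n.+1%:R), y]) w t) (w x).
    by rewrite -dE derive1E; exact: derivableP.
  have d2 := is_deriveD d (is_derive_cst (v (- n.+1%:R)) x (1 : R)).
  rewrite addr0 in d2; apply: near_eq_is_derive d2.
  near=> y; rewrite !fctE Rintegral_itv_obnd_cbnd//.
  rewrite vw ?subrK// ltW//.
  by near: y; exact: lt_nbhsr.
apply: ae_imp => x /(_ (Num.bound `|x|)); apply; rewrite ltrNl.
rewrite (le_lt_trans (ler_norm _))// normrN (lt_trans (archi_boundP _))//.
by rewrite ltr_nat.
Unshelve. all: by end_near. Qed.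

Lemma weak_derivative_ae_derive v w : continuous v -> is_weak_derivative v w ->
  {ae mu, forall x, is_derive x (1 : R) v (w x)}.
Proof.
move=> cv vw; have [_ lw _] := vw; apply: FTC_ae_derive => // s t.
exact: weak_derivative_FTC.
Qed.

Lemma lip_weak_derivative K v : lip K v -> is_weak_derivative v (weak_derivative v).
Proof.
move=> vK; apply: (@xgetPex _ (cst 0) [set w | is_weak_derivative v w]).
exists (lip_derive v); apply: (lip_is_weak_derivative vK).
- exact: measurable_lip_derive vK.
- by move=> x; exact: lip_derive_bound vK.
- exact: ae_is_derive_lip vK.
Qed.

(** [weak_derivative] is a choice; any two weak derivatives of a Lipschitz
    function agree almost everywhere, as each integrates to its increments. *)
Lemma ae_weak_derivativeE K v : lip K v ->
  {ae mu, forall x, weak_derivative v x = lip_derive v x}.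
Proof.
move=> vK; have cv := lip_continuous vK.
apply: ae_imp (weak_derivative_ae_derive cv (lip_weak_derivative vK)) => x dx.
by rewrite (lip_derive_val dx).
Qed.

Lemma measurable_weak_derivative K v : lip K v -> measurable_fun setT (weak_derivative v).
Proof. by move=> /lip_weak_derivative[_ []]. Qed.

Lemma lebesgue_setT_gt0 : (0 < mu setT)%E.
Proof.
apply: (@lt_le_trans _ _ (mu `[0, 1]%classic)).
  by rewrite lebesgue_measure_itv/= lte_fin ltr01 -EFinB lte_fin subr0.
by apply: le_measure; rewrite ?inE//; exact: measurable_itv.
Qed.

(** The L^oo norm is an essential supremum because the line is not null. *)
Lemma Lnorm_ooP f K :
  ('N[mu]_+oo[EFin \o f] <= K%:E)%E <-> {ae mu, forall x, `|f x| <= K}.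
Proof.
rewrite Lnorm.unlock lebesgue_setT_gt0; split.
  by move/ess_supP; apply: ae_imp => x; rewrite /= lee_fin.
by move=> h; apply/ess_supP; apply: ae_imp h => x; rewrite /= lee_fin.
Qed.

Lemma bounded_Lfun_oo f K : measurable_fun setT f -> (forall x, `|f x| <= K) ->
  f \in Lfun mu +oo%E.
Proof.
move=> mf fK; rewrite inE; apply/andP; split; rewrite inE//=.
rewrite /finite_norm (@le_lt_trans _ _ K%:E) ?ltry//.
by apply/Lnorm_ooP; apply: aeW.
Qed.

(** The increments of [v] are the integrals of [w], which may be truncated to
    [[-1, 1]]. *)
Lemma lip_of_weak_derivative v w : continuous v -> is_weak_derivative v w ->
  {ae mu, forall x, `|w x| <= 1} -> lip 1 v.
Proof.
move=> cv vw w1 x y; wlog xy : x y / x <= y.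
  by move=> h; have [/h//|/ltW/h] := leP x y; rewrite distrC (distrC x).
rewrite mul1r distrC (distrC x) -(weak_derivative_FTC cv vw xy).
have [_ lw _] := vw.
pose g t := clamp (-1) 1 (w t).
have g1 t : `|g t| <= 1 by rewrite ler_norml; apply: clamp_itv; lra.
have mg : measurable_fun setT g.
  have [mw _ _] := lw.
  by apply: measurable_maxr => //; exact: measurable_minr.
have -> : \int[mu]_(t in `[x, y]) w t = \int[mu]_(t in `[x, y]) g t.
  apply: Rintegral_ae_eq => //.
  - by case: lw => mw _ _; exact: measurable_funS mw.
  - exact: measurable_funTS.
  - by apply: ae_imp w1 => t wt _; rewrite /g clamp_id// -ler_norml.
have ig : mu.-integrable `[x, y] (EFin \o g) by exact: bounded_integrable_itv g1.
have i1 : mu.-integrable `[x, y] (EFin \o (fun=> 1)).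
  by apply: (@bounded_integrable_itv _ _ 1) => // t; rewrite normr1.
apply: (le_trans (le_normr_Rintegral _ ig)) => //.
apply: (@le_trans _ _ (\int[mu]_(t in `[x, y]) 1)).
  by apply: le_Rintegral => //; exact: integrable_norm.
rewrite Rintegral_cst//= lebesgue_measure_itv/= lte_fin.
by case: ltP => yx; rewrite ?mulr0 ?normr_ge0// -EFinB/= mul1r ler_norm.
Qed.

Lemma cvg_pm1_bounded v : continuous v -> v t @[t --> +oo] --> (1 : R) ->
  v t @[t --> -oo] --> (-1 : R) -> exists K, forall t, `|v t| <= K.
Proof.
move=> cv /cvgrPdist_le/(_ _ ltr01)[A [_ hA]] /cvgrPdist_le/(_ _ ltr01)[B [_ hB]].
have [K K0 hK] := continuous_bounded_itv B A cv.
exists (Num.max K 2) => t; rewrite le_max.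
have [At|tA] := ltP A t.
  have := hA _ At; rewrite ler_distl => /andP[? ?]; apply/orP; right.
  by rewrite ler_norml; apply/andP; split; lra.
have [tB|Bt] := ltP t B.
  have := hB _ tB; rewrite ler_distl => /andP[? ?]; apply/orP; right.
  by rewrite ler_norml; apply/andP; split; lra.
by rewrite hK// Bt.
Qed.

(** For the continuous representative of an element of the space, the bound on
    the weak derivative is the Lipschitz bound, by integration in one direction
    and by differentiation in the other. *)
Lemma X1P v : X1 v <->
  [/\ lip 1 v, v t @[t --> +oo] --> (1 : R) & v t @[t --> -oo] --> (-1 : R)].
Proof.
split=> [[[_ [w [vw _]]] cv nv vy vNy]|[v1 vy vNy]].
  have wdv : is_weak_derivative v (weak_derivative v).
    by apply: (@xgetPex _ (cst 0) [set w | is_weak_derivative v w]); exists w.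
  by split => //; apply: (lip_of_weak_derivative cv wdv); exact/Lnorm_ooP.
have cv := lip_continuous v1; have wdv := lip_weak_derivative v1.
split => //.
  have [K hK] := cvg_pm1_bounded cv vy vNy; split.
    by apply: bounded_Lfun_oo hK; exact: measurable_lip v1.
  exists (lip_derive v); split.
    apply: (lip_is_weak_derivative v1).
    - exact: measurable_lip_derive v1.
    - by move=> x; exact: lip_derive_bound v1.
    - exact: ae_is_derive_lip v1.
  by apply: bounded_Lfun_oo (fun x => lip_derive_bound x v1); exact: measurable_lip_derive v1.
apply/Lnorm_ooP; apply: ae_imp (ae_weak_derivativeE v1) => x ->.
exact: lip_derive_bound v1.
Qed.

End WeakDerivatives.

(** * Primitives *)

Section Primitive.
Context {R : realType}.
Notation mu := (@lebesgue_measure R).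
Implicit Types (f u v w : R -> R) (s t r : R).

Lemma Rintegral_itv_ge f s t : t <= s -> \int[mu]_(x in `[s, t]) f x = 0.
Proof.
rewrite le_eqVlt => /predU1P[->|ts]; first by rewrite set_itv1 Rintegral_set1.
by rewrite set_itv_ge ?bnd_simp -?ltNge// Rintegral_set0.
Qed.

Section BoundedIntegrand.
Variables (g : R -> R) (M : R).
Hypotheses (mg : measurable_fun setT g) (gM : forall t, `|g t| <= M).

Lemma Rintegral_itv_cat s t r : s <= t -> t <= r ->
  \int[mu]_(x in `[s, t]) g x + \int[mu]_(x in `[t, r]) g x =
  \int[mu]_(x in `[s, r]) g x.
Proof.
move=> st tr; rewrite -[X in _ + X]Rintegral_itv_obnd_cbnd; last first.
  exact: (@bounded_integrable_itv _ _ M).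
rewrite -(@Rintegral_itvB _ g (BLeft s) (BRight r) t) ?bnd_simp//; last first.
  exact: (@bounded_integrable_itv _ _ M).
by rewrite addrC subrK.
Qed.

Lemma Rintegral_itv_bound s t : s <= t ->
  `|\int[mu]_(x in `[s, t]) g x| <= M * (t - s).
Proof.
move=> st; have ig := @bounded_integrable_itv _ g M s t true false mg gM.
apply: (le_trans (le_normr_Rintegral _ ig)) => //.
have -> : M * (t - s) = \int[mu]_(x in `[s, t]) M.
  rewrite Rintegral_cst//= lebesgue_measure_itv/= lte_fin.
  by case: ltP => // ts; have -> : t = s; [apply/eqP; rewrite eq_le ts st|rewrite subrr].
apply: le_Rintegral => //; first exact: integrable_norm.
apply: (@bounded_integrable_itv _ _ `|M|) => // x; exact: measurable_cst.
Qed.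

(** At most one of the two segments has positive length. *)
Definition primitive t : R :=
  \int[mu]_(x in `[0, t]) g x - \int[mu]_(x in `[t, 0]) g x.

Lemma primitiveB s t : s <= t -> primitive t - primitive s = \int[mu]_(x in `[s, t]) g x.
Proof.
move=> st; rewrite /primitive; have [s0|s0] := leP 0 s.
  have t0 := le_trans s0 st.
  rewrite !(@Rintegral_itv_ge _ _ 0)// !subr0 -(Rintegral_itv_cat s0 st).
  by rewrite addrAC subrr add0r.
have {}s0 := ltW s0; rewrite (@Rintegral_itv_ge _ 0 s)// sub0r opprK.
have [t0|t0] := leP 0 t.
  by rewrite (@Rintegral_itv_ge _ t 0)// subr0 addrC Rintegral_itv_cat.
have {}t0 := ltW t0; rewrite (@Rintegral_itv_ge _ 0 t)// sub0r.
by rewrite -(Rintegral_itv_cat st t0) addrC addrK.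
Qed.

Lemma lip_primitive : lip M primitive.
Proof.
move=> x y; wlog xy : x y / x <= y.
  by move=> h; have [/h//|/ltW/h] := leP x y; rewrite distrC (distrC x).
rewrite distrC (distrC x) primitiveB// (@ger0_norm _ (y - x)) ?subr_ge0//.
exact: Rintegral_itv_bound.
Qed.

Lemma ae_is_derive_primitive : {ae mu, forall x, is_derive x (1 : R) primitive (g x)}.
Proof.
apply: FTC_ae_derive; first exact: bounded_locally_integrable gM.
by move=> s t st; rewrite primitiveB.
Qed.

End BoundedIntegrand.

Lemma FTC_is_derive v g : continuous g ->
  (forall s t, s <= t -> \int[mu]_(x in `[s, t]) g x = v t - v s) ->
  forall t, is_derive t (1 : R) v (g t).
Proof.
move=> cg vg t; have lg := continuous_locally_integrable cg.
have [||||dx dE] := @continuous_FTC1_closed _ g (t - 1) t (t + 1).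
- by rewrite ltrDl.
- exact: (@locally_integrable_itv _ g (t - 1) (t + 1) true false lg).
- by rewrite ltrBlDr ltrDl.
- exact: cg.
have d : is_derive t (1 : R) (fun y => \int[mu]_(x in `[t - 1, y]) g x) (g t).
  by rewrite -dE derive1E; exact: derivableP.
have d2 := is_deriveD d (is_derive_cst (v (t - 1)) t (1 : R)).
rewrite addr0 in d2; apply: near_eq_is_derive d2.
near=> y; rewrite !fctE vg ?subrK// ltW//.
by near: y; apply: lt_nbhsr; rewrite ltrBlDr ltrDl.
Unshelve. all: by end_near. Qed.
End Primitive.

(** * Lebesgue measurable functions and Borel representatives *)

Section LebesgueVersusBorel.
Context {R : realType}.
Notation mu := (@lebesgue_measure R).
Notation cmu := (@completed_lebesgue_measure R).
Notation LR := (lebesgue_measurable_type R).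
Notation BR := (measurableTypeR R).

Lemma borel_lebesgue_measurable (A : set R) :
  measurable (A : set BR) -> measurable (A : set LR).
Proof. by move=> mA; exact: sub_caratheodory. Qed.

Lemma borel_measurable_fun_lebesgue d (T : measurableType d) (f : R -> T) :
  measurable_fun [set: BR] f -> measurable_fun [set: LR] f.
Proof.
move=> mf _ Y mY; apply: borel_lebesgue_measurable; exact: mf.
Qed.

Lemma integral_completed (f : R -> \bar R) : measurable_fun [set: BR] f ->
  (forall x, 0 <= f x)%E -> (\int[cmu]_x f x = \int[mu]_x f x)%E.
Proof.
move=> mf f0.
have mid : measurable_fun [set: LR] (@id R : LR -> BR).
  by apply: borel_measurable_fun_lebesgue; exact: measurable_id.
transitivity (\int[pushforward cmu (@id R : LR -> BR)]_x f x)%E; last first.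
  by apply: eq_measure_integral.
by rewrite ge0_integral_pushforward.
Qed.

(** Each rational sublevel set is Borel up to a null set; outside the countable
    union of these null sets the function is Borel. *)
Lemma borel_representative (a : R -> R) (c : R) : lebesgue_measurable_fun a ->
  exists N : set BR, [/\ measurable N, mu N = 0%E &
    measurable_fun [set: BR] (fun t => if t \in N then c else a t)].
Proof.
move=> ma.
have hq (q : rat) : exists AM : set BR * set BR, [/\ measurable AM.1, measurable AM.2,
    mu AM.2 = 0%E & forall t, ~ AM.2 t -> (a t < ratr q <-> AM.1 t)].
  have : measurable (a @^-1` `]-oo, ratr q[ : set LR).
    by rewrite -[X in measurable X]setTI; apply: ma => //; exact: measurable_itv.
  rewrite -[X in X _]completed_caratheodory_measurable g_sigma_completed_algebra_genE.
  move=> [A mA [N [M [mM M0 NM]] ANE]]; exists (A, M); split => //= t Mt.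
  have -> : (a t < ratr q) = (a @^-1` `]-oo, ratr q[) t :> Prop by rewrite /= in_itv.
  rewrite -ANE; split; last by left.
  by case => // /NM.
have [AM hAM] := choice hq.
pose e n := odflt 0%Q (@unpickle rat n).
pose N := \bigcup_n (AM (e n)).2; exists N.
have mN : measurable (N : set BR).
  by apply: bigcupT_measurable => n; have [] := hAM (e n).
have N0 : mu N = 0%E.
  apply: measure_negligible => //; apply: negligible_bigcup => n.
  by have [_ ? ? _] := hAM (e n); exact/negligibleP.
split => //.
move=> _; apply: (measurability _ (RGenInftyO.measurableE R)) => //.
move=> _ [_ [r ->] <-]; rewrite setTI.
rewrite (_ : _ @^-1` _ = \bigcup_(n in [set n | ratr (e n) < r])
    ((AM (e n)).1 `\` N `|` [set t | t \in N /\ c < ratr (e n)])); last first.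
  apply/seteqP; split => [t|t [n /= nr]].
    rewrite /= in_itv/= => /rat_in_itvoo[q]; rewrite in_itv/= => /andP[tq qr].
    have eq : e (pickle q) = q by rewrite /e pickleK.
    exists (pickle q); rewrite /= eq//.
    move: tq; case: ifPn => [tN cq|]; first by right.
    rewrite notin_setE => tN aq; left; split => //.
    have [_ _ _ /(_ t) h] := hAM q; apply/h => //.
    by move=> Mt; apply: tN; exists (pickle q) => //; rewrite eq.
  rewrite in_itv/= => -[[At tN]|[tN cn]].
    rewrite memNset//; have [_ _ _ /(_ t) h] := hAM (e n).
    by apply: lt_trans nr; apply/h => // Mt; apply: tN; exists n.
  by rewrite tN (lt_trans cn).
apply: bigcup_measurable => n _; apply: measurableU.
  by apply: measurableD => //; have [] := hAM (e n).
have [cn|nc] := boolP (c < ratr (e n)).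
  rewrite (_ : [set t | _] = N)//; apply/seteqP; split => [t /= [/set_mem//]|t Nt].
  by split => //; exact: mem_set.
rewrite (_ : [set t | _] = set0)//; apply/seteqP; by split => [t /= [_ cn]|//].
Qed.

Lemma eq_integral_completed (f g : R -> \bar R) : measurable_fun [set: LR] f ->
  measurable_fun [set: BR] g -> (forall x, 0 <= f x)%E -> (forall x, 0 <= g x)%E ->
  {ae mu, forall x, f x = g x} -> (\int[cmu]_x f x = \int[mu]_x g x)%E.
Proof.
move=> mf mg f0 g0 fg; rewrite -integral_completed//.
apply: ge0_ae_eq_integral; [exact: measurableT|exact: mf| | | |].
- exact: borel_measurable_fun_lebesgue mg.
- by move=> x _; exact: f0.
- by move=> x _; exact: g0.
have [A [mA A0 fgA]] := fg.
exists A; split => //; first exact: borel_lebesgue_measurable.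
by apply: subset_trans fgA => x /= h fgx; apply: h => _.
Qed.

End LebesgueVersusBorel.

(** * The Born-Infeld integrand and its Legendre transform *)

Section BornInfeld.
Context {R : realType}.
Implicit Types (p q m A : R).

(** Written with the norm so as to be convertible to the integrand of [action]. *)
Definition born p : R := 1 - Num.sqrt (1 - `|p| ^+ 2).

(** The inverse of the flux p / sqrt (1 - p^2). *)
Definition velocity q : R := q / Num.sqrt (1 + q ^+ 2).

Lemma sqrt1D_gt0 q : 0 < Num.sqrt (1 + q ^+ 2).
Proof. by rewrite sqrtr_gt0 ltr_pwDl// sqr_ge0. Qed.

Lemma sqr_sqrt1D q : Num.sqrt (1 + q ^+ 2) ^+ 2 = 1 + q ^+ 2.
Proof. by rewrite sqr_sqrtr// addr_ge0// sqr_ge0. Qed.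

Lemma sqr_velocity q : 1 - velocity q ^+ 2 = (Num.sqrt (1 + q ^+ 2) ^+ 2)^-1.
Proof.
have s0 := sqrt1D_gt0 q; have sE := sqr_sqrt1D q.
rewrite /velocity expr_div_n; set r := Num.sqrt _ in s0 sE *.
have -> : q ^+ 2 = r ^+ 2 - 1 by rewrite sE addrAC subrr add0r.
by field; rewrite gt_eqF.
Qed.

Lemma velocity_lt1 q : `|velocity q| < 1.
Proof.
rewrite -(ltr_pXn2r (n := 2))// ?nnegrE// expr1n real_normK ?num_real//.
by rewrite -subr_gt0 sqr_velocity invr_gt0 exprn_gt0// sqrt1D_gt0.
Qed.

Lemma sqrt_sub_velocity q :
  Num.sqrt (1 - `|velocity q| ^+ 2) = (Num.sqrt (1 + q ^+ 2))^-1.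
Proof.
rewrite real_normK ?num_real// sqr_velocity -exprVn sqrtr_sqr ger0_norm//.
Qed.

Lemma velocityK q : velocity q / Num.sqrt (1 - `|velocity q| ^+ 2) = q.
Proof. by rewrite sqrt_sub_velocity invrK divfK// gt_eqF// sqrt1D_gt0. Qed.

Lemma velocity_inj : injective velocity.
Proof. by move=> q q' h; rewrite -(velocityK q) h velocityK. Qed.

Lemma born_ge0 p : 0 <= born p.
Proof.
by rewrite subr_ge0 -[leRHS]sqrtr1 ler_wsqrtr// gerBl exprn_ge0.
Qed.

Lemma born_le1 p : born p <= 1.
Proof. by rewrite gerBl sqrtr_ge0. Qed.

Lemma born0 : born 0 = 0.
Proof. by rewrite /born normr0 expr0n subr0 sqrtr1 subrr. Qed.

Lemma born_mono p q : `|p| <= `|q| -> born p <= born q.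
Proof.
move=> pq; rewrite lerD2l lerN2 ler_wsqrtr// lerD2l lerN2.
by rewrite ler_pXn2r// nnegrE.
Qed.

Lemma continuous_born : continuous born.
Proof.
move=> p; apply: cvgB; first exact: cvg_cst.
have sq : 1 - `|x| ^+ 2 @[x --> p] --> 1 - `|p| ^+ 2.
  apply: cvgB; first exact: cvg_cst.
  by apply: cvgM; apply: cvg_norm; exact: cvg_id.
exact: (cvg_comp _ _ sq (@sqrt_continuous R _)).
Qed.

(** With s = sqrt (1 - p^2), Lagrange's identity
    (q p + s)^2 + (q s - p)^2 = 1 + q^2 is Young's inequality for the pair
    1 - sqrt (1 - p^2), sqrt (1 + q^2) - 1 with its equality case. *)
Lemma born_young p q : `|p| <= 1 -> q * p - (Num.sqrt (1 + q ^+ 2) - 1) <= born p.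
Proof.
move=> p1; rewrite /born; set s := Num.sqrt (1 - _); set r := Num.sqrt _.
have s0 : 0 <= s by exact: sqrtr_ge0.
have r0 : 0 < r by exact: sqrt1D_gt0.
have rE : r ^+ 2 = 1 + q ^+ 2 by exact: sqr_sqrt1D.
have sE : s ^+ 2 = 1 - p ^+ 2.
  rewrite /s sqr_sqrtr ?real_normK ?num_real// subr_ge0.
  by rewrite -real_normK ?num_real// expr_le1.
suff : q * p + s <= r by lra.
have [le0|gt0] := leP (q * p + s) 0; first by rewrite (le_trans le0)// ltW.
rewrite -(ler_pXn2r (n := 2)) ?nnegrE ?(ltW gt0) ?(ltW r0)//.
have -> : r ^+ 2 = (q * p + s) ^+ 2 + (q * s - p) ^+ 2 + (1 - p ^+ 2 - s ^+ 2) * (1 + q ^+ 2).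
  by rewrite rE; ring.
by rewrite sE subrr mul0r addr0 lerDl sqr_ge0.
Qed.

Lemma born_velocity q :
  born (velocity q) = q * velocity q - (Num.sqrt (1 + q ^+ 2) - 1).
Proof.
rewrite /born sqrt_sub_velocity /velocity; set r := Num.sqrt _.
have r0 : 0 < r by exact: sqrt1D_gt0.
have -> : q * (q / r) = (r ^+ 2 - 1) / r by rewrite mulrA -expr2 /r sqr_sqrt1D; congr (_ / _); ring.
by field; rewrite gt_eqF.
Qed.

(** Equality in Young's inequality forces the square in Lagrange's identity
    to vanish, that is [q sqrt (1 - p^2) = p]. *)
Lemma born_young_eq p q : `|p| <= 1 ->
  born p = q * p - (Num.sqrt (1 + q ^+ 2) - 1) -> p = velocity q.
Proof.
move=> p1; rewrite /born /velocity; set s := Num.sqrt (1 - _); set r := Num.sqrt _.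
have s0 : 0 <= s by exact: sqrtr_ge0.
have r0 : 0 < r by exact: sqrt1D_gt0.
have rE : r ^+ 2 = 1 + q ^+ 2 by exact: sqr_sqrt1D.
have sE : s ^+ 2 = 1 - p ^+ 2.
  rewrite /s sqr_sqrtr ?real_normK ?num_real// subr_ge0.
  by rewrite -real_normK ?num_real// expr_le1.
move=> h; have h1 : q * p + s = r by lra.
have : (q * s - p) ^+ 2 = 0.
  have -> : (q * s - p) ^+ 2 = r ^+ 2 - (q * p + s) ^+ 2 - (1 - p ^+ 2 - s ^+ 2) * (1 + q ^+ 2).
    by rewrite rE; ring.
  by rewrite h1 sE; ring.
move/eqP; rewrite sqrf_eq0 subr_eq0 => /eqP qs.
have sr : s * r = 1 by rewrite -h1 mulrDr -expr2 sE mulrA (mulrC s) qs; ring.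
by rewrite -qs -[LHS]mulr1 -(mulfV (lt0r_neq0 r0)) mulrA -(mulrA q) sr mulr1.
Qed.

(** born is the supremum of its affine minorants; at |m| = 1 the slope
    has to go to infinity. *)
Lemma born_sup m A : `|m| <= 1 ->
  (forall q, q * m - (Num.sqrt (1 + q ^+ 2) - 1) <= A) -> born m <= A.
Proof.
move=> m1 hA; have [mlt|m1'] := ltP `|m| 1.
  pose s := Num.sqrt (1 - `|m| ^+ 2).
  have s0 : 0 < s.
    by rewrite sqrtr_gt0 subr_gt0 expr_lt1.
  have vm : velocity (m / s) = m.
    have sE : s ^+ 2 = 1 - m ^+ 2.
      rewrite /s sqr_sqrtr ?real_normK ?num_real// subr_ge0.
      by rewrite -real_normK ?num_real// expr_le1.
    rewrite /velocity.
    have -> : 1 + (m / s) ^+ 2 = (s^-1) ^+ 2.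
      have -> : (m / s) ^+ 2 = (1 - s ^+ 2) / s ^+ 2 by rewrite expr_div_n sE; congr (_ / _); ring.
      by field; rewrite gt_eqF.
    by rewrite sqrtr_sqr ger0_norm ?invr_ge0 ?ltW// invrK divfK// gt_eqF.
  by have := hA (m / s); rewrite -{2}vm -born_velocity vm.
apply: (le_trans (born_le1 m)).
have {m1 m1'} m1 : `|m| = 1 by apply/eqP; rewrite eq_le m1.
rewrite leNgt; apply/negP => A1.
(* the slope at which the affine minorant exceeds A if A < 1 *)
pose k := (1 - A)^-1.
have k0 : 0 < k by rewrite invr_gt0 subr_gt0.
have := hA (k * m).
rewrite -mulrA -expr2 exprMn -(real_normK (num_real m)) m1 expr1n !mulr1.
have : Num.sqrt (1 + k ^+ 2) <= k + k^-1 / 2.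
  have -> : k + k^-1 / 2 = Num.sqrt ((k + k^-1 / 2) ^+ 2).
    rewrite sqrtr_sqr ger0_norm//; apply: addr_ge0; first exact: ltW.
    by apply: divr_ge0 => //; rewrite invr_ge0 ltW.
  rewrite ler_wsqrtr//.
  have -> : (k + k^-1 / 2) ^+ 2 = 1 + k ^+ 2 + (k^-1 / 2) ^+ 2 by field; rewrite gt_eqF.
  by rewrite lerDl sqr_ge0.
rewrite /k invrK; lra.
Qed.

(** A supremum of affine functions is convex. *)
Lemma born_convex p p' e : `|p| <= 1 -> `|p'| <= 1 -> 0 <= e <= 1 ->
  born ((1 - e) * p + e * p') <= (1 - e) * born p + e * born p'.
Proof.
move=> p1 p1' /andP[e0 e1]; have e1' : 0 <= 1 - e by rewrite subr_ge0.
apply: born_sup.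
  apply: (le_trans (ler_normD _ _)); rewrite !normrM (ger0_norm e1') (ger0_norm e0).
  by have := ler_wpM2l e1' p1; have := ler_wpM2l e0 p1'; lra.
move=> q; have := ler_wpM2l e1' (born_young q p1).
have := ler_wpM2l e0 (born_young q p1').
set r := Num.sqrt _; lra.
Qed.

Lemma velocity_lip q q' : `|velocity q - velocity q'| <= 2 * `|q - q'|.
Proof.
rewrite /velocity; set r := Num.sqrt _; set r' := Num.sqrt (1 + q' ^+ 2).
have r0 : 0 < r by exact: sqrt1D_gt0.
have r'0 : 0 < r' by exact: sqrt1D_gt0.
have rE : r ^+ 2 = 1 + q ^+ 2 by exact: sqr_sqrt1D.
have r'E : r' ^+ 2 = 1 + q' ^+ 2 by exact: sqr_sqrt1D.
have qr : `|q| <= r.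
  by rewrite -(ler_pXn2r (n := 2)) ?nnegrE ?(ltW r0)// rE real_normK ?num_real// lerDr.
have qr' : `|q'| <= r'.
  by rewrite -(ler_pXn2r (n := 2)) ?nnegrE ?(ltW r'0)// r'E real_normK ?num_real// lerDr.
have r1 : 1 <= r.
  by rewrite -(ler_pXn2r (n := 2)) ?nnegrE ?(ltW r0)// rE expr1n lerDl sqr_ge0.
have rr : `|r' - r| <= `|q - q'|.
  have rr0 : 0 < r' + r by rewrite addr_gt0.
  rewrite -(ler_pM2r rr0) -{1}(gtr0_norm rr0) -normrM.
  have -> : (r' - r) * (r' + r) = (q' - q) * (q' + q) by rewrite -!subr_sqr rE r'E; ring.
  rewrite normrM (distrC q') ler_wpM2l// (le_trans (ler_normD _ _))// lerD//.
have -> : q / r - q' / r' = ((q - q') * r' + q' * (r' - r)) / (r * r').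
  by field; rewrite !gt_eqF.
rewrite normrM normfV (gtr0_norm (mulr_gt0 r0 r'0)) ler_pdivrMr ?mulr_gt0//.
apply: (le_trans (ler_normD _ _)); rewrite !normrM (gtr0_norm r'0).
apply: (@le_trans _ _ (`|q - q'| * r' + r' * `|q - q'|)).
  by rewrite lerD2l ler_pM.
have -> : `|q - q'| * r' + r' * `|q - q'| = 2 * `|q - q'| * (1 * r') by ring.
by rewrite ler_wpM2l ?mulr_ge0// ler_wpM2r// ltW.
Qed.

End BornInfeld.

(** * Prescribing the total displacement *)

Section VelocityWindow.
Context {R : realType}.
Notation mu := (@lebesgue_measure R).
Implicit Types (q r d : R) (G : R -> R).

Lemma velocityN q : velocity (- q) = - velocity q.
Proof. by rewrite /velocity sqrrN mulNr. Qed.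

Lemma velocity_ge_half q : 1 <= q -> 1 / 2 <= velocity q.
Proof.
move=> q1; have q0 : 0 < q by apply: lt_le_trans q1.
rewrite /velocity ler_pdivlMr ?sqrt1D_gt0// mul1r ler_pdivrMl ?ltr0n//.
have -> : 2 * q = Num.sqrt ((2 * q) ^+ 2) by rewrite sqrtr_sqr ger0_norm// mulr_ge0// ltW.
apply: ler_wsqrtr; have := ler_pM ler01 ler01 q1 q1; rewrite exprMn -!expr2; nra.
Qed.

Lemma continuous_velocity : continuous (@velocity R).
Proof. by apply: (@lip_continuous _ 2) => x y; exact: velocity_lip. Qed.

Lemma continuous_velocity_shift G c : continuous G -> continuous (fun t => velocity (G t + c)).
Proof.
move=> cG x; have h : G t + c @[t --> x] --> G x + c by apply: cvgD; [exact: cG|exact: cvg_cst].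
exact: (cvg_comp _ _ h (@continuous_velocity _)).
Qed.

Lemma velocity_shift_bound G c t : `|velocity (G t + c)| <= 1.
Proof. exact/ltW/velocity_lt1. Qed.

(** The integral is continuous in [c], and it is at least [r] for [c] large
    and at most [-r] for [-c] large, as [velocity] tends to 1 and -1. *)
Lemma velocity_shift_choice G r d : continuous G -> 0 < r -> `|d| <= r ->
  exists c, \int[mu]_(t in `[- r, r]) velocity (G t + c) = d.
Proof.
move=> cG r0 dr.
have rr : - r <= r by lra.
have mrr : measurable (`[- r, r]%classic : set (measurableTypeR R)) by exact: measurable_itv.
have mesr : fine (mu `[- r, r]) = 2 * r.
  rewrite lebesgue_measure_itv/= lte_fin ifT; first by rewrite /=; ring.
  by lra.
have iv c : mu.-integrable `[- r, r] (EFin \o (fun t => velocity (G t + c))).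
  apply: (@bounded_integrable_itv _ _ 1); last by move=> t; exact: velocity_shift_bound.
  by apply: continuous_measurable_fun; exact: continuous_velocity_shift.
have ic c : mu.-integrable `[- r, r] (EFin \o (cst c : R -> R)).
  by apply: (@bounded_integrable_itv _ _ `|c|) => // x; exact: measurable_cst.
pose F c := \int[mu]_(t in `[- r, r]) velocity (G t + c).
have F_lip : lip (4 * r) F.
  move=> x y; rewrite /F -RintegralB//.
  apply: (le_trans (le_normr_Rintegral _ _)) => //; first exact: integrable_EFinB.
  have -> : 4 * r * `|x - y| = \int[mu]_(t in `[- r, r]) (2 * `|x - y|).
    by rewrite Rintegral_cst//= mesr; ring.
  apply: le_Rintegral => //.
  - by apply: integrable_norm; exact: integrable_EFinB.
  - exact: ic.
  by move=> t _; rewrite (le_trans (velocity_lip _ _))// opprD addrACA subrr add0r.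
have [Q Q0 GQ] := continuous_bounded_itv (- r) r cG.
have GQ' t : - r <= t <= r -> - Q <= G t <= Q by move=> /GQ; rewrite ler_norml.
have Fhi : r <= F (Q + 1).
  have {1}-> : r = \int[mu]_(t in `[- r, r]) (1 / 2) by rewrite Rintegral_cst//= mesr; field.
  apply: le_Rintegral => //; first exact: ic.
  move=> t; rewrite /= in_itv/= => /GQ'/andP[h _].
  by apply: velocity_ge_half; lra.
have Flo : F (- (Q + 1)) <= - r.
  have {1}-> : - r = \int[mu]_(t in `[- r, r]) (- (1 / 2)) by rewrite Rintegral_cst//= mesr; field.
  apply: le_Rintegral => //; first exact: ic.
  move=> t; rewrite /= in_itv/= => /GQ'/andP[_ h].
  rewrite lerNr -velocityN; apply: velocity_ge_half; lra.
move: dr; rewrite ler_norml => /andP[d1 d2].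
have cF : {within `[- (Q + 1), Q + 1], continuous F}.
  by apply: continuous_subspaceT; exact: lip_continuous F_lip.
have QQ : - (Q + 1) <= Q + 1 by lra.
have [|c _ <-] := @IVT R F (- (Q + 1)) (Q + 1) d QQ cF; last by exists c.
have := le_trans d2 Fhi; have := le_trans Flo d1 => h1 h2.
by rewrite ge_min h1 le_max h2 orbT.
Qed.
End VelocityWindow.

(** * Translations and difference quotients *)

Section Translation.
Context {R : realType}.
Notation mu := (@lebesgue_measure R).
Notation BR := (measurableTypeR R).
Implicit Types (f u v w : R -> R) (K h : R).

Lemma measurable_shift h : measurable_fun [set: BR] (fun x : BR => x + h : BR).
Proof. exact: measurable_funD. Qed.

Lemma lebesgue_measure_shift h (A : set BR) : measurable A ->
  mu ((fun x => x + h) @^-1` A) = mu A.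
Proof.
move=> mA.
apply/esym.
rewrite -[RHS]/(pushforward mu (fun x : BR => x + h : BR) A).
move: A mA; apply: lebesgue_measure_unique; first exact: measurable_shift.
move=> mh _ [[a b] _ <-] /=.
rewrite /pushforward (_ : _ @^-1` _ = `](a - h), (b - h)]%classic); last first.
  by apply/seteqP; split => x /=; rewrite !in_itv/= ltrBlDr lerBrDr.
by rewrite !lebesgue_measure_itv/= !lte_fin ltrD2r -!EFinB opprB addrA subrK.
Qed.

Lemma integral_shift h (f : R -> \bar R) : measurable_fun [set: BR] f ->
  (forall x, 0 <= f x)%E -> (\int[mu]_x f (x + h)%R = \int[mu]_x f x)%E.
Proof.
move=> mf f0.
transitivity (\int[pushforward mu (fun x : BR => (x + h)%R : BR)]_x f x)%E.
  rewrite ge0_integral_pushforward//; exact: measurable_shift.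
apply: eq_measure_integral; first exact: measurable_shift.
by move=> mh A mA _; exact: lebesgue_measure_shift.
Qed.

Lemma ae_shift h (P : R -> Prop) : {ae mu, forall x, P x} -> {ae mu, forall x, P (x + h)}.
Proof.
move=> [A [mA A0 PA]]; exists ((fun x => x + h) @^-1` A); split.
- by rewrite -[X in measurable X]setTI; exact: measurable_shift.
- by rewrite lebesgue_measure_shift.
- by move=> x /= Px; apply: PA.
Qed.

(** Jensen's inequality, proved by integrating the affine minorants of [born]. *)
Lemma born_diff_quotient_le u t h : 0 < h -> lip 1 u ->
  h * born ((u (t + h) - u t) / h) <=
    \int[mu]_(x in `[t, t + h]) born (lip_derive u x).
Proof.
move=> h0 u1.
have th : t <= t + h by rewrite lerDl ltW.
have mD := measurable_lip_derive u1.
have iD := @integrable_lip_derive _ _ _ t (t + h) true false u1.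
have iB : mu.-integrable `[t, t + h] (EFin \o (fun x => born (lip_derive u x))).
  apply: (@bounded_integrable_itv _ _ 1).
    by apply: measurableT_comp => //; apply: continuous_measurable_fun; exact: continuous_born.
  by move=> x; rewrite ger0_norm ?born_ge0// born_le1.
rewrite -ler_pdivlMl//; apply: born_sup.
  rewrite normrM normfV (gtr0_norm h0) ler_pdivrMr// mul1r.
  by apply: (le_trans (u1 _ _)); rewrite mul1r addrAC subrr add0r gtr0_norm.
move=> q; set c := Num.sqrt _ - 1; rewrite ler_pdivlMl//.
have -> : h * (q * ((u (t + h) - u t) / h) - c) = q * (u (t + h) - u t) - c * h.
  by field; rewrite gt_eqF.
rewrite -(lip_FTC th u1).
have -> : c * h = \int[mu]_(x in `[t, t + h]) c.
  rewrite Rintegral_cst//= lebesgue_measure_itv/= lte_fin ltrDl h0 -EFinB/=.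
  by rewrite addrAC subrr add0r.
have ic : mu.-integrable `[t, t + h] (EFin \o (fun=> c)).
  exact: (@bounded_integrable_itv _ _ `|c|).
have iq : mu.-integrable `[t, t + h] (EFin \o (fun x => q * lip_derive u x)).
  apply: (@bounded_integrable_itv _ _ (`|q| * 1)); first exact: measurable_funM.
  by move=> x; rewrite normrM ler_wpM2l// lip_derive_bound.
rewrite -RintegralZl// -RintegralB//.
apply: le_Rintegral => //; first exact: integrable_EFinB.
by move=> x _; apply: born_young; exact: lip_derive_bound.
Qed.

(** Jensen's inequality on every window [t, t + h], then Tonelli's theorem. *)
Lemma energy_diff_quotient_le u h : 0 < h -> lip 1 u ->
  (\int[mu]_t (born ((u (t + h) - u t) / h))%:E <=
   \int[mu]_t (born (lip_derive u t))%:E)%E.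
Proof.
move=> h0 u1; have mu_ := measurable_lip u1; have mD := measurable_lip_derive u1.
have mB : measurable_fun setT (@born R).
  by apply: continuous_measurable_fun; exact: continuous_born.
pose F x := born (lip_derive u x).
have mF : measurable_fun setT F by exact: measurableT_comp.
have F0 x : 0 <= F x by exact: born_ge0.
(* integrated first in z.2, the energy of the window [t, t + h] at t = z.1;
   first in z.1, h times the density at z.2 *)
pose k (z : BR * BR) : \bar R := (F z.2 * \1_(`[0, h]%classic : set BR) (z.2 - z.1))%:E.
have k0 z : (0 <= k z)%E by rewrite lee_fin mulr_ge0.
have mk : measurable_fun setT k.
  apply/measurable_EFinP; apply: measurable_funM.
    by apply: measurableT_comp.
  apply: measurableT_comp; first exact: measurable_indic.
  by apply: measurable_funB; [exact: measurable_snd|exact: measurable_fst].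
have kL t : (\int[mu]_x k (t, x) = (\int[mu]_(x in `[t, t + h]) F x)%:E)%E.
  rewrite /Rintegral fineK; last first.
    apply: integrable_fin_num => //; apply: (@bounded_integrable_itv _ _ 1) => // x.
    by rewrite ger0_norm ?born_ge0// born_le1.
  rewrite [RHS]integral_mkcond; apply: eq_integral => x _.
  rewrite /k/= patchE indicE !mem_setE !in_itv/= subr_ge0 lerBlDl.
  by case: ifP => _; rewrite ?mulr1 ?mulr0.
have kR x : (\int[mu]_t k (t, x) = (F x)%:E * h%:E)%E.
  rewrite (eq_integral (fun t => (F x)%:E * (\1_(`[x - h, x]%classic : set BR) t)%:E)%E); last first.
    move=> t _; rewrite /k/= EFinM; congr (_ * (_)%:E)%E.
    rewrite !indicE !mem_setE !in_itv/= subr_ge0 lerBlDr lerBlDl addrC.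
    by rewrite andbC -lerBlDl addrC.
  rewrite ge0_integralZl_EFin//; last first.
    by apply/measurable_EFinP; exact: measurable_indic.
  rewrite integral_indic// setIT; congr (_ * _)%E.
  transitivity (mu `[x - h, x]%classic) => //.
  rewrite lebesgue_measure_itv/= lte_fin ltrBlDr ltrDl h0.
  by rewrite -EFinB opprB addrCA subrr addr0.
have : (\int[mu]_x \int[mu]_y k (x, y) = \int[mu]_y \int[mu]_x k (x, y))%E.
  exact: fubini_tonelli.
under eq_integral do rewrite kL.
under [X in _ = X -> _]eq_integral do rewrite kR.
rewrite ge0_integralZr//; last 3 first.
- exact/measurable_EFinP.
- by move=> x _; rewrite lee_fin.
- by rewrite lee_fin ltW.
move=> E.
have mq : measurable_fun [set: BR] (fun t : R => (born ((u (t + h) - u t) / h))%:E).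
  apply/measurable_EFinP; apply: measurableT_comp => //.
  apply: measurable_funM => //; apply: measurable_funB => //.
  by apply: measurableT_comp => //; exact: measurable_shift.
rewrite -(@lee_pmul2r _ h%:E)// -E -ge0_integralZr//; last 2 first.
- by move=> t _; rewrite lee_fin born_ge0.
- by rewrite lee_fin ltW.
apply: ge0_le_integral => //.
- by move=> t _; rewrite -EFinM lee_fin mulr_ge0 ?born_ge0// ltW.
- by apply: emeasurable_funM; [exact: mq|exact: measurable_cst].
- rewrite (_ : (fun t => _) = fubini_F mu k); first exact: measurable_fun_fubini_tonelli_F.
  by apply/funext => t; rewrite -kL.
- move=> t _; rewrite -EFinM lee_fin mulrC; exact: born_diff_quotient_le.
Qed.

End Translation.

(** * Limits of Lipschitz functions *)

Section LipschitzSequences.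
Context {R : realType}.
Notation mu := (@lebesgue_measure R).
Notation BR := (measurableTypeR R).
Implicit Types (f g u v w : R -> R) (K h : R).

Lemma fatou_le (f_ : nat -> R -> R) f (c : R) :
  (forall n, measurable_fun [set: BR] (f_ n)) -> (forall n x, 0 <= f_ n x) ->
  measurable_fun [set: BR] f -> (forall x, 0 <= f x) ->
  {ae mu, forall x, f_ n x @[n --> \oo] --> f x} ->
  (forall e, 0 < e -> \forall n \near \oo, (\int[mu]_x (f_ n x)%:E <= (c + e)%:E)%E) ->
  (\int[mu]_x (f x)%:E <= c%:E)%E.
Proof.
move=> mf_ f_0 mf f0 ff hc.
have mEf n : measurable_fun [set: BR] (fun x => (f_ n x)%:E) by exact/measurable_EFinP.
have -> : (\int[mu]_x (f x)%:E = \int[mu]_x limn_einf (fun n => (f_ n x)%:E))%E.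
  apply: ge0_ae_eq_integral => //.
  - exact/measurable_EFinP.
  - rewrite /limn_einf; apply: (measurableT_comp (f := -%E)) => //.
    by apply: measurable_fun_limn_esup => n; apply: measurableT_comp.
  - by move=> x _; rewrite lee_fin.
  - by move=> x _; rewrite limn_einf_lim; apply: lime_ge; [exact: is_cvg_einfs|];
      near=> n; apply: le_ereal_inf_tmp => _ [k _ <-]; rewrite lee_fin.
  - apply: ae_imp ff => x fx _.
    have /cvg_limn_einf_sup[-> _] // : (f_ n x)%:E @[n --> \oo] --> (f x)%:E.
    by apply: cvg_EFin => //; exact: nearW.
apply: (le_trans (fatou mu measurableT mEf _)).
  by move=> n x _; rewrite lee_fin.
apply/lee_addgt0Pr => e e0; rewrite limn_einf_lim.
apply: lime_le; first exact: is_cvg_einfs.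
have [N _ hN] := hc e e0; near=> n.
apply: (@le_trans _ _ (\int[mu]_x (f_ (maxn n N) x)%:E)%E).
  by apply: ereal_inf_lbound; exists (maxn n N) => //=; rewrite leq_maxl.
by rewrite -EFinD; apply: hN; rewrite /= leq_maxr.
Unshelve. all: by end_near. Qed.

(** Passing to the limit in the difference quotients. *)
Lemma ae_lip_derive_contraction u v : lip 1 u -> lip 1 v ->
  (forall x y, `|u x - u y| <= `|v x - v y|) ->
  {ae mu, forall t, `|lip_derive u t| <= `|lip_derive v t|}.
Proof.
move=> u1 v1 uv; apply: ae_imp2 (lip_ae_derivable u1) (lip_ae_derivable v1) => t ut vt.
rewrite !lip_derive_derivable//.
apply: (ler_cvg_to (cvg_norm (cvg_diff_quotient ut)) (cvg_norm (cvg_diff_quotient vt))).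
by near=> n; rewrite !normrM ler_wpM2l.
Unshelve. all: by end_near. Qed.

Lemma lip_glue K f g s : lip K f -> lip K g -> f s = g s ->
  lip K (fun t => if t <= s then f t else g t).
Proof.
move=> fK gK fgs x y; wlog xy : x y / x <= y.
  by move=> h; have [/h//|/ltW/h] := leP x y; rewrite distrC (distrC x).
have K0 := lip_ge0 fK.
have [ys|sy] := leP y s; first by rewrite (le_trans xy ys).
have [xs|sx] := leP x s; last exact: gK.
have -> : f x - g y = (f x - f s) + (g s - g y) by rewrite fgs addrA subrK.
apply: (le_trans (ler_normD _ _)).
apply: (le_trans (lerD (fK _ _) (gK _ _))); rewrite -mulrDr ler_wpM2l//.
rewrite (distrC x s) (distrC s y) (distrC x y) !ger0_norm ?subr_ge0 ?(ltW sy)//.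
by lra.
Qed.

(** The theorem of Arzela and Ascoli, from Tychonoff's: a cluster point for
    pointwise convergence is approached on the finite grid of mesh [1/(n+1)] of
    [[-n, n]] by some [v_ k] with [k >= n], hence on all of [[-n, n]] by the
    Lipschitz bound. *)
Lemma lip_subsequence (v_ : nat -> R -> R) : (forall n, lip 1 (v_ n)) ->
  (forall n t, `|v_ n t| <= 1) ->
  exists u, exists phi : nat -> nat, [/\ forall n, (n <= phi n)%N, lip 1 u,
    forall t, `|u t| <= 1 & forall t, v_ (phi n) t @[n --> \oo] --> u t].
Proof.
move=> v1 vb.
have cpt := @tychonoff R (fun=> R) (fun=> `[-1, 1]%classic) (fun=> @segment_compact _ (-1) 1).
pose F := v_ @ \oo.
have FF : ProperFilter F by exact: fmap_proper_filter.
have [|u [ub uF]] := cpt F FF.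
  by exists 0%N => // n _ i; rewrite /= in_itv/= -ler_norml.
have {}ub t : `|u t| <= 1 by have := ub t; rewrite /= in_itv/= -ler_norml.
(* frequently close to u on any finite set of points *)
have close (N : nat) (x : 'I_N -> R) e n : 0 < e ->
    exists2 k, (n <= k)%N & forall j, `|v_ k (x j) - u (x j)| < e.
  move=> e0.
  pose B j := [set f : R -> R | `|f (x j) - u (x j)| < e].
  have nbj j : nbhs u (B j).
    have /cvgrPdist_lt/(_ _ e0) : (f (x j) : R) @[f --> u] --> u (x j).
      exact: (@proj_continuous R (fun=> R : topologicalType) (x j) u).
    by apply: filterS => f /=; rewrite distrC.
  have nb : nbhs u [set f | forall j, B j f].
    exact: (@filter_forall _ 'I_N B (nbhs u) (nbhs_filter u) nbj).
  have Fn : F [set f | exists2 k, (n <= k)%N & f = v_ k].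
    by exists n => // k /= nk; exists k.
  have [f [[k nk ->] fu]] := uF _ _ Fn nb.
  by exists k.
have u1 : lip 1 u.
  move=> x y; rewrite mul1r; apply/ler_addgt0Pr => e e0.
  have e2 : 0 < e / 2 by rewrite divr_gt0.
  have [k _ hk] := close 2%N (fun j : 'I_2 => if j == 0%N :> nat then x else y) _ 0%N e2.
  have := hk ord0; have := hk (lift ord0 ord0); rewrite /= !ltr_distl => /andP[? ?] /andP[? ?].
  have := v1 k x y; rewrite mul1r ler_norml => /andP[? ?].
  by rewrite ler_norml; apply/andP; split; lra.
exists u.
have step (n : nat) : exists2 k, (n <= k)%N &
    forall t, `|t| <= n%:R -> `|v_ k t - u t| <= 3 * n.+1%:R^-1.
  (* the grid -n + j / (n + 1), 0 <= j <= 2 n (n + 1), of [-n, n] *)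
  pose N := (2 * n * n.+1).+1.
  pose x (j : 'I_N) : R := - n%:R + j%:R * n.+1%:R^-1.
  have i0 : 0 < n.+1%:R^-1 :> R by rewrite invr_gt0.
  have [k nk hk] := close N x _ n i0.
  exists k => // t; rewrite ler_norml => /andP[nt tn].
  pose y := (t + n%:R) * n.+1%:R.
  have y0 : 0 <= y by rewrite mulr_ge0// -lerBlDr sub0r.
  have /andP[jy yj] := truncn_itv y0.
  have jN : (Num.truncn y < N)%N.
    rewrite /N ltnS -(ler_nat R) (le_trans jy)// /y.
    rewrite mulnC natrM mulrC ler_wpM2l// natrM; lra.
  pose z : R := - n%:R + (Num.truncn y)%:R * n.+1%:R^-1.
  have hz : `|v_ k z - u z| < n.+1%:R^-1 by exact: hk (Ordinal jN).
  have tz : `|t - z| <= n.+1%:R^-1.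
    have -> : t - z = (y - (Num.truncn y)%:R) * n.+1%:R^-1.
      by rewrite mulrBl /y mulfK ?pnatr_eq0// /z; ring.
    rewrite ger0_norm; last by rewrite mulr_ge0 ?subr_ge0// ltW.
    by rewrite ler_piMl ?(ltW i0)// lerBlDr addrC natr1 ltW.
  have := v1 k t z; have := u1 t z; rewrite !mul1r => h1 h2.
  have -> : v_ k t - u t = (v_ k t - v_ k z) + (v_ k z - u z) + (u z - u t) by ring.
  apply: (le_trans (ler_normD _ _)); rewrite (distrC (u z)).
  have -> : 3 * n.+1%:R^-1 = n.+1%:R^-1 + n.+1%:R^-1 + n.+1%:R^-1 :> R by ring.
  apply: lerD; last exact: le_trans h1 tz.
  by apply: (le_trans (ler_normD _ _)); apply: lerD; [exact: le_trans h2 tz|exact: ltW].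
have [phi hphi] := choice (fun n => let: ex_intro2 k nk hk := step n in ex_intro _ k (conj nk hk)).
exists phi; split => // [n|t]; first by have [] := hphi n.
apply/cvgrPdist_le => e e0; have e3 : 0 < e / 3 by rewrite divr_gt0.
near=> n; rewrite distrC.
have [_ hn] := hphi n.
apply: (le_trans (hn t _)).
  apply: ltW; apply: (lt_le_trans (archi_boundP (normr_ge0 t))).
  by rewrite ler_nat; near: n; exact: nbhs_infty_ge.
rewrite mulrC -ler_pdivlMr// ltW//.
by near: n; exact: near_infty_natSinv_lt (PosNum e3).
Unshelve. all: by end_near. Qed.

End LipschitzSequences.

(** * The direct method *)

Section Energy.
Context {R : realType}.
Notation mu := (@lebesgue_measure R).
Notation BR := (measurableTypeR R).
Implicit Types (f g u v w : R -> R) (K h s t : R).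
Context (W b : R -> R) (a1 a2 T : R).
Hypotheses (W_C1 : C1 W) (W_N1 : W (-1) = 0) (W_1 : W 1 = 0).
Hypothesis W_gt0 : forall s, s != 1 -> s != -1 -> 0 < W s.
Hypothesis mb : measurable_fun [set: BR] b.
Hypothesis a1_gt0 : 0 < a1.
Hypothesis b_bounds : forall t, a1 <= b t <= a2.
Hypothesis T_gt0 : 0 < T.
Hypothesis b_periodic : {ae mu, forall t, b (t + T) = b t}.

Definition density v t : R := born (lip_derive v t) + b t * W (v t).

Definition energy v : \bar R := (\int[mu]_t (density v t)%:E)%E.

Definition transition v :=
  [/\ lip 1 v, v t @[t --> +oo] --> (1 : R) & v t @[t --> -oo] --> (-1 : R)].

Lemma W_ge0 s : 0 <= W s.
Proof.
have [->|s1] := eqVneq s 1; first by rewrite W_1.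
have [->|sN1] := eqVneq s (-1); first by rewrite W_N1.
exact/ltW/W_gt0.
Qed.

Lemma continuous_W : continuous W.
Proof.
have [dW _] := W_C1.
by move=> x; apply: differentiable_continuous; apply/derivable1_diffP.
Qed.

Lemma b_gt0 t : 0 < b t.
Proof. by have /andP[h _] := b_bounds t; exact: lt_le_trans h. Qed.

Lemma a2_ge0 : 0 <= a2.
Proof. by have /andP[h1 h2] := b_bounds 0; rewrite (le_trans (ltW a1_gt0))// (le_trans h1). Qed.

Lemma density_ge0 v t : 0 <= density v t.
Proof. by rewrite addr_ge0 ?born_ge0// mulr_ge0 ?W_ge0// ltW// b_gt0. Qed.

Lemma measurable_born_comp f : measurable_fun [set: BR] f ->
  measurable_fun [set: BR] (fun t => born (f t)).
Proof.
move=> mf; apply: measurableT_comp => //.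
by apply: continuous_measurable_fun; exact: continuous_born.
Qed.

Lemma measurable_potential v : measurable_fun [set: BR] v ->
  measurable_fun [set: BR] (fun t => b t * W (v t)).
Proof.
move=> mv; apply: measurable_funM => //; apply: measurableT_comp => //.
by apply: continuous_measurable_fun; exact: continuous_W.
Qed.

Lemma measurable_density K v : lip K v -> measurable_fun [set: BR] (density v).
Proof.
move=> vK; apply: measurable_funD.
  by apply: measurable_born_comp; exact: measurable_lip_derive vK.
by apply: measurable_potential; exact: measurable_lip vK.
Qed.

Lemma le_energy_ae K L u v : lip K u -> lip L v ->
  {ae mu, forall t, density u t <= density v t} -> (energy u <= energy v)%E.
Proof.
move=> uK vL uv; apply: ae_ge0_le_integral => //.
- by move=> t _; rewrite lee_fin density_ge0.
- by apply/measurable_EFinP; exact: measurable_density uK.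
- by move=> t _; rewrite lee_fin density_ge0.
- by apply/measurable_EFinP; exact: measurable_density vL.
- by apply: ae_imp uv => t h _; rewrite lee_fin.
Qed.

Lemma energy_ge0 v : (0 <= energy v)%E.
Proof. by apply: integral_ge0 => t _; rewrite lee_fin density_ge0. Qed.

Lemma transition_clamp v : transition v -> transition (clamp (-1) 1 \o v).
Proof.
move=> [v1 vy vNy]; split.
- move=> x y /=; apply: (le_trans (clamp_contraction _ _ _ _)); exact: v1.
- apply/cvgrPdist_le => e e0.
  move/cvgrPdist_le: vy => /(_ _ e0); apply: filterS => t /=; apply: le_trans.
  have := clamp_contraction (-1) 1 1 (v t); rewrite (@clamp_id _ _ _ 1)// lexx andbT; lra.
- apply/cvgrPdist_le => e e0.
  move/cvgrPdist_le: vNy => /(_ _ e0); apply: filterS => t /=; apply: le_trans.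
  have := clamp_contraction (-1) 1 (-1) (v t); rewrite (@clamp_id _ _ _ (-1))// lexx /=; lra.
Qed.

(** Truncation does not increase the slope, and the potential vanishes at the
    truncation levels. *)
Lemma energy_clamp v : lip 1 v -> (energy (clamp (-1) 1 \o v) <= energy v)%E.
Proof.
move=> v1; have c1 : lip 1 (clamp (-1) 1 \o v).
  by move=> x y /=; apply: (le_trans (clamp_contraction _ _ _ _)); exact: v1.
apply: (le_energy_ae c1 v1).
apply: ae_imp (ae_lip_derive_contraction c1 v1 _); last first.
  by move=> x y; exact: clamp_contraction.
move=> t ct; rewrite /density lerD ?born_mono// ler_wpM2l ?(ltW (b_gt0 t))//=.
have [vt|vt] := leP (v t) (-1).
  suff -> : clamp (-1) 1 (v t) = -1 by rewrite W_N1 W_ge0.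
  by rewrite /clamp /Num.max /Num.min; case: (ltP 1 (v t)) => ?; case: ltP => ?; lra.
have [vt1|vt1] := leP 1 (v t).
  suff -> : clamp (-1) 1 (v t) = 1 by rewrite W_1 W_ge0.
  by rewrite /clamp /Num.max /Num.min; case: (ltP 1 (v t)) => ?; case: ltP => ?; lra.
by rewrite clamp_id// !ltW.
Qed.

Lemma lip_shift K h v : lip K v -> lip K (fun t => v (t + h)).
Proof.
by move=> vK x y; apply: (le_trans (vK _ _)); rewrite opprD addrACA subrr addr0.
Qed.

Lemma transition_shift h v : transition v -> transition (fun t => v (t + h)).
Proof.
move=> [v1 vy vNy]; split; first exact: lip_shift.
  by apply: (cvg_comp _ _ _ vy); exact: cvg_addrr.
by apply: (cvg_comp _ _ _ vNy); exact: cvg_addrr_Ny.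
Qed.

Lemma energy_shift v : lip 1 v -> energy (fun t => v (t + T)) = energy v.
Proof.
move=> v1; have vT := lip_shift T v1.
rewrite /energy -[RHS](@integral_shift _ T (EFin \o density v)); last 2 first.
- by apply/measurable_EFinP; exact: measurable_density v1.
- by move=> t; rewrite lee_fin density_ge0.
apply: ge0_ae_eq_integral => //.
- by apply/measurable_EFinP; exact: measurable_density vT.
- apply/measurable_EFinP; apply: (measurableT_comp (measurable_density v1)).
  exact: measurable_shift.
- by move=> t _; rewrite lee_fin density_ge0.
- by move=> t _; rewrite lee_fin density_ge0.
apply: ae_imp b_periodic => t bt _ /=; rewrite /density bt.
suff -> : lip_derive (fun t => v (t + T)) t = lip_derive v (t + T) by [].
by rewrite /lip_derive; congr limn_sup; apply/funext => n; rewrite addrAC.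
Qed.

Lemma energy_shiftn n v : lip 1 v -> energy (fun t => v (t + T *+ n)) = energy v.
Proof.
move=> v1; elim: n => [|n ih].
  by congr energy; apply/funext => t; rewrite mulr0n addr0.
rewrite -ih -[RHS]energy_shift; last exact: lip_shift.
by congr energy; apply/funext => t; rewrite mulrSr addrA addrAC.
Qed.

(** Translate by the multiple of the period that brings [t0] into [[0, T]]. *)
Lemma energy_normalize v (t0 : R) : transition v ->
  exists h, [/\ energy (fun t => v (t + h)) = energy v,
    transition (fun t => v (t + h)) & 0 <= t0 - h <= T].
Proof.
move=> vt; have [v1 _ _] := vt.
pose z := Num.floor (t0 / T).
have /andP[z1 z2] := floor_itv (t0 / T).
exists (T * z%:~R); split; last first.
- apply/andP; split.
    by rewrite subr_ge0 mulrC -ler_pdivlMr.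
  have : t0 <= (z + 1)%:~R * T by rewrite -ler_pdivrMr// ltW.
  by rewrite intrD mulrDl mul1r mulrC; lra.
- exact: transition_shift.
case: z {z1 z2} => n.
  rewrite -(energy_shiftn n v1); congr energy; apply/funext => t.
  by rewrite -mulr_natr.
have vs : lip 1 (fun t => v (t + T * (Negz n)%:~R)) by exact: lip_shift.
rewrite -(energy_shiftn n.+1 vs); congr energy; apply/funext => t.
by rewrite NegzE mulrNz mulrN -addrA -[T *+ _]mulr_natr subrr addr0.
Qed.

(** The slope enters the energy through a convex function, and only difference
    quotients converge pointwise.  For each step [h], Fatou's lemma bounds the
    energy of the quotients of [u], since those of [u_ n] have no more energy
    than [u_ n] itself; then [h] tends to 0, again by Fatou's lemma. *)
Lemma energy_lsc (u_ : nat -> R -> R) u (c : R) :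
  (forall n, lip 1 (u_ n)) -> lip 1 u -> (forall t, u_ n t @[n --> \oo] --> u t) ->
  (forall e, 0 < e -> \forall n \near \oo, (energy (u_ n) <= (c + e)%:E)%E) ->
  (energy u <= c%:E)%E.
Proof.
move=> un1 u1 unu hc.
have mdq v h : lip 1 v -> measurable_fun [set: BR] (fun t : R => born ((v (t + h) - v t) / h)).
  move=> v1; apply: measurable_born_comp; apply: measurable_funM => //.
  apply: measurable_funB; last exact: measurable_lip v1.
  by apply: measurableT_comp; [exact: measurable_lip v1|exact: measurable_shift].
pose q v h t := born ((v (t + h) - v t) / h) + b t * W (v t).
have mq v h : lip 1 v -> measurable_fun [set: BR] (q v h).
  move=> v1; apply: measurable_funD; first exact: mdq.
  by apply: measurable_potential; exact: measurable_lip v1.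
have q0 v h t : 0 <= q v h t by rewrite addr_ge0 ?born_ge0// mulr_ge0 ?W_ge0// ltW// b_gt0.
have hq h : 0 < h -> (\int[mu]_t (q u h t)%:E <= c%:E)%E.
  move=> h0; apply: (@fatou_le _ (fun n => q (u_ n) h)) => //.
  - by move=> n; exact: mq.
  - exact: mq.
  - apply: aeW => t; apply: cvgD.
      have cq : (u_ n (t + h) - u_ n t) / h @[n --> \oo] --> (u (t + h) - u t) / h.
        by apply: cvgM; [apply: cvgB; exact: unu|exact: cvg_cst].
      exact: (cvg_comp _ _ cq (@continuous_born R _)).
    by apply: cvgM; [exact: cvg_cst|exact: (cvg_comp _ _ (unu t) (@continuous_W _))].
  move=> e e0; apply: filterS (hc e e0) => n; apply: le_trans.
  have mp : measurable_fun [set: BR] (fun t => (b t * W (u_ n t))%:E).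
    by apply/measurable_EFinP; apply: measurable_potential; exact: measurable_lip (un1 n).
  have p0 t : (0 <= (b t * W (u_ n t))%:E)%E by rewrite lee_fin mulr_ge0 ?W_ge0// ltW// b_gt0.
  rewrite /energy /q /density.
  under eq_integral do rewrite EFinD.
  under [leRHS]eq_integral do rewrite EFinD.
  rewrite !ge0_integralD//.
  - by apply: leeD => //; exact: energy_diff_quotient_le.
  - by move=> t _; rewrite lee_fin born_ge0.
  - by apply/measurable_EFinP; apply: measurable_born_comp; exact: measurable_lip_derive (un1 n).
  - by move=> t _; rewrite lee_fin born_ge0.
  - by apply/measurable_EFinP; exact: mdq.
apply: (@fatou_le _ (fun n => q u n.+1%:R^-1)) => //.
- by move=> n; exact: mq.
- exact: measurable_density u1.
- exact: density_ge0.
- apply: ae_imp (lip_ae_derivable u1) => t ut; apply: cvgD; last exact: cvg_cst.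
  have cq : (u (t + n.+1%:R^-1) - u t) / n.+1%:R^-1 @[n --> \oo] --> lip_derive u t.
    rewrite (lip_derive_derivable ut).
    have := cvg_diff_quotient ut; apply: cvg_trans; apply: near_eq_cvg.
    by near=> n; rewrite invrK mulrC.
  exact: (cvg_comp _ _ cq (@continuous_born R _)).
- move=> e e0; near=> n; apply: (le_trans (hq _ _)).
    by rewrite invr_gt0.
  by rewrite lee_fin lerDl ltW.
Unshelve. all: by end_near. Qed.

Lemma indic_itvE s r t : \1_(`[s, r]%classic : set BR) t = (s <= t <= r)%R%:R :> R.
Proof. by rewrite indicE mem_setE in_itv. Qed.

Lemma integral_cst_indic (c s r : R) : 0 <= c -> s <= r ->
  (\int[mu]_t (c * \1_(`[s, r]%classic : set BR) t)%:E = (c * (r - s))%:E)%E.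
Proof.
move=> c0 sr; under eq_integral do rewrite EFinM.
rewrite ge0_integralZl_EFin//; last first.
  by apply/measurable_EFinP; exact: measurable_indic.
rewrite integral_indic// setIT EFinM; congr (_ * _)%E.
transitivity (mu `[s, r]%classic) => //.
rewrite lebesgue_measure_itv/= lte_fin -EFinB; case: ltP => // rs.
by have -> : r = s by [apply/eqP; rewrite eq_le rs]; rewrite subrr.
Qed.

Lemma density_le (M : R) v t : (forall x, `|x| <= 1 -> W x <= M) -> `|v t| <= 1 ->
  density v t <= 1 + a2 * M.
Proof.
move=> WM vt; rewrite lerD ?born_le1//.
have /andP[_ bt] := b_bounds t.
by rewrite ler_pM ?WM ?W_ge0// ltW// b_gt0.
Qed.

Lemma density_near_pm1 v t (c : R) : W c = 0 -> (\near t, v t = c) -> density v t = 0.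
Proof.
move=> Wc vc; rewrite /density (nbhs_singleton vc) Wc mulr0 addr0.
have dv : is_derive t (1 : R) v 0.
  apply: (near_eq_is_derive _ (is_derive_cst c t (1 : R))).
  by apply: filterS vc => x ->.
by rewrite (lip_derive_val dv) born0.
Qed.

Lemma cvgy_eventually v (A c : R) : (forall t, A < t -> v t = c) -> v t @[t --> +oo] --> c.
Proof.
move=> vc; apply: cvg_near_cst; near=> t; apply: vc.
by near: t; apply: nbhs_pinfty_gt; exact: num_real.
Unshelve. all: by end_near. Qed.

Lemma cvgNy_eventually_eq v u (A c : R) : (forall t, t < A -> v t = u t) ->
  u t @[t --> -oo] --> c -> v t @[t --> -oo] --> c.
Proof.
move=> vc; apply: cvg_trans; apply: near_eq_cvg; near=> t; apply/esym/vc.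
by near: t; apply: nbhs_ninfty_lt; exact: num_real.
Unshelve. all: by end_near. Qed.

Lemma transition_ramp : transition (clamp (-1) 1).
Proof.
split.
- by move=> x y; rewrite mul1r; exact: clamp_contraction.
- apply: (@cvgy_eventually _ 1) => t t1.
  by rewrite /clamp /Num.max /Num.min; case: (ltP 1 t) => ?; case: ltP => ?; lra.
- apply: (@cvgNy_eventually_eq _ (cst (-1)) (-1)); last exact: cvg_cst.
  move=> t t1; rewrite /= /clamp /Num.max /Num.min.
  by case: (ltP 1 t) => ?; case: ltP => ?; lra.
Qed.

Lemma energy_ramp_lty : (energy (clamp (-1) 1) < +oo)%E.
Proof.
have [r1 _ _] := transition_ramp.
have [M M0 hM] := continuous_bounded_itv (-1) 1 continuous_W.
have WM x : `|x| <= 1 -> W x <= M.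
  by move=> x1; apply: (le_trans (ler_norm _)); apply: hM; rewrite -ler_norml.
have C0 : 0 <= 1 + a2 * M by rewrite addr_ge0// mulr_ge0// a2_ge0.
apply: (@le_lt_trans _ _ ((1 + a2 * M) * (1 - (-1)))%:E); last exact: ltry.
rewrite -integral_cst_indic//.
apply: ge0_le_integral => //.
- by move=> t _; rewrite lee_fin density_ge0.
- by apply/measurable_EFinP; exact: measurable_density r1.
- by apply/measurable_EFinP; apply: measurable_funM => //; exact: measurable_indic.
- move=> t _; rewrite lee_fin indic_itvE; case: (boolP (-1 <= t <= 1)) => [t1|].
    rewrite mulr1; apply: density_le => //.
    by rewrite ler_norml; apply: clamp_itv; lra.
  rewrite mulr0 negb_and -!ltNge => /orP[t1|t1].
    rewrite (@density_near_pm1 _ _ (-1)) ?W_N1//; near=> x.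
    have : x < -1 by near: x; exact: lt_nbhsl.
    by rewrite /clamp /Num.max /Num.min => ?; case: (ltP 1 x) => ?; case: ltP => ?; lra.
  rewrite (@density_near_pm1 _ _ 1) ?W_1//; near=> x.
  have : 1 < x by near: x; exact: lt_nbhsr.
  by rewrite /clamp /Num.max /Num.min => ?; case: (ltP 1 x) => ?; case: ltP => ?; lra.
Unshelve. all: by end_near. Qed.

(** Having crossed 0 costs at least a1 w0 / 2, on a window of length 1/2.  If v
    is already close to 1 at a time s before that crossing, replacing v after s
    by a quick climb to 1 saves this cost, up to O(1 - v s). *)
Lemma early_climb (m M w0 : R) v t0 s :
  (forall u, transition u -> (m%:E <= energy u)%E) ->
  (forall x, `|x| <= 1 -> W x <= M) ->
  0 <= w0 -> (forall x, `|x| <= 1/2 -> w0 <= W x) ->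
  transition v -> (forall t, `|v t| <= 1) -> v t0 = 0 -> s <= t0 ->
  ((m + a1 * w0 * (1/2))%:E <= energy v + ((1 + a2 * M) * (1 - v s))%:E)%E.
Proof.
move=> hm WM w00 Ww0 vt vb v0 st0; have [v1 vy vNy] := vt.
have M0 : 0 <= M by apply: le_trans (WM 0 _); rewrite ?W_ge0// normr0.
have C0 : 0 <= 1 + a2 * M by rewrite addr_ge0// mulr_ge0// a2_ge0.
have vs1 : v s <= 1 by have := vb s; rewrite ler_norml => /andP[].
have vsN1 : -1 <= v s by have := vb s; rewrite ler_norml => /andP[].
(* the quickest climb to 1 from the value v s *)
pose g t := Num.min 1 (v s + (t - s)).
have g1 : lip 1 g.
  move=> x y; have h1 := ler_norm (x - y); have h2 := ler_norm (y - x).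
  rewrite distrC in h2; have h3 := normr_ge0 (x - y).
  rewrite mul1r ler_norml /g /Num.min.
  by case: ltP => ?; case: ltP => ?; apply/andP; split; lra.
have gs : v s = g s by rewrite /g subrr addr0 (min_idPr vs1).
pose p t := if t <= s then v t else g t.
have p1 : lip 1 p by exact: lip_glue.
have p_right t : s + (1 - v s) < t -> p t = 1.
  move=> st; rewrite /p leNgt (_ : s < t) /=; last by lra.
  by rewrite /g; apply/min_idPl; lra.
have p_left t : t <= s -> p t = v t by rewrite /p => ->.
have pb t : `|p t| <= 1.
  rewrite /p; have [ts|st] := leP t s; first exact: vb.
  by rewrite ler_norml /g le_min ge_min lexx andbT; apply/andP; split; lra.
have pt : transition p.
  split => //; first exact: (cvgy_eventually p_right).
  by apply: cvgNy_eventually_eq vNy => t /ltW; exact: p_left.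
(* v pays on [t0, t0 + 1/2], where |v| <= 1/2, and p pays on the climb *)
have dens : {ae mu, forall t, density p t + a1 * w0 * \1_(`[t0, t0 + 1/2]%classic : set BR) t
    <= density v t + (1 + a2 * M) * \1_(`[s, s + (1 - v s)]%classic : set BR) t}.
  apply: ae_imp (lip_ae_derivable v1) => t dv.
  rewrite !indic_itvE.
  have low : a1 * w0 * (t0 <= t <= t0 + 1/2)%R%:R <= density v t.
    case: (boolP (t0 <= t <= t0 + 1/2)) => [/andP[t0t tt0]|_]; last first.
      by rewrite mulr0 density_ge0.
    rewrite mulr1 /density ler_wpDl ?born_ge0//.
    have /andP[bt _] := b_bounds t; apply: ler_pM => //; first exact: ltW.
    apply: Ww0; rewrite -[v t]subr0 -v0; apply: (le_trans (v1 _ _)).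
    by rewrite mul1r ger0_norm ?subr_ge0// lerBlDl.
  have [ts|st] := ltP t s => /=.
    rewrite mulr0 addr0 (_ : t0 <= t = false) ?mulr0 ?addr0; last first.
      by apply/negbTE; rewrite -ltNge (lt_le_trans ts).
    rewrite /density p_left ?(ltW ts)//.
    suff -> : lip_derive p t = lip_derive v t by [].
    have dvt := derivableP dv.
    have dpt : is_derive t (1 : R) p ('D_1 v t).
      apply: near_eq_is_derive dvt; near=> x; rewrite p_left//; apply: ltW; near: x.
      exact: lt_nbhsl.
    have dp : derivable p t 1 by exact: ex_derive.
    rewrite (lip_derive_derivable dp) (lip_derive_derivable dv) !derive1E.
    exact: derive_val.
  have [tle|tgt] := leP t (s + (1 - v s)); rewrite ?mulr1 ?mulr0 ?addr0.
    rewrite addrC lerD//; exact: density_le.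
  rewrite (@density_near_pm1 _ _ 1) ?W_1 ?add0r//; near=> x; apply: p_right; near: x.
  exact: lt_nbhsr.
have mind (A : set BR) (c : R) : measurable A ->
    measurable_fun [set: BR] (fun t => (c * \1_A t)%:E).
  by move=> mA; apply/measurable_EFinP; apply: measurable_funM => //; exact: measurable_indic.
have mden u : lip 1 u -> measurable_fun [set: BR] (fun t => (density u t)%:E).
  by move=> u1; apply/measurable_EFinP; exact: measurable_density u1.
have den0 u t : [set: BR] t -> (0 <= (density u t)%:E)%E.
  by move=> _; rewrite lee_fin density_ge0.
have ind0 (A : set BR) (c : R) t : 0 <= c -> [set: BR] t -> (0 <= (c * \1_A t)%:E)%E.
  by move=> c0 _; rewrite lee_fin mulr_ge0.
have aw0 : 0 <= a1 * w0 by rewrite mulr_ge0// ltW.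
apply: (@le_trans _ _ (energy p + (a1 * w0 * (1/2))%:E)%E).
  by rewrite EFinD leeD2r// hm.
have -> : (a1 * w0 * (1/2))%:E =
    (\int[mu]_t (a1 * w0 * \1_(`[t0, t0 + 1/2]%classic : set BR) t)%:E)%E.
  rewrite integral_cst_indic//; last by lra.
  by congr (_ * _)%:E; lra.
have -> : ((1 + a2 * M) * (1 - v s))%:E =
    (\int[mu]_t ((1 + a2 * M) * \1_(`[s, s + (1 - v s)]%classic : set BR) t)%:E)%E.
  rewrite integral_cst_indic//; last by lra.
  by congr (_ * _)%:E; lra.
rewrite /energy -!ge0_integralD//.
- apply: ae_ge0_le_integral => //.
  + by move=> t _; apply: adde_ge0; [exact: den0|exact: ind0].
  + by apply: emeasurable_funD; [exact: mden|exact: mind].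
  + by move=> t _; apply: adde_ge0; [exact: den0|exact: ind0].
  + by apply: emeasurable_funD; [exact: mden|exact: mind].
  + by apply: ae_imp dens => t h _; rewrite -!EFinD lee_fin.
- by move=> t; exact: den0.
- exact: mden.
- by move=> t; exact: ind0.
- exact: mind.
- by move=> t; exact: den0.
- exact: mden.
- by move=> t; exact: ind0.
- exact: mind.
Unshelve. all: by end_near. Qed.

Lemma integrable_density v : lip 1 v -> (energy v < +oo)%E ->
  mu.-integrable setT (EFin \o density v).
Proof.
move=> v1 vfin; apply/integrableP; split.
  by apply/measurable_EFinP; exact: measurable_density v1.
apply: le_lt_trans vfin; rewrite le_eqVlt; apply/orP; left; apply/eqP.
by apply: eq_integral => t _; rewrite /= ger0_norm// density_ge0.
Qed.

(** The tails of a convergent integral vanish: far away, the density cannot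
    stay above [c] on a segment unless the segment is short. *)
Lemma energy_window_vanish u (d : R) : lip 1 u -> (energy u < +oo)%E -> 0 < d ->
  exists N : nat, forall c s r, 0 <= c -> s <= r ->
    (forall x, s <= x <= r -> N%:R <= `|x| /\ c <= density u x) -> c * (r - s) <= d.
Proof.
move=> u1 ufin d0.
have md := measurable_density u1.
have iu := integrable_density u1 ufin.
pose A (n : nat) : set BR := [set x : R | n%:R <= `|x|].
have mA n : measurable (A n).
  rewrite (_ : A n = (@Num.norm _ R : BR -> BR) @^-1` `[n%:R, +oo[); last first.
    by apply/seteqP; split => x /=; rewrite in_itv/= andbT.
  by rewrite -[X in measurable X]setTI; apply: normr_measurable => //; exact: measurable_itv.
pose f n x := density u x * \1_(A n) x.
have f0 n x : 0 <= f n x by rewrite mulr_ge0 ?density_ge0.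
have fd n x : `|f n x| <= density u x.
  rewrite ger0_norm// /f indicE ler_piMr ?density_ge0//.
  by case: (_ \in _).
have mf n : measurable_fun [set: BR] (f n).
  by apply: measurable_funM => //; exact: measurable_indic.
have ifn n : mu.-integrable setT (EFin \o f n).
  apply: le_integrable iu => //; first exact/measurable_EFinP.
  by move=> x _ /=; rewrite lee_fin (le_trans (fd n x))// ler_norm.
have : \int[mu]_x f n x @[n --> \oo] --> \int[mu]_x (cst 0 x : R).
  apply: (@dominated_Rintegral _ _ f _ (density u)) => //.
  - apply: aeW => x _; apply: cvg_near_cst; near=> n.
    rewrite /f indicE memNset ?mulr0//= => nx.
    have : `|x| < n%:R.
      apply: (lt_le_trans (archi_boundP (normr_ge0 x))).
      by rewrite ler_nat; near: n; exact: nbhs_infty_ge.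
    by rewrite ltNge nx.
  - by apply: aeW => x n _.
rewrite Rintegral_cst//= mul0r => /cvgrPdist_le/(_ _ d0)[N _ hN].
exists N => c s r c0 sr h.
have := hN N (leqnn N); rewrite sub0r normrN => /(le_trans (ler_norm _)); apply: le_trans.
have -> : c * (r - s) = fine ((c * (r - s))%:E) by [].
rewrite -integral_cst_indic//; apply: fine_le.
- by rewrite integral_cst_indic.
- exact: (integrable_fin_num _ (ifn N)).
apply: ge0_le_integral => //.
- by move=> x _; rewrite lee_fin mulr_ge0.
- by apply/measurable_EFinP; apply: measurable_funM => //; exact: measurable_indic.
- exact/measurable_EFinP.
- move=> x _; rewrite lee_fin indic_itvE; case: (boolP (s <= x <= r)) => [/h[Nx cx]|_].
    by rewrite mulr1 /f indicE mem_set// mulr1.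
  by rewrite mulr0.
Unshelve. all: by end_near. Qed.

Lemma W_lip_itv (B : R) : exists2 L, 0 <= L &
  forall x y, `|x| <= B -> `|y| <= B -> `|W x - W y| <= L * `|x - y|.
Proof.
have [dW cW'] := W_C1.
have [L L0 hL] := continuous_bounded_itv (- B) B cW'.
exists L => // x y; wlog xy : x y / x <= y.
  move=> h xB yB; have [/h|/ltW/h] := leP x y; first exact.
  by rewrite distrC (distrC x); exact.
rewrite !ler_norml => /andP[Bx xB] /andP[By yB].
have [||c] := @MVT_segment _ W (derive1 W) x y xy.
- by move=> z _; rewrite derive1E; exact: derivableP.
- by apply: derivable_within_continuous => z _; exact: dW.
rewrite in_itv/= => /andP[xc cy] E.
rewrite -ler_norml distrC E normrM (distrC x) ler_wpM2r// hL//.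
by rewrite (le_trans Bx xc) (le_trans cy yB).
Qed.

(** [W u] is Lipschitz, so if it reached [e] it would exceed [e/2] on a segment of
    fixed length. *)
Lemma potential_vanish u (e : R) : lip 1 u -> (forall t, `|u t| <= 1) ->
  (energy u < +oo)%E -> 0 < e -> exists N : R, forall t, N <= `|t| -> W (u t) < e.
Proof.
move=> u1 ub ufin e0.
have [L L0 hL] := W_lip_itv 1.
have L1 : 0 < 2 * (L + 1) by rewrite mulr_gt0// ltr_wpDl.
pose r := e / (2 * (L + 1)); have r0 : 0 < r by rewrite divr_gt0.
have Lr : L * r <= e / 2.
  rewrite /r mulrA ler_pdivrMr//.
  have -> : e / 2 * (2 * (L + 1)) = e * L + e by field.
  by rewrite mulrC lerDl ltW.
pose c := a1 * (e / 2); have c0 : 0 < c by rewrite mulr_gt0// divr_gt0.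
have d0 : 0 < c * r / 2 by rewrite divr_gt0// mulr_gt0.
have [N hN] := energy_window_vanish u1 ufin d0.
exists (N%:R + r) => t Nt; rewrite ltNge; apply/negP => eW.
have := hN c t (t + r) (ltW c0); rewrite lerDl (ltW r0) => /(_ isT).
rewrite addrAC subrr add0r => h.
suff : c * r <= c * r / 2.
  have cr0 : 0 < c * r := mulr_gt0 c0 r0.
  by rewrite ler_pdivlMr// mulr2n mulrDr !mulr1 gerDl leNgt cr0.
apply: h => x /andP[tx xr]; split.
  have : `|t| <= `|x| + r.
    rewrite -{1}(subrK x t) (le_trans (ler_normD _ _))// addrC lerD2l distrC.
    by rewrite ger0_norm ?subr_ge0// lerBlDl.
  by move=> /(le_trans Nt); rewrite lerD2r.
rewrite /density ler_wpDl ?born_ge0//.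
have /andP[bx _] := b_bounds x; apply: ler_pM => //; rewrite ?(ltW a1_gt0) ?divr_ge0 ?(ltW e0)//.
have := hL (u t) (u x) (ub t) (ub x); rewrite ler_norml => /andP[_].
have : L * `|u t - u x| <= L * r.
  rewrite ler_wpM2l// (le_trans (u1 _ _))// mul1r distrC ger0_norm ?subr_ge0//.
  by rewrite lerBlDl.
lra.
Qed.

Lemma W_away (c d : R) : -1 < c -> d < 1 ->
  exists2 w0, 0 < w0 & forall s, c <= s <= d -> w0 <= W s.
Proof.
move=> c1 d1; have [cd|dc] := leP c d; last first.
  by exists 1 => // s /andP[cs sd]; move: dc; rewrite ltNge (le_trans cs sd).
have [|x xcd hx] := @EVT_min _ W c d cd.
  by apply: continuous_subspaceT; exact: continuous_W.
exists (W x) => [|s scd]; last by apply: hx; rewrite in_itv.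
move: xcd; rewrite in_itv/= => /andP[cx xd].
by apply: W_gt0; [rewrite lt_eqF//; lra|rewrite gt_eqF//; lra].
Qed.

(** Where the potential is small, [u] is close to -1 or to 1; the one-sided
    bounds select the limit at each end. *)
Lemma transition_of_energy u (A B e : R) : lip 1 u -> (forall t, `|u t| <= 1) ->
  (energy u < +oo)%E -> (forall t, A <= t -> 0 <= u t) ->
  0 < e -> (forall t, t <= B -> u t <= 1 - e) -> transition u.
Proof.
move=> u1 ub ufin uA e0 uB; split => //.
  apply/cvgrPdist_le => d d0.
  have [||w0 w00 hw] := @W_away 0 (1 - d); [by lra|by lra|].
  have [N hN] := potential_vanish u1 ub ufin w00.
  near=> t.
  have At : A <= t by near: t; apply: nbhs_pinfty_ge; exact: num_real.
  have Nt : N <= `|t|.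
    by apply: le_trans (ler_norm _); near: t; apply: nbhs_pinfty_ge; exact: num_real.
  have := ub t; rewrite ler_norml => /andP[_ ut1].
  rewrite ger0_norm ?subr_ge0// lerBlDl -lerBlDr leNgt; apply/negP => utd.
  by have := hw (u t); rewrite uA// (ltW utd) leNgt hN// => /(_ isT).
apply/cvgrPdist_le => d d0.
have [||w0 w00 hw] := @W_away (- 1 + d) (1 - e); [by lra|by lra|].
have [N hN] := potential_vanish u1 ub ufin w00.
near=> t.
have Bt : t <= B by near: t; apply: nbhs_ninfty_le; exact: num_real.
have Nt : N <= `|t|.
  rewrite -normrN; apply: le_trans (ler_norm _); rewrite lerNr.
  by near: t; apply: nbhs_ninfty_le; exact: num_real.
have := ub t; rewrite ler_norml => /andP[utN1 _].
rewrite distrC ger0_norm ?subr_ge0// lerBlDl leNgt; apply/negP => utd.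
by have := hw (u t); rewrite uB// (ltW utd) leNgt hN// => /(_ isT).
Unshelve. all: by end_near. Qed.

(** The last zero, rather than any zero, so that the sign to its right is
    known. *)
Lemma last_zero v : transition v ->
  exists t0, v t0 = 0 /\ forall t, t0 <= t -> 0 <= v t.
Proof.
move=> [v1 /cvgrPdist_lt/(_ _ ltr01)[A [_ hA]] /cvgrPdist_lt/(_ _ ltr01)[B [_ hB]]].
pose S := [set t : R | v t <= 0].
have posS t : A < t -> 0 < v t.
  by move=> /hA; rewrite ltr_distl => /andP[? ?]; lra.
have S0 : S !=set0.
  exists (B - 1); have /hB : B - 1 < B by rewrite ltrBlDr ltrDl.
  by rewrite /S /= ltr_distl => /andP[? ?]; lra.
have supS : has_sup S.
  split => //; exists A => t; rewrite /S /= => vt; rewrite leNgt; apply/negP => /posS.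
  by rewrite ltNge vt.
have afterS t : sup S < t -> 0 < v t.
  move=> St; rewrite ltNge; apply/negP => vt.
  have : t <= sup S by apply: ub_le_sup => //; case: supS.
  by rewrite leNgt St.
have vle : v (sup S) <= 0.
  rewrite leNgt; apply/negP => v0.
  have [t vt tS] := sup_adherent v0 supS.
  have tle : t <= sup S by apply: ub_le_sup => //; case: supS.
  have := v1 (sup S) t; rewrite mul1r (@ger0_norm _ (sup S - t)) ?subr_ge0// => h.
  have := le_trans (ler_norm _) h; rewrite /S /= in vt; lra.
have vge : 0 <= v (sup S).
  rewrite leNgt; apply/negP => v0.
  have := @afterS (sup S - v (sup S)); rewrite ltrBrDr -ltrBrDl subrr => /(_ v0).
  have := v1 (sup S - v (sup S)) (sup S).
  rewrite mul1r addrAC subrr add0r normrN (ltr0_norm v0) => h.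
  by have := le_trans (ler_norm _) h; lra.
exists (sup S); split; first by apply/eqP; rewrite eq_le vle vge.
by move=> t; rewrite le_eqVlt => /predU1P[<-//|/afterS/ltW].
Qed.

(** The direct method, with the last zero of the minimizing sequence placed in
    the period [[0, T]]. *)
Theorem exists_minimizer : exists u, exists m : R, [/\ transition u,
  forall t, `|u t| <= 1, energy u = m%:E &
  forall v, transition v -> (m%:E <= energy v)%E].
Proof.
pose E := [set energy v | v in transition].
have Elb x : E x -> (0 <= x)%E by move=> [v _ <-]; exact: energy_ge0.
have inf0 : (0 <= ereal_inf E)%E by apply: le_ereal_inf_tmp => x /Elb.
have inffin : ereal_inf E \is a fin_num.
  rewrite ge0_fin_numE//; apply: le_lt_trans energy_ramp_lty.
  by apply: ereal_inf_lbound; exists (clamp (-1) 1) => //; exact: transition_ramp.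
pose m := fine (ereal_inf E).
have mE : ereal_inf E = m%:E by rewrite fineK.
have hm v : transition v -> (m%:E <= energy v)%E.
  by move=> vt; rewrite -mE; apply: ereal_inf_lbound; exists v.
have [M M0 hM] := continuous_bounded_itv (-1) 1 continuous_W.
have WM x : `|x| <= 1 -> W x <= M.
  by move=> x1; apply: (le_trans (ler_norm _)); apply: hM; rewrite -ler_norml.
have [||w0 w00 hw] := @W_away (- (1/2)) (1/2); [by lra|by lra|].
have Ww0 x : `|x| <= 1/2 -> w0 <= W x by rewrite ler_norml => /hw.
(* truncated and translated almost minimizers *)
have cand (e : R) : 0 < e -> exists v, [/\ transition v, forall t, `|v t| <= 1,
    (energy v <= (m + e)%:E)%E &
    exists t0, [/\ 0 <= t0 <= T, v t0 = 0 & forall t, t0 <= t -> 0 <= v t]].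
  move=> e0; have [_ [v0 v0t <-] v0e] := lb_ereal_inf_adherent e0 inffin.
  have v0c := transition_clamp v0t; have [v01 _ _] := v0t.
  have [t0 [vt0 vpos]] := last_zero v0c.
  have [h [hE ht /andP[h1 h2]]] := energy_normalize t0 v0c.
  exists (fun t => (clamp (-1) 1 \o v0) (t + h)); split => //.
  - by move=> t; rewrite ler_norml; apply: clamp_itv; lra.
  - by rewrite hE (le_trans (energy_clamp v01))// EFinD -mE ltW.
  - exists (t0 - h); split; rewrite ?h1 ?subrK//.
    by move=> t; rewrite lerBlDr => /vpos.
have inv0 n : 0 < n.+1%:R^-1 :> R by rewrite invr_gt0.
have [v_ hv] := choice (fun n => cand _ (inv0 n)).
have [||u [phi [phin u1 ub vu]]] := @lip_subsequence _ v_.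
- by move=> n; have [[]] := hv n.
- by move=> n t; have [_ h] := hv n.
have Eu : (energy u <= m%:E)%E.
  apply: (@energy_lsc (fun n => v_ (phi n))) => //.
    by move=> n; have [[]] := hv (phi n).
  move=> e e0; near=> n; have [_ _ h _] := hv (phi n); apply: (le_trans h).
  rewrite lee_fin lerD2l ltW//.
  apply: (@le_lt_trans _ _ n.+1%:R^-1).
    by rewrite lef_pV2 ?posrE// ler_nat ltnS.
  by near: n; exact: near_infty_natSinv_lt (PosNum e0).
have C0 : 0 < 1 + a2 * M by rewrite ltr_pwDl// mulr_ge0// a2_ge0.
(* k is the cost of crossing 0; early_climb gives 1 - v t >= e as soon as the
   energy of v is below m + k / 2 *)
pose k := a1 * w0 * (1/2); have k0 : 0 < k by rewrite !mulr_gt0//; lra.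
pose e := k / 4 / (1 + a2 * M); have e0 : 0 < e by rewrite !divr_gt0.
have uT t : T <= t -> 0 <= u t.
  move=> Tt; rewrite -(cvg_lim (@Rhausdorff R) (vu t)).
  apply: limr_ge; first exact: cvgP (vu t).
  apply: nearW => n; have [_ _ _ [t0 [/andP[_ t0T] _ pos]]] := hv (phi n).
  by apply: pos; exact: le_trans Tt.
have uB t : t <= 0 -> u t <= 1 - e.
  move=> t_le0; rewrite -(cvg_lim (@Rhausdorff R) (vu t)).
  apply: limr_le; first exact: cvgP (vu t).
  have k2 : 0 < k / 2 by rewrite divr_gt0.
  near=> n.
  have [vt v1 ve [t0 [/andP[t0_ge0 _] vt0 _]]] := hv (phi n).
  have t_le_t0 : t <= t0 := le_trans t_le0 t0_ge0.
  have := early_climb hm WM (ltW w00) Ww0 vt v1 vt0 t_le_t0.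
  move=> /le_trans/(_ (leeD ve (lexx _))); rewrite -EFinD lee_fin -addrA lerD2l -/k => h.
  have nk : (phi n).+1%:R^-1 < k / 2.
    apply: (@le_lt_trans _ _ n.+1%:R^-1).
      by rewrite lef_pV2 ?posrE// ler_nat ltnS.
    by near: n; exact: near_infty_natSinv_lt (PosNum k2).
  rewrite lerBrDr -lerBrDl ler_pdivrMr// [X in _ <= X]mulrC.
  have k4 : k / 4 <= k / 2 by rewrite ler_wpM2l ?(ltW k0)// lef_pV2 ?posrE// ler_nat.
  apply: (le_trans k4); rewrite (splitr k) in h.
  by rewrite -(lerD2l (k / 2)) (le_trans h)// lerD2r ltW.
exists u, m.
have ufin : (energy u < +oo)%E by apply: le_lt_trans Eu _; rewrite ltry.
have ut : transition u by exact: (transition_of_energy u1 ub ufin uT e0 uB).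
by split => //; apply/eqP; rewrite eq_le Eu hm.
Unshelve. all: by end_near. Qed.

(** * Regularity of minimizers *)

Section Minimizer.
Variables (u : R -> R) (m : R).
Hypotheses (ut : transition u) (um : energy u = m%:E).
Hypothesis ub : forall t, `|u t| <= 1.
Hypothesis umin : forall v, transition v -> (m%:E <= energy v)%E.

Definition force t := b t * derive1 W (u t).

Let u1 : lip 1 u. Proof. by case: ut. Qed.

Lemma continuous_W' : continuous (derive1 W). Proof. by case: W_C1. Qed.

Lemma measurable_force : measurable_fun [set: BR] force.
Proof.
apply: measurable_funM => //; apply: measurableT_comp; last exact: measurable_lip u1.
by apply: continuous_measurable_fun; exact: continuous_W'.
Qed.

Lemma force_bounded : exists M, forall t, `|force t| <= M.
Proof.
have [K K0 hK] := continuous_bounded_itv (-1) 1 continuous_W'.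
exists (a2 * K) => t; have /andP[ab ba] := b_bounds t.
rewrite normrM ler_pM// ?hK//; last by rewrite -ler_norml.
by rewrite ger0_norm// ltW// b_gt0.
Qed.

Lemma transition_perturb v (r : R) : lip 1 v ->
  (forall t, ~ (- r <= t <= r) -> v t = u t) -> transition v.
Proof.
move=> v1 vu; have [_ uy uNy] := ut; split => //.
  apply: cvg_trans uy; apply: near_eq_cvg; near=> t; apply/esym/vu.
  apply/negP; rewrite negb_and -!ltNge; apply/orP; right.
  by near: t; apply: nbhs_pinfty_gt; exact: num_real.
apply: (@cvgNy_eventually_eq _ u (- r)) => // t tr; apply: vu.
by apply/negP; rewrite negb_and -!ltNge tr.
Unshelve. all: by end_near. Qed.

Lemma ae_lip_derive_outside v (r : R) : lip 1 v ->
  (forall t, ~ (- r <= t <= r) -> v t = u t) ->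
  {ae mu, forall t, ~ (- r <= t <= r) -> lip_derive v t = lip_derive u t}.
Proof.
move=> v1 vu; apply: ae_imp (lip_ae_derivable u1) => t dut /negP.
rewrite negb_and -!ltNge => tr.
have h : \forall x \near t, u x = v x.
  case/orP: tr => tr; near=> x; apply/esym/vu/negP; rewrite negb_and -!ltNge; apply/orP.
    by left; near: x; exact: lt_nbhsl.
  by right; near: x; exact: lt_nbhsr.
have dvt : derivable v t 1 by exact: near_eq_derivable h dut.
by rewrite (lip_derive_derivable dut) (lip_derive_derivable dvt) !derive1E (near_eq_derive _ h).
Unshelve. all: by end_near. Qed.

Lemma lip_derive_segment v (e : R) : lip 1 v ->
  {ae mu, forall t, lip_derive (fun x => u x + e * (v x - u x)) t =
    (1 - e) * lip_derive u t + e * lip_derive v t}.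
Proof.
move=> v1; apply: ae_imp2 (ae_is_derive_lip u1) (ae_is_derive_lip v1) => t du dv.
have d := is_deriveD du (is_deriveM (is_derive_cst e t (1 : R)) (is_deriveB dv du)).
have dw : is_derive t (1 : R) (fun x => u x + e * (v x - u x))
   ((1 - e) * lip_derive u t + e * lip_derive v t).
  have -> : (1 - e) * lip_derive u t + e * lip_derive v t =
    lip_derive u t + (e *: (lip_derive v t - lip_derive u t) + (v t - u t) *: 0).
    by rewrite /GRing.scale/= mulr0 addr0; ring.
  exact: d.
by rewrite (lip_derive_val dw).
Qed.

Lemma lip_segment v (e : R) : 0 <= e <= 1 -> lip 1 v -> lip 1 (fun t => u t + e * (v t - u t)).
Proof.
move=> /andP[e0 e1] v1 x y; rewrite mul1r.
have -> : u x + e * (v x - u x) - (u y + e * (v y - u y)) =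
  (1 - e) * (u x - u y) + e * (v x - v y) by ring.
have e1' : 0 <= 1 - e by rewrite subr_ge0.
apply: (le_trans (ler_normD _ _)); rewrite !normrM (ger0_norm e0) (ger0_norm e1').
have -> : `|x - y| = (1 - e) * `|x - y| + e * `|x - y| by ring.
have := u1 x y; have := v1 x y; rewrite !mul1r => vxy uxy.
by rewrite lerD// ler_wpM2l.
Qed.

(** Stated for an [h] that bounds [f] only almost everywhere, and so may be
    negative on a null set. *)
Lemma ae_Rintegral_ge (f h : R -> R) : measurable_fun [set: BR] f ->
  (forall t, 0 <= f t) -> (m%:E <= \int[mu]_t (f t)%:E)%E ->
  mu.-integrable setT (EFin \o h) -> {ae mu, forall t, f t <= h t} ->
  m <= \int[mu]_t h t.
Proof.
move=> mf f0 mint ih fh.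
have mh : measurable_fun [set: BR] h by apply/measurable_EFinP; exact: measurable_int ih.
rewrite -lee_fin /Rintegral fineK; last exact: integrable_fin_num.
have -> : (\int[mu]_t (h t)%:E = \int[mu]_t `|h t|%:E)%E.
  apply: ae_eq_integral => //.
  - exact/measurable_EFinP.
  - by apply/measurable_EFinP; exact: measurableT_comp.
  - by apply: ae_imp fh => t fh _; rewrite ger0_norm// (le_trans _ fh).
apply: (le_trans mint); apply: ae_ge0_le_integral => //.
- by move=> t _; rewrite lee_fin.
- exact/measurable_EFinP.
- by apply/measurable_EFinP; exact: measurableT_comp.
- by apply: ae_imp fh => t fh _; rewrite lee_fin (le_trans fh)// ler_norm.
Qed.

(** [born] may fail to be differentiable along the segment from [u] to [v], so
    its difference quotient is replaced by the upper bound [born v' - born u']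
    that convexity provides; the potential is differentiated. *)
Lemma first_variation v (r : R) : lip 1 v ->
  (forall t, ~ (- r <= t <= r) -> v t = u t) ->
  0 <= \int[mu]_(t in `[- r, r])
    (born (lip_derive v t) - born (lip_derive u t) + force t * (v t - u t)).
Proof.
move=> v1 vu; have [_ vy vNy] := transition_perturb v1 vu.
have [_ uy uNy] := ut.
have [Bu hBu] := cvg_pm1_bounded (lip_continuous u1) uy uNy.
have [Bv hBv] := cvg_pm1_bounded (lip_continuous v1) vy vNy.
pose B := Num.max Bu Bv.
have uB t : `|u t| <= B by rewrite le_max hBu.
have vB t : `|v t| <= B by rewrite le_max hBv orbT.
have [L L0 hL] := W_lip_itv B.
pose e_ n : R := n.+1%:R^-1.
have e0 n : 0 < e_ n by rewrite invr_gt0.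
have e1 n : e_ n <= 1 by rewrite invf_le1// ler1n.
have ne n : n.+1%:R * e_ n = 1 by rewrite mulfV.
pose w n t := u t + e_ n * (v t - u t).
(* the upper bound of the difference quotient of the density *)
pose k n t := born (lip_derive v t) - born (lip_derive u t) +
  b t * (n.+1%:R * (W (w n t) - W (u t))).
have w1 n : lip 1 (w n) by apply: lip_segment => //; rewrite ltW//= e1.
have wu n t : ~ (- r <= t <= r) -> w n t = u t by move=> /vu; rewrite /w => ->; ring.
have wB n t : `|w n t| <= B.
  have -> : w n t = (1 - e_ n) * u t + e_ n * v t by rewrite /w; ring.
  apply: (le_trans (ler_normD _ _)); rewrite !normrM.
  rewrite (ger0_norm (ltW (e0 n))) (@ger0_norm _ (1 - _)) ?subr_ge0//.
  have -> : B = (1 - e_ n) * B + e_ n * B by ring.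
  by rewrite lerD// ler_wpM2l ?subr_ge0// ltW.
have mu_ := measurable_lip u1; have mv_ := measurable_lip v1.
have mDu := measurable_lip_derive u1; have mDv := measurable_lip_derive v1.
have mk n : measurable_fun [set: BR] (k n).
  apply: measurable_funD.
    by apply: measurable_funB; exact: measurable_born_comp.
  apply: measurable_funM => //; apply: measurable_funM => //.
  by apply: measurable_funB; apply: measurableT_comp (measurable_lip _) => //;
    apply: continuous_measurable_fun; exact: continuous_W.
pose C := 1 + a2 * (L * (B + B)).
have kC n t : `|k n t| <= C.
  apply: (le_trans (ler_normD _ _)); apply: lerD.
    have := born_ge0 (lip_derive v t); have := born_ge0 (lip_derive u t).
    have := born_le1 (lip_derive v t); have := born_le1 (lip_derive u t).
    by move=> *; rewrite ler_norml; apply/andP; split; lra.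
  have /andP[ab ba] := b_bounds t; have b0 : 0 <= b t by rewrite ltW// b_gt0.
  rewrite normrM (ger0_norm b0); apply: ler_pM => //.
  rewrite normrM ger0_norm//.
  apply: (@le_trans _ _ (n.+1%:R * (L * `|w n t - u t|))).
    by rewrite ler_wpM2l// hL.
  rewrite /w [X in `|X|]addrAC subrr add0r normrM (ger0_norm (ltW (e0 n))).
  rewrite mulrCA (mulrA n.+1%:R) ne mul1r ler_wpM2l//.
  by rewrite (le_trans (ler_normB _ _))// lerD.
have kint n : 0 <= \int[mu]_(t in `[- r, r]) k n t.
  pose K t := k n t * \1_(`[- r, r]%classic : set BR) t.
  have Kin t : - r <= t <= r -> K t = k n t.
    by move=> tr; rewrite /K indic_itvE tr mulr1.
  have Kout t : ~ (- r <= t <= r) -> K t = 0.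
    by move=> /negP tr; rewrite /K indic_itvE (negbTE tr) mulr0.
  have mK : measurable_fun [set: BR] K.
    rewrite /K; apply: measurable_funM; first exact: mk.
    by apply: measurable_indic; exact: measurable_itv.
  have iK : mu.-integrable setT (EFin \o K).
    apply: (integrable_supp Kout); apply: (@integrable_itv _ _ C) => //.
    by move=> t tr; rewrite Kin.
  have -> : \int[mu]_(t in `[- r, r]) k n t = \int[mu]_t K t.
    rewrite (Rintegral_supp Kout); apply: eq_Rintegral => t.
    by rewrite inE/= in_itv/= => /Kin.
  have iu : mu.-integrable setT (EFin \o density u).
    by apply: integrable_density; rewrite // um ltry.
  have iZ : mu.-integrable setT (EFin \o (fun t => e_ n * K t)).
    rewrite (_ : _ \o _ = (fun t => (e_ n)%:E * (EFin \o K) t)%E).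
      exact: integrableZl.
    by apply/funext => t; rewrite /= EFinM.
  (* convexity inside the window; outside, w n and u have the same density *)
  have dens : {ae mu, forall t, density (w n) t <= density u t + e_ n * K t}.
    apply: ae_imp2 (lip_derive_segment (e_ n) v1) (ae_lip_derive_outside (w1 n) (wu n)) => t Dw Dwo.
    have [tr|/negP tr] := boolP (- r <= t <= r); last first.
      by rewrite Kout// mulr0 addr0 /density Dwo// wu.
    rewrite Kin// /density /k -/(w n) Dw.
    have e01 : 0 <= e_ n <= 1 by rewrite ltW//= e1.
    have Du1 := lip_derive_bound t u1; have Dv1 := lip_derive_bound t v1.
    have := born_convex Du1 Dv1 e01.
    set p := born _; set bu := born _; set bv := born _; set dW := W (w n t) - W (u t).
    have -> : bu + b t * W (u t) + e_ n * (bv - bu + b t * (n.+1%:R * dW)) =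
      (1 - e_ n) * bu + e_ n * bv + b t * W (u t) + (n.+1%:R * e_ n) * (b t * dW) by ring.
    move=> pc; rewrite ne mul1r -(addrA ((1 - e_ n) * bu + _)) -mulrDr (addrC (W (u t))).
    by rewrite /dW subrK lerD2r.
  have := @ae_Rintegral_ge (density (w n)) _ (measurable_density (w1 n)) (density_ge0 _)
    (umin (transition_perturb (w1 n) (wu n))) (integrable_EFinD measurableT iu iZ) dens.
  rewrite RintegralD// RintegralZl//.
  have -> : \int[mu]_t density u t = m by rewrite /Rintegral -/(energy u) um.
  by rewrite lerDl pmulr_rge0.
have : \int[mu]_(t in `[- r, r]) k n t @[n --> \oo] --> \int[mu]_(t in `[- r, r])
    (born (lip_derive v t) - born (lip_derive u t) + force t * (v t - u t)).
  apply: (@dominated_Rintegral _ _ k _ (cst C)).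
  - exact: measurable_itv.
  - by move=> n; exact: measurable_funS (mk n).
  - apply: (measurable_funS measurableT) => //; apply: measurable_funD.
      by apply: measurable_funB; exact: measurable_born_comp.
    by apply: measurable_funM; [exact: measurable_force|exact: measurable_funB].
  - apply: aeW => t _; apply: cvgD; first exact: cvg_cst.
    rewrite /force -mulrA; apply: cvgM; first exact: cvg_cst.
    by apply: cvg_scaled_increment; case: W_C1.
  - by apply: (@bounded_integrable_itv _ _ `|C|) => // x; exact: measurable_cst.
  - by apply: aeW => t n _; exact: kC.
move=> h; rewrite -(cvg_lim (@Rhausdorff R) h); apply: limr_ge; first exact: cvgP h.
by apply: nearW => n; exact: kint.
Qed.

(** [Z] below is the defect in Young's inequality for [u'].  It is nonnegative,
    and minimality against the competitor [v], which has no defect, shows that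
    its integral is at most 0. *)
Lemma euler_window M (r : R) : (forall t, `|force t| <= M) -> 2 <= r ->
  exists c, {ae mu, forall t, - r <= t <= r ->
    lip_derive u t = velocity (primitive force t + c)}.
Proof.
move=> fM r2; have r0 : 0 < r by lra.
have rr : - r <= r by lra.
pose G := primitive force.
have G1 : lip M G := lip_primitive measurable_force fM.
have cG : continuous G := lip_continuous G1.
have [|c Fc] := @velocity_shift_choice _ G r (u r - u (- r)) cG r0.
  apply: (le_trans _ r2); apply: (le_trans (ler_normB _ _)).
  by have := ub r; have := ub (- r); lra.
exists c; pose p t := velocity (G t + c).
have cp : continuous p := continuous_velocity_shift cG.
have p1 t : `|p t| <= 1 := velocity_shift_bound G c t.
have mp : measurable_fun setT p := continuous_measurable_fun cp.
have P1 : lip 1 (primitive p) := lip_primitive mp p1.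
pose f t := u (- r) + (primitive p t - primitive p (- r)).
have f1 : lip 1 f.
  move=> x y; have := P1 x y; congr (`|_| <= _); rewrite /f; ring.
have fNr : f (- r) = u (- r) by rewrite /f subrr addr0.
have fr : f r = u r by rewrite /f (primitiveB mp p1)// Fc addrC subrK.
(* the competitor of slope p in the window *)
pose v t := if t <= - r then u t else if t <= r then f t else u t.
have v1 : lip 1 v.
  by apply: lip_glue u1 (lip_glue f1 u1 fr) _; rewrite rr fNr.
have vu t : ~ (- r <= t <= r) -> v t = u t.
  move=> /negP; rewrite negb_and -!ltNge /v => /orP[tr|tr]; first by rewrite (ltW tr).
  by rewrite (leNgt t r) tr if_same.
have vf t : - r <= t <= r -> v t = f t.
  move=> /andP[rt tr]; rewrite /v tr; case: ifPn => // tNr.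
  by have -> : t = - r; [apply/eqP; rewrite eq_le tNr rt|].
have zr : v r - u r = 0 by rewrite vf ?rr ?lexx// fr subrr.
have zNr : v (- r) - u (- r) = 0 by rewrite vf ?rr ?lexx// fNr subrr.
have Dv t : - r < t < r -> is_derive t (1 : R) v (p t).
  move=> /andP[rt tr].
  have d : is_derive t (1 : R) (primitive p) (p t).
    by apply: FTC_is_derive => // s s' ss'; rewrite (primitiveB mp p1).
  have d2 := is_deriveD (is_derive_cst (u (- r)) t (1 : R))
    (is_deriveB d (is_derive_cst (primitive p (- r)) t (1 : R))).
  rewrite subr0 add0r in d2; apply: near_eq_is_derive d2.
  near=> x; rewrite vf//; apply/andP; split; apply: ltW.
    by near: x; exact: lt_nbhsr.
  by near: x; exact: lt_nbhsl.
pose S t := Num.sqrt (1 + (G t + c) ^+ 2) - 1.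
pose Z t := born (lip_derive u t) - ((G t + c) * lip_derive u t - S t).
have Z0 t : 0 <= Z t by rewrite subr_ge0; apply: born_young; exact: lip_derive_bound u1.
suff : {ae mu, forall t, - r <= t <= r -> Z t = 0}.
  apply: ae_imp => t /[apply] Zt; apply: born_young_eq; first exact: lip_derive_bound u1.
  by apply/eqP; rewrite -subr_eq0 -/(S t) -/(Z t) Zt.
pose X t := born (lip_derive v t) - born (lip_derive u t) + force t * (v t - u t).
have X0 : 0 <= \int[mu]_(t in `[- r, r]) X t := first_variation v1 vu.
pose q t := G t + c; pose z t := v t - u t.
have q1 : lip M q by move=> x y; have := G1 x y; congr (`|_| <= _); rewrite /q; ring.
have z2 : lip 2 z.
  move=> x y; have := v1 x y; have := u1 x y; rewrite !mul1r /z => ux vx.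
  have -> : v x - u x - (v y - u y) = v x - v y - (u x - u y) by ring.
  by apply: (le_trans (ler_normB _ _)); lra.
pose Y t := lip_derive q t * z t + q t * lip_derive z t.
have Y0 : \int[mu]_(t in `[- r, r]) Y t = 0.
  by rewrite (lip_parts rr q1 z2) /z zr zNr !mulr0 subrr.
(* the defect of the competitor is 0 by born_velocity *)
have ZE : {ae mu, forall t, - r <= t <= r -> Z t = Y t - X t}.
  have h1 := ae_imp2 (fun _ => @conj _ _) (ae_neq (- r)) (ae_neq r).
  have h2 := ae_imp2 (fun _ => @conj _ _)
    (ae_is_derive_primitive measurable_force fM) (ae_is_derive_lip u1).
  apply: ae_imp2 h1 h2 => t [tNr tr] [dG du] /andP[rt rt'].
  have dv : is_derive t (1 : R) v (p t).
    by apply: Dv; rewrite !lt_neqAle eq_sym tNr rt tr rt'.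
  have -> : Y t = force t * z t + q t * (p t - lip_derive u t).
    rewrite /Y; congr (_ * _ + _ * _).
      by apply: lip_derive_val; rewrite -[force t]addr0; exact: is_deriveD.
    by apply: lip_derive_val; exact: is_deriveB.
  rewrite /X (lip_derive_val dv) /p born_velocity -/(S t) -/(p t) /Z /q /z.
  by ring.
have mDu := measurable_lip_derive u1; have mDv := measurable_lip_derive v1.
have mDz := measurable_lip_derive z2; have mDq := measurable_lip_derive q1.
have cz := lip_continuous z2; have cq := lip_continuous q1.
have iborn g : measurable_fun [set: BR] g ->
    mu.-integrable `[- r, r] (EFin \o (fun t => born (g t))).
  move=> mg; apply: (@bounded_integrable_itv _ _ 1); first exact: measurable_born_comp.
  by move=> t; rewrite ger0_norm ?born_ge0// born_le1.
have mr : measurable (`[- r, r]%classic : set BR) by exact: measurable_itv.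
have iX : mu.-integrable `[- r, r] (EFin \o X).
  apply: integrable_EFinD => //; first by apply: integrable_EFinB => //; exact: iborn.
  by apply: (@integrableM_itv _ force z) => //; [exact: measurable_force|exists M].
have iY : mu.-integrable `[- r, r] (EFin \o Y).
  apply: integrable_EFinD => //.
    apply: (@integrableM_itv _ (lip_derive q) z) => //.
    by exists M => t _; exact: lip_derive_bound q1.
  have -> : (fun x => q x * lip_derive z x) = (fun x => lip_derive z x * q x).
    by apply/funext => x; rewrite mulrC.
  apply: (@integrableM_itv _ (lip_derive z) q) => //.
  by exists 2 => t _; exact: lip_derive_bound z2.
have cS : continuous S.
  move=> x; apply: cvgB; last exact: cvg_cst.
  have h : 1 + q t ^+ 2 @[t --> x] --> 1 + q x ^+ 2.
    by apply: cvgD; [exact: cvg_cst|apply: cvgM; exact: cq].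
  exact: (cvg_comp _ _ h (@sqrt_continuous _ _)).
have iZ : mu.-integrable `[- r, r] (EFin \o Z).
  apply: integrable_EFinB => //; first exact: iborn.
  apply: integrable_EFinB => //.
    have -> : (fun x => (G x + c) * lip_derive u x) = (fun x => lip_derive u x * q x).
      by apply/funext => x; rewrite mulrC.
    apply: (@integrableM_itv _ (lip_derive u) q) => //.
    by exists 1 => t _; exact: lip_derive_bound u1.
  exact: (@locally_integrable_itv _ S (- r) r true false (continuous_locally_integrable cS)).
have mZ : measurable_fun (`[- r, r]%classic : set BR) (EFin \o Z) by exact: measurable_int iZ.
have Zle : \int[mu]_(t in `[- r, r]) Z t <= 0.
  have -> : \int[mu]_(t in `[- r, r]) Z t = \int[mu]_(t in `[- r, r]) (Y t - X t).
    apply: Rintegral_ae_eq => //.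
    - exact/measurable_EFinP.
    - by apply/measurable_EFinP; exact: (measurable_int _ (integrable_EFinB mr iY iX)).
  by rewrite RintegralB// Y0 sub0r oppr_le0.
have : (\int[mu]_(t in `[(- r)%R, r]) `|(EFin \o Z) t| = 0)%E.
  have -> : (\int[mu]_(t in `[(- r)%R, r]) `|(EFin \o Z) t| = (\int[mu]_(t in `[- r, r]) Z t)%R%:E)%E.
    rewrite /Rintegral fineK; last exact: integrable_fin_num.
    by apply: eq_integral => t _; rewrite /= ger0_norm.
  congr (_%:E); apply/eqP; rewrite eq_le Zle/=.
  by apply: Rintegral_ge0.
move=> /(ae_eq_integral_abs _ mr mZ); apply: ae_imp => t h tr.
by have := h _; rewrite /= in_itv => /(_ tr)[].
Unshelve. all: by end_near. Qed.

(** Two windows overlap, and [velocity] is injective: the constants agree. *)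
Lemma minimizer_is_derive : exists c, forall t,
  is_derive t (1 : R) u (velocity (primitive force t + c)).
Proof.
have [M fM] := force_bounded.
have n2 n : 2 <= n.+2%:R :> R by rewrite ler_nat.
have [c_ hc] := choice (fun n => euler_window fM (n2 n)).
pose p c t := velocity (primitive force t + c).
have cE n : c_ n = c_ 0%N.
  have lt2 : -2 < 2 :> R by lra.
  have [t /andP[t1 t2] [hn h0]] :=
    ae_witness lt2 (ae_imp2 (fun _ => @conj _ _) (hc n) (hc 0%N)).
  have tn : - n.+2%:R <= t <= n.+2%:R.
    by have := n2 n; move=> *; apply/andP; split; lra.
  have := hn tn; rewrite h0; last by rewrite t1 t2.
  by move=> /velocity_inj/addrI.
exists (c_ 0%N); apply: (@FTC_is_derive _ u (p (c_ 0%N))).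
  by apply: continuous_velocity_shift; exact: (lip_continuous (lip_primitive measurable_force fM)).
move=> s t st; rewrite -(lip_FTC st u1).
have mp : measurable_fun setT (p (c_ 0%N)).
  apply: continuous_measurable_fun; apply: continuous_velocity_shift.
  exact: (lip_continuous (lip_primitive measurable_force fM)).
apply: Rintegral_ae_eq => //.
- exact: measurable_funS mp.
- exact: measurable_funS (measurable_lip_derive u1).
have : {ae mu, forall x : R, forall n : nat, - n.+2%:R <= x <= n.+2%:R ->
    lip_derive u x = p (c_ 0%N) x}.
  by apply: ae_foralln => n; apply: ae_imp (hc n) => x; rewrite cE.
apply: ae_imp => x h _; apply/esym.
apply: (h (Num.bound `|x|)); rewrite -ler_norml ltW//.
by rewrite (lt_le_trans (archi_boundP (normr_ge0 x)))// ler_nat -addn2 leq_addr.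
Qed.

End Minimizer.

End Energy.

(** * The slope at infinity *)

Section SlopeAtInfinity.
Context {R : realType}.
Notation mu := (@lebesgue_measure R).
Implicit Types (u p : R -> R) (K h l : R).

Section Slope.
Variables (u p : R -> R) (K : R).
Hypotheses (up : forall t, is_derive t (1 : R) u (p t)) (pK : lip K p).

(** The mean value theorem gives a nearby point where the slope is the
    difference quotient. *)
Lemma slope_le t h : 0 < h -> `|p t| <= `|u (t + h) - u t| / h + K * h.
Proof.
move=> h0; have th : t <= t + h by rewrite lerDl ltW.
have [|x xth E] := @MVT_segment _ u p t (t + h) th.
  by apply: derivable_within_continuous => y _; exact: ex_derive.
move: xth; rewrite in_itv/= => /andP[tx xt].
rewrite E addrAC subrr add0r normrM (gtr0_norm h0) mulfK ?gt_eqF//.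
rewrite -{1}(subrK (p x) (p t)) addrC (le_trans (ler_normD _ _))// lerD2l.
rewrite (le_trans (pK _ _))// ler_wpM2l ?(lip_ge0 pK)//.
by rewrite distrC ger0_norm ?subr_ge0// lerBlDl.
Qed.

Lemma slope_small (e : R) : 0 < e -> exists h d : R, [/\ 0 < h, 0 < d &
  forall t l, `|l - u t| < d -> `|l - u (t + h)| < d -> `|p t| <= e].
Proof.
move=> e0; have K0 := lip_ge0 pK.
have K1 : 0 < K + 1 by rewrite ltr_wpDl.
pose h := e / 2 / (K + 1); have h0 : 0 < h by rewrite !divr_gt0.
have Kh : K * h <= e / 2.
  by rewrite /h mulrCA -[leRHS]mulr1 ler_wpM2l ?divr_ge0 ?(ltW e0)// ler_pdivrMr// mul1r lerDl.
exists h, (e / 4 * h); split => //; first by rewrite mulr_gt0// divr_gt0.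
move=> t l; rewrite (distrC l) => ut uth.
apply: (le_trans (slope_le t h0)); rewrite [leRHS](splitr e) lerD// ler_pdivrMr//.
have -> : u (t + h) - u t = - (l - u (t + h)) - (u t - l) by ring.
apply: (le_trans (ler_normB _ _)); rewrite normrN.
have -> : e / 2 * h = e / 4 * h + e / 4 * h by field.
by rewrite lerD// ltW.
Qed.

Lemma slope_cvgy l : u t @[t --> +oo] --> l -> p t @[t --> +oo] --> (0 : R).
Proof.
move=> ul; apply/cvgrPdist_le => e /slope_small[h [d [h0 d0 hp]]].
have [A [_ hA]] := (cvgrPdist_lt _ _).1 ul _ d0.
near=> t; have At : A < t by near: t; apply: nbhs_pinfty_gt; exact: num_real.
rewrite sub0r normrN; apply: (hp t l); apply: hA => //.
by rewrite (lt_le_trans At)// lerDl ltW.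
Unshelve. all: by end_near. Qed.

Lemma slope_cvgNy l : u t @[t --> -oo] --> l -> p t @[t --> -oo] --> (0 : R).
Proof.
move=> ul; apply/cvgrPdist_le => e /slope_small[h [d [h0 d0 hp]]].
have [A [_ hA]] := (cvgrPdist_lt _ _).1 ul _ d0.
near=> t; have At : t < A - h by near: t; apply: nbhs_ninfty_lt; exact: num_real.
rewrite sub0r normrN; apply: (hp t l); apply: hA; last by rewrite -ltrBrDr.
by rewrite (lt_le_trans At)// lerBlDr lerDl ltW.
Unshelve. all: by end_near. Qed.

End Slope.

Lemma vanishing_sup_lt1 p : continuous p -> (forall t, `|p t| < 1) ->
  p t @[t --> +oo] --> (0 : R) -> p t @[t --> -oo] --> (0 : R) ->
  exists2 d, d < 1 & forall t, `|p t| <= d.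
Proof.
move=> cp p1.
have half : 0 < 1 / 2 :> R by lra.
move=> /cvgrPdist_lt/(_ _ half)[A [_ hA]] /cvgrPdist_lt/(_ _ half)[B [_ hB]].
have out t : ~ (B <= t <= A) -> `|p t| < 1 / 2.
  move=> /negP; rewrite negb_and -!ltNge => /orP[/hB|/hA]; by rewrite sub0r normrN.
have [BA|AB] := leP B A; last first.
  exists (1 / 2); first by lra.
  move=> t; apply/ltW/out => /andP[Bt tA]; have := le_trans Bt tA.
  by rewrite leNgt AB.
have cnp : {within `[B, A], continuous (fun t => `|p t|)}.
  by apply: continuous_subspaceT => t; apply: cvg_norm; exact: cp.
have [x _ hx] := EVT_max BA cnp.
exists (Num.max (1 / 2) `|p x|); first by rewrite gt_max p1 andbT; lra.
move=> t; rewrite le_max; have [tBA|/negP/out/ltW->//] := boolP (B <= t <= A).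
by rewrite hx ?orbT// in_itv.
Qed.

Lemma bounded_L2loc p K : measurable_fun setT p -> (forall t, `|p t| <= K) -> L2loc p.
Proof.
move=> mp pK; split => //; apply: (@bounded_locally_integrable _ _ (K ^+ 2)).
  exact: measurable_funX.
move=> t; rewrite normrX ler_pXn2r ?nnegrE//.
exact: le_trans (pK t).
Qed.
End SlopeAtInfinity.

(** * The action and the theorem *)

Lemma actionE (R : realType) (W a b v : R -> R) : continuous W -> (forall s, 0 <= W s) ->
  lebesgue_measurable_fun a -> (forall t, 0 <= a t) ->
  measurable_fun [set: measurableTypeR R] b -> (forall t, 0 <= b t) ->
  {ae @lebesgue_measure R, forall t, a t = b t} -> lip 1 v ->
  action a W v = energy W b v.
Proof.
move=> cW W0 ma a0 mb b0 ab v1.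
have mWv : measurable_fun [set: measurableTypeR R] (fun t => W (v t)).
  by apply: measurableT_comp (measurable_lip v1) => //; exact: continuous_measurable_fun.
apply: eq_integral_completed.
- apply/measurable_EFinP; apply: measurable_funD.
    apply: borel_measurable_fun_lebesgue; apply: measurable_born_comp.
    exact: measurable_weak_derivative v1.
  apply: measurable_funM; first exact: ma.
  exact: borel_measurable_fun_lebesgue mWv.
- apply/measurable_EFinP; apply: measurable_funD.
    by apply: measurable_born_comp; exact: measurable_lip_derive v1.
  exact: measurable_funM.
- by move=> t; rewrite lee_fin addr_ge0 ?mulr_ge0//; exact: born_ge0.
- by move=> t; rewrite lee_fin addr_ge0 ?mulr_ge0//; exact: born_ge0.
- by apply: ae_imp2 (ae_weak_derivativeE v1) ab => t dv abt; rewrite /density -dv -abt.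
Qed.

Theorem theorem1p3 (R : realType) (W a : R -> R) (a1 a2 T : R)
  (W_C1 : C1 W)
  (W_N1 : W (-1) = 0) (W_1 : W 1 = 0)
  (W_gt0 : forall s, s != 1 -> s != -1 -> 0 < W s)
  (a_meas : lebesgue_measurable_fun a)
  (a1_gt0 : 0 < a1)
  (a_bounds : forall t, a1 <= a t <= a2)
  (T_gt0 : 0 < T)
  (a_periodic : periodic a T) :
  exists u : R -> R,
    [/\ X1 u,
        action a W u = ereal_inf [set action a W v | v in X1],
        C1 u /\ W22loc u /\ solves_equation a W u,
        (u t, derive1 u t) @[t --> +oo] --> ((1, 0) : R * R)
          /\ (u t, derive1 u t) @[t --> -oo] --> ((-1, 0) : R * R)
      & ('N[@lebesgue_measure R]_+oo[EFin \o derive1 u] < 1)%E].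
Proof.
have [N [mN N0]] := borel_representative a1 a_meas.
set b := (X in measurable_fun _ X) => mb.
have ab : {ae @lebesgue_measure R, forall t, a t = b t}.
  exists N; split => // t /=; apply: contra_notP => Nt.
  by rewrite /b ifF//; apply: memNset.
have b_bounds t : a1 <= b t <= a2.
  rewrite /b; case: ifP => // _; rewrite lexx/=.
  by have /andP[] := a_bounds 0; exact: le_trans.
have b_periodic : {ae @lebesgue_measure R, forall t, b (t + T) = b t}.
  by apply: ae_imp2 ab (ae_shift T ab) => t <- <-.
have [u [m [ut ub um umin]]] :=
  exists_minimizer W_C1 W_N1 W_1 W_gt0 mb a1_gt0 b_bounds T_gt0 b_periodic.
have [c du] := minimizer_is_derive W_C1 W_N1 W_1 W_gt0 mb a1_gt0 b_bounds
  ut um ub umin.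
have [u1 uy uNy] := ut.
have [M fM] := force_bounded W_C1 a1_gt0 b_bounds ub.
have mf := measurable_force W_C1 mb ut.
pose q t := primitive (force W b u) t + c.
have q1 : lip M q.
  by move=> x y; have := lip_primitive mf fM x y; congr (`|_| <= _); rewrite /q; ring.
have Du t : derive1 u t = velocity (q t) by rewrite derive1E; have [_ ->] := du t.
have DuE : derive1 u = velocity \o q by apply/funext => t; exact: Du.
have D1 t : `|derive1 u t| < 1 by rewrite Du velocity_lt1.
have D1' t : `|derive1 u t| <= 1 := ltW (D1 t).
have D_lip : lip (2 * M) (derive1 u).
  move=> x y; rewrite !Du (le_trans (velocity_lip _ _))// -mulrA ler_wpM2l//.
have cD := lip_continuous D_lip.
have duD t : is_derive t (1 : R) u (derive1 u t) by rewrite Du.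
have W0 : forall s, 0 <= W s := W_ge0 W_N1 W_1 W_gt0.
have a0 t : 0 <= a t by have /andP[h _] := a_bounds t; exact: le_trans (ltW a1_gt0) h.
have b0 t : 0 <= b t by have /andP[h _] := b_bounds t; exact: le_trans (ltW a1_gt0) h.
have actE v : lip 1 v -> action a W v = energy W b v.
  by apply: actionE => //; exact: continuous_W.
have Dy := slope_cvgy duD D_lip uy; have DNy := slope_cvgNy duD D_lip uNy.
have mD : measurable_fun setT (derive1 u) := continuous_measurable_fun cD.
exists u; split.
- exact/X1P.
- apply/eqP; rewrite eq_le; apply/andP; split.
    apply: le_ereal_inf_tmp => _ [v /X1P vt <-]; have [v1 _ _] := vt.
    by rewrite !actE// um umin.
  by apply: ereal_inf_lbound; exists u => //; exact/X1P.
- split; first by split; [move=> x; exact: ex_derive|exact: cD].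
  split.
    exists (derive1 u), (lip_derive (derive1 u)); split.
    + by apply: (lip_is_weak_derivative u1 mD D1'); exact: aeW.
    + apply: (lip_is_weak_derivative D_lip (measurable_lip_derive D_lip)).
        by move=> x; exact: lip_derive_bound D_lip.
      exact: ae_is_derive_lip D_lip.
    + exact: bounded_L2loc (measurable_lip u1) ub.
    + exact: bounded_L2loc mD D1'.
    + apply: (bounded_L2loc (measurable_lip_derive D_lip)) => t.
      exact: lip_derive_bound D_lip.
  exists (force W b u); split.
    rewrite (_ : (fun t => _) = q); last by apply/funext => t; rewrite Du velocityK.
    apply: (lip_is_weak_derivative q1 mf fM).
    apply: ae_imp (ae_is_derive_primitive mf fM) => t dq.
    by rewrite -[force _ _ _ t]addr0; exact: is_deriveD.
  by apply: ae_imp ab => t abt; rewrite /force abt.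
- by split; [exact: (cvg_pair uy Dy)|exact: (cvg_pair uNy DNy)].
- have [d d1 hd] := vanishing_sup_lt1 cD D1 Dy DNy.
  apply: (@le_lt_trans _ _ d%:E); last by rewrite lte_fin.
  by apply/Lnorm_ooP; apply: aeW.
Qed.
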